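(* Let $s>2$. For every sufficiently small $\delta>0$ and every sufficiently large $\mathcal{C}>0$ there exists $p_0=p_0(s,\delta,\mathcal{C})$ such that for every even integer $p\geq p_0$ the equation \[ u_{tt}-\Delta u+V_p*u+u^p=0,\qquad u=u(t,x),\ t\in\mathbb{R},\ x\in\mathbb{T}:=\mathbb{R}/2\pi\mathbb{Z}, \] with $V_p(x):=1+\cos(x)+p^2\cos(px)$, possesses a solution $u(t,x)$ such that $\|u(0)\|_{E^s}\le\delta$ and \[ \frac{\|u(T)\|_{E^s}}{\|u(0)\|_{E^s}}\geq\mathcal{C} \] at a time $T=\mathcal{O}\big(2^p\,p^{-1}\,\|u(0)\|_{E^s}^{1-p}\big)$.
   Context: For $s\in\mathbb{R}$ and $u=\sum_{j\in\mathbb{Z}}u_je^{\mathrm{i}jx}$, $\|u\|_s^2:=\sum_{j\in\mathbb{Z}}|u_j|^2\langle j\rangle^{2s}$ with $\langle j\rangle:=\max\{1,|j|\}$, and $H^s$ is the corresponding Sobolev space on $\mathbb{T}$. The norm $\|u\|_{E^s}:=\|u\|_{s+1/2}+\|u_t\|_{s-1/2}$. The convolution term $V_p*u$ is the Fourier multiplier $e^{\mathrm{i}jx}\mapsto V_j e^{\mathrm{i}jx}$ with $V_0=1$, $V_{\pm1}=1$, $V_{\pm p}=p^2$ and $V_j=0$ otherwise, so that the linear frequencies $\omega(j)=\sqrt{j^2+V_j}$ equal $1$ for $j=0$, $\sqrt2|j|$ for $j\in\{\pm1,\pm p\}$, and $|j|$ otherwise. ''Sufficiently small/large'' means below/above some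 universal constant. The notation $A=\mathcal{O}(B)$ means there exist pure constants $0<C_1<C_2$ with $C_1B\le A\le C_2B$. *)

(* Defs.v *)
From Stdlib Require Import Reals Lra.
From Coquelicot Require Import Coquelicot.
Open Scope R_scope.

(* Real Fourier data of a 2*PI-periodic real function f:
   f_j = (1/2pi) int_0^{2pi} f(y) e^{-ijy} dy = fc_cos f j - i * fc_sin f j. *)
Definition fc_cos (f : R -> R) (j : nat) : R :=
  / (2 * PI) * RInt (fun y => f y * cos (INR j * y)) 0 (2 * PI).
Definition fc_sin (f : R -> R) (j : nat) : R :=
  / (2 * PI) * RInt (fun y => f y * sin (INR j * y)) 0 (2 * PI).

(* |f_j|^2 = |f_{-j}|^2 for real f *)
Definition fc_sq (f : R -> R) (j : nat) : R := fc_cos f j ^ 2 + fc_sin f j ^ 2.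

Definition Hs_terms (r : R) (f : R -> R) (k : nat) : R :=
  Rpower (INR (S k)) (2 * r) * fc_sq f (S k).

Definition Hs_fin (r : R) (f : R -> R) : Prop := ex_series (Hs_terms r f).

(* ||f||_r^2 = |f_0|^2 + sum_{j <> 0} |j|^{2r} |f_j|^2  (<0> = 1) *)
Definition Hs_norm (r : R) (f : R -> R) : R :=
  sqrt (fc_sq f 0 + 2 * Series (Hs_terms r f)).

Definition dt (u : R -> R -> R) (t : R) : R -> R :=
  fun x => Derive (fun tau => u tau x) t.

Definition Es_norm (s : R) (u : R -> R -> R) (t : R) : R :=
  Hs_norm (s + /2) (u t) + Hs_norm (s - /2) (dt u t).

(* V_p * f : Fourier multiplier with V_0 = 1, V_{+-1} = 1, V_{+-p} = p^2, V_j = 0 else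
   (convolution (1/2pi) int K(x-y) f(y) dy with K(x) = 1 + 2 cos x + 2 p^2 cos(px)). *)
Definition Vconv (p : nat) (f : R -> R) (x : R) : R :=
  / (2 * PI) * RInt f 0 (2 * PI)
  + / PI * RInt (fun y => f y * cos (x - y)) 0 (2 * PI)
  + (INR p) ^ 2 / PI * RInt (fun y => f y * cos (INR p * (x - y))) 0 (2 * PI).

Definition is_solution (s : R) (p : nat) (u : R -> R -> R) (T : R) : Prop :=
  (forall t x, u t (x + 2 * PI) = u t x) /\
  (exists eps, 0 < eps /\
     forall t, - eps < t < T + eps ->
       forall x,
         ex_derive (fun tau => u tau x) t /\
         ex_derive (fun tau => Derive (fun sig => u sig x) tau) t /\
         ex_derive (fun y => u t y) x /\
         ex_derive (fun y => Derive (fun z => u t z) y) x /\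
         Derive (fun tau => Derive (fun sig => u sig x) tau) t
         - Derive (fun y => Derive (fun z => u t z) y) x
         + Vconv p (u t) x + (u t x) ^ p = 0) /\
  (forall t, 0 <= t <= T -> Hs_fin (s + /2) (u t) /\ Hs_fin (s - /2) (dt u t)).

(* Main.v *)
Require Import Defs.
From Stdlib Require Import Reals Arith Lra Lia List FunctionalExtensionality.
From Coquelicot Require Import Coquelicot.
Open Scope R_scope.

(** Write [u = A y] with [eps = A^(p-1)] and [c + d = 1]. The linear solution
    [Y = c cos t + d cos 2t cos 2x] has integer frequencies, as do all wave modes [j <> 0, 1, p].
    Since [p] is even, [Y^p >= 0] is a sum of peaks of width [p^(-1/2)] in [t] and [x], and it forces
    all modes [j] in [4 Z] with [j <= const p^(1/2)] resonantly, with the same strength of order [1/p].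

    A contraction in the Wiener algebra with weights [(1 + 1/p)^j] shows that [y] stays within [1/p]
    of [Y], hence [y^p] comparable to [Y^p], as long as [eps T <= const / log p]: the Duhamel integral
    of a mode [j <= p] gains a factor [1/p] from the concentration of the peaks, and a mode [j > p]
    gains it from its frequency. The resonant modes start from rest, so if [T] is a multiple of [2 pi]
    their velocities satisfy [|y_j'(T)| >= const / (p log p)], and summing about [p^(1/2)] of them gives
    an [E^s] norm of at least [const p^(s/2-1) / log p], which is unbounded for [s > 2].

    The time scale [2^p p^(-1) N^(1-p)] is reached by varying [d]: this changes the norm [N] of the data
    between [3 A / 2] and [2 A], while the dynamics only depends on the supremum [A (c + d)]. *)

(** * Continuous functions and their integrals *)

Lemma continuity_continuous (f : R -> R) (x : R) : continuity f -> continuous f x.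
Proof. intros f_cont. apply continuity_pt_filterlim, f_cont. Qed.

Lemma continuity_is_derive (f f' : R -> R) : (forall x, is_derive f x (f' x)) -> continuity f.
Proof.
  intros f_derive x. apply continuity_pt_filterlim.
  apply (@ex_derive_continuous R_AbsRing R_NormedModule). now exists (f' x).
Qed.

Lemma continuity_Rabs_le (f : R -> R) :
  continuity f <->
  forall x e, 0 < e -> exists d, 0 < d /\ forall y, Rabs (y - x) < d -> Rabs (f y - f x) <= e.
Proof.
  split.
  - intros f_cont x e e_pos. destruct (f_cont x e e_pos) as (d & d_pos & f_near).
    exists d. split; [exact d_pos|]. intros y y_near.
    destruct (Req_dec x y) as [<-|x_neq_y]; [rewrite Rminus_diag, Rabs_R0; lra|].
    apply Rlt_le, f_near. now repeat split.
  - intros f_near x e e_pos. destruct (f_near x (e / 2)) as (d & d_pos & f_near_x); [lra|].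
    exists d. split; [exact d_pos|]. intros y [_ y_near].
    apply Rle_lt_trans with (e / 2); [now apply f_near_x | lra].
Qed.

Lemma continuity_sum_f_R0 (f : nat -> R -> R) (n : nat) :
  (forall k, continuity (f k)) -> continuity (fun x => sum_f_R0 (fun k => f k x) n).
Proof.
  intros f_cont. induction n as [|n IH]; [exact (f_cont 0%nat)|].
  exact (continuity_plus _ _ IH (f_cont (S n))).
Qed.

Lemma ex_RInt_continuity (f : R -> R) (a b : R) : continuity f -> ex_RInt f a b.
Proof.
  intros f_cont. apply (@ex_RInt_continuous R_CompleteNormedModule).
  intros x _. now apply continuity_continuous.
Qed.

Lemma RInt_eq (f g : R -> R) (a b : R) : (forall x, f x = g x) -> RInt f a b = RInt g a b.
Proof. intros f_eq_g. apply RInt_ext. intros; apply f_eq_g. Qed.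

Lemma RInt_Rplus (f g : R -> R) (a b : R) : continuity f -> continuity g ->
  RInt (fun x => f x + g x) a b = RInt f a b + RInt g a b.
Proof. intros f_cont g_cont. apply (RInt_plus f g); now apply ex_RInt_continuity. Qed.

Lemma RInt_Rminus (f g : R -> R) (a b : R) : continuity f -> continuity g ->
  RInt (fun x => f x - g x) a b = RInt f a b - RInt g a b.
Proof. intros f_cont g_cont. apply (RInt_minus f g); now apply ex_RInt_continuity. Qed.

Lemma RInt_Rmult (k : R) (f : R -> R) (a b : R) : continuity f ->
  RInt (fun x => k * f x) a b = k * RInt f a b.
Proof. intros f_cont. apply (RInt_scal f a b k). now apply ex_RInt_continuity. Qed.

Lemma RInt_Rconst (k a b : R) : RInt (fun _ => k) a b = (b - a) * k.
Proof. now rewrite RInt_const. Qed.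

Lemma RInt_concat (f : R -> R) (a b c : R) : continuity f ->
  RInt f a b + RInt f b c = RInt f a c.
Proof. intros f_cont. apply (RInt_Chasles f a b c); now apply ex_RInt_continuity. Qed.

Lemma RInt_nonneg (f : R -> R) (a b : R) : a <= b -> continuity f ->
  (forall x, 0 <= f x) -> 0 <= RInt f a b.
Proof. intros a_le_b f_cont f_nonneg. apply RInt_ge_0; auto using ex_RInt_continuity. Qed.

Lemma RInt_mono (f g : R -> R) (a b : R) : a <= b -> continuity f -> continuity g ->
  (forall x, a <= x <= b -> f x <= g x) -> RInt f a b <= RInt g a b.
Proof.
  intros a_le_b f_cont g_cont f_le_g. apply RInt_le; auto using ex_RInt_continuity.
  intros x x_in. apply f_le_g. lra.
Qed.

Lemma RInt_ge_const (f : R -> R) (a k l v : R) : 0 <= k <= l -> continuity f ->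
  (forall x, 0 <= f x) -> (forall x, a <= x <= a + k -> v <= f x) -> k * v <= RInt f a (a + l).
Proof.
  intros k_in f_cont f_nonneg f_ge. rewrite <- (RInt_concat f a (a + k)) by exact f_cont.
  assert (rest : 0 <= RInt f (a + k) (a + l)) by (apply RInt_nonneg; auto; lra).
  assert (near : RInt (fun _ => v) a (a + k) <= RInt f a (a + k))
    by (apply RInt_mono; [lra | reg | exact f_cont | exact f_ge]).
  rewrite RInt_Rconst in near. lra.
Qed.

Lemma Rabs_RInt_le (f g : R -> R) (a b : R) : a <= b -> continuity f -> continuity g ->
  (forall x, Rabs (f x) <= g x) -> Rabs (RInt f a b) <= RInt g a b.
Proof.
  intros a_le_b f_cont g_cont f_le_g.
  apply Rle_trans with (RInt (fun x => Rabs (f x)) a b).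
  - apply abs_RInt_le; auto using ex_RInt_continuity.
  - apply RInt_mono; auto. reg.
Qed.

Lemma RInt_sum_f_R0 (f : nat -> R -> R) (n : nat) (a b : R) : (forall k, continuity (f k)) ->
  RInt (fun x => sum_f_R0 (fun k => f k x) n) a b = sum_f_R0 (fun k => RInt (f k) a b) n.
Proof.
  intros f_cont. induction n as [|n IH]; [reflexivity|]. simpl. rewrite <- IH.
  apply (RInt_Rplus (fun x => sum_f_R0 (fun k => f k x) n)); auto using continuity_sum_f_R0.
Qed.

Lemma is_derive_RInt_continuity (f : R -> R) (a x : R) : continuity f ->
  is_derive (fun t => RInt f a t) x (f x).
Proof.
  intros f_cont.
  apply (is_derive_RInt f (fun t => RInt f a t) a x); [|now apply continuity_continuous].
  apply filter_forall. intros y. apply (RInt_correct f). now apply ex_RInt_continuity.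
Qed.

Lemma Rabs_RInt_le_support (f g : R -> R) (a b c t : R) :
  continuity f -> continuity g -> (forall s, Rabs (f s) <= g s) ->
  (forall s, s < a \/ b < s -> g s = 0) -> Rabs (RInt f c t) <= RInt g a b.
Proof.
  intros f_cont g_cont f_le_g g_supp.
  assert (g_nonneg : forall s, 0 <= g s).
  { intros s. eapply Rle_trans; [apply Rabs_pos | apply f_le_g]. }
  assert (mass_nonneg : forall u v, u <= v -> 0 <= RInt g u v) by (intros; now apply RInt_nonneg).
  assert (mass_outside : forall u v, u <= v -> v <= a \/ b <= u -> RInt g u v = 0).
  { intros u v u_le_v outside. rewrite (RInt_ext g (fun _ => 0)), RInt_Rconst; [apply Rmult_0_r|].
    intros s. rewrite Rmin_left, Rmax_right by lra. intros s_in. apply g_supp. lra. }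
  assert (mass_le : forall u v, u <= v -> RInt g u v <= RInt g (Rmin a u) (Rmax b v)).
  { intros u v u_le_v. rewrite <- (RInt_concat g (Rmin a u) u), <- (RInt_concat g u v (Rmax b v))
      by exact g_cont.
    pose proof (mass_nonneg (Rmin a u) u (Rmin_r a u)).
    pose proof (mass_nonneg v (Rmax b v) (Rmax_r b v)). lra. }
  assert (mass_hull : forall u v, RInt g (Rmin a u) (Rmax b v) = RInt g a b).
  { intros u v. rewrite <- (RInt_concat g (Rmin a u) a), <- (RInt_concat g a b (Rmax b v))
      by exact g_cont.
    rewrite (mass_outside (Rmin a u) a), (mass_outside b (Rmax b v));
      auto using Rmin_l, Rmax_l, Rle_refl.
    now rewrite Rplus_0_l, Rplus_0_r. }
  destruct (Rle_dec c t) as [c_le_t|t_lt_c].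
  - rewrite <- (mass_hull c t). eapply Rle_trans; [|now apply mass_le]. now apply Rabs_RInt_le.
  - rewrite <- (opp_RInt_swap f t c) by now apply ex_RInt_continuity.
    unfold opp; simpl. rewrite Rabs_Ropp, <- (mass_hull t c).
    eapply Rle_trans; [|apply mass_le; lra]. apply Rabs_RInt_le; auto; lra.
Qed.

Section Periodic.

Variables (f : R -> R) (P : R).
Hypothesis f_cont : continuity f.
Hypothesis f_periodic : forall t, f (t + P) = f t.

Lemma RInt_shift (a b : R) : RInt f (a + P) (b + P) = RInt f a b.
Proof.
  pose proof (RInt_comp_lin f 1 P a b (ex_RInt_continuity f _ _ f_cont)) as shift.
  rewrite !Rmult_1_l in shift. rewrite <- shift. apply RInt_eq. intros t.
  unfold scal; simpl; unfold mult; simpl. now rewrite !Rmult_1_l, f_periodic.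
Qed.

Lemma RInt_period (a : R) : RInt f a (a + P) = RInt f 0 P.
Proof.
  rewrite <- (RInt_concat f a 0), <- (RInt_concat f 0 P) by exact f_cont.
  pose proof (RInt_shift 0 a) as tail. rewrite Rplus_0_l in tail. rewrite tail.
  pose proof (RInt_concat f a 0 a f_cont) as loop. rewrite RInt_point in loop.
  change (RInt f a 0 + RInt f 0 a = 0) in loop. lra.
Qed.

Lemma RInt_periods (a : R) (n : nat) : RInt f a (a + INR n * P) = INR n * RInt f 0 P :> R.
Proof.
  induction n as [|n IH].
  - simpl. rewrite !Rmult_0_l, Rplus_0_r. exact (RInt_point a f).
  - rewrite <- (RInt_concat f a (a + INR n * P)), IH, S_INR by exact f_cont.
    replace (a + (INR n + 1) * P) with (a + INR n * P + P) by ring. rewrite RInt_period. ring.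
Qed.

End Periodic.

Lemma RInt_blocks_ge (f : R -> R) (P M : R) (n : nat) : continuity f ->
  (forall i, M <= RInt f (INR i * P) (INR i * P + P)) -> INR n * M <= RInt f 0 (INR n * P).
Proof.
  intros f_cont block_ge. induction n as [|n IH].
  - simpl. rewrite !Rmult_0_l, RInt_point. apply Rle_refl.
  - rewrite <- (RInt_concat f 0 (INR n * P)) by exact f_cont. specialize (block_ge n).
    rewrite S_INR. replace ((INR n + 1) * P) with (INR n * P + P) by ring. lra.
Qed.

(** * Sums and series *)

Definition kronecker (i j : nat) : R := if Nat.eq_dec i j then 1 else 0.

Lemma kronecker_eq (i : nat) : kronecker i i = 1.
Proof. unfold kronecker. now destruct (Nat.eq_dec i i). Qed.

Lemma kronecker_neq (i j : nat) : i <> j -> kronecker i j = 0.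
Proof. intros i_neq_j. unfold kronecker. now destruct (Nat.eq_dec i j). Qed.

Lemma sum_kronecker (j n : nat) (f : nat -> R) :
  sum_f_R0 (fun k => kronecker j k * f k) n = if le_dec j n then f j else 0.
Proof.
  induction n as [|n IH]; simpl.
  - destruct (le_dec j 0) as [j_le|j_gt].
    + replace j with 0%nat by lia. rewrite kronecker_eq. ring.
    + rewrite kronecker_neq by lia. ring.
  - rewrite IH. destruct (Nat.eq_dec j (S n)) as [->|j_neq].
    + rewrite kronecker_eq. destruct (le_dec (S n) n), (le_dec (S n) (S n)); try lia. ring.
    + rewrite kronecker_neq by exact j_neq.
      destruct (le_dec j n), (le_dec j (S n)); try lia; ring.
Qed.

Lemma sum_f_R0_mono (a : nat -> R) (n m : nat) :
  (forall i, 0 <= a i) -> (n <= m)%nat -> sum_f_R0 a n <= sum_f_R0 a m.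
Proof.
  intros a_nonneg n_le_m. induction n_le_m as [|m n_le_m IH]; [apply Rle_refl|].
  rewrite tech5. specialize (a_nonneg (S m)). lra.
Qed.

Lemma sum_f_R0_ge_term (a : nat -> R) (n k : nat) :
  (forall i, 0 <= a i) -> (k <= n)%nat -> a k <= sum_f_R0 a n.
Proof.
  intros a_nonneg k_le_n. eapply Rle_trans; [|now apply (sum_f_R0_mono a k n)].
  destruct k as [|k]; [apply Rle_refl|]. rewrite tech5. pose proof (cond_pos_sum a k a_nonneg). lra.
Qed.

Lemma is_series_sum_f_R0 (a : nat -> R) (l : R) :
  is_series a l <-> is_lim_seq (fun n => sum_f_R0 a n) l.
Proof.
  split; intros sum_lim.
  - apply is_lim_seq_ext with (2 := sum_lim). intros n. apply sum_n_Reals.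
  - apply is_lim_seq_ext with (v := fun n => sum_n a n) in sum_lim; [exact sum_lim|].
    intros n. now rewrite sum_n_Reals.
Qed.

Lemma is_lim_seq_sum_f_R0 (a : nat -> R) :
  ex_series a -> is_lim_seq (fun n => sum_f_R0 a n) (Series a).
Proof. intros a_summable. now apply is_series_sum_f_R0, Series_correct. Qed.

Lemma is_series_kronecker (n : nat) (f : nat -> R) : is_series (fun k => kronecker n k * f k) (f n).
Proof.
  apply is_series_sum_f_R0, is_lim_seq_ext_loc with (fun _ => f n); [|apply is_lim_seq_const].
  exists n. intros m n_le_m. rewrite sum_kronecker. now destruct (le_dec n m).
Qed.

Lemma Series_eq_0 (a : nat -> R) : (forall k, a k = 0) -> Series a = 0.
Proof.
  intros a_eq_0. apply is_series_unique, is_series_sum_f_R0.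
  apply is_lim_seq_ext with (fun _ => 0); [|apply is_lim_seq_const].
  intros n. symmetry. now apply sum_eq_R0.
Qed.

Lemma ex_series_Rabs_le (a b : nat -> R) :
  ex_series b -> (forall k, Rabs (a k) <= b k) -> ex_series a.
Proof.
  intros b_summable a_le_b.
  exact (@ex_series_le R_AbsRing R_CompleteNormedModule a b a_le_b b_summable).
Qed.

Lemma Rabs_sum_gap_le (a b : nat -> R) (n m : nat) : (forall k, Rabs (a k) <= b k) ->
  (n <= m)%nat -> Rabs (sum_f_R0 a m - sum_f_R0 a n) <= sum_f_R0 b m - sum_f_R0 b n.
Proof.
  intros a_le_b n_le_m. induction n_le_m as [|m n_le_m IH].
  - rewrite !Rminus_diag, Rabs_R0. lra.
  - rewrite !tech5. specialize (a_le_b (S m)).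
    apply Rabs_le_between in IH, a_le_b. apply Rabs_le. lra.
Qed.

Lemma Rabs_Series_tail_le (a b : nat -> R) (n : nat) : ex_series b ->
  (forall k, Rabs (a k) <= b k) -> Rabs (Series a - sum_f_R0 a n) <= Series b - sum_f_R0 b n.
Proof.
  intros b_summable a_le_b.
  assert (gap_lim : forall c, ex_series c ->
    is_lim_seq (fun m => sum_f_R0 c (m + n) - sum_f_R0 c n) (Series c - sum_f_R0 c n)).
  { intros c c_summable. apply is_lim_seq_minus'; [|apply is_lim_seq_const].
    now apply (is_lim_seq_incr_n (fun m => sum_f_R0 c m) n), is_lim_seq_sum_f_R0. }
  pose proof (is_lim_seq_abs _ _ (gap_lim a (ex_series_Rabs_le a b b_summable a_le_b))) as a_lim.
  refine (is_lim_seq_le _ _ _ _ _ a_lim (gap_lim b b_summable)).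
  intros m. apply Rabs_sum_gap_le; [exact a_le_b | lia].
Qed.

Lemma sum_f_R0_le_Series (a : nat -> R) (n : nat) : ex_series a -> (forall k, 0 <= a k) ->
  sum_f_R0 a n <= Series a.
Proof.
  intros a_summable a_nonneg.
  pose proof (Rabs_Series_tail_le (fun _ => 0) a n a_summable) as tail.
  apply Rminus_le_0. eapply Rle_trans; [apply Rabs_pos | apply tail].
  intros k. now rewrite Rabs_R0.
Qed.

Lemma CVU_Series (f : nat -> R -> R) (b : nat -> R) : ex_series b ->
  (forall k x, Rabs (f k x) <= b k) ->
  CVU_dom (fun n x => sum_f_R0 (fun k => f k x) n) (fun _ => True).
Proof.
  intros b_summable f_le_b e.
  pose proof (is_lim_seq_sum_f_R0 b b_summable) as b_lim. apply is_lim_seq_spec in b_lim.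
  destruct (b_lim e) as [N b_near]. exists N. intros n N_le_n x _.
  pose proof (Rabs_Series_tail_le (fun k => f k x) b n b_summable (fun k => f_le_b k x)) as tail.
  pose proof (ex_series_Rabs_le (fun k => f k x) b b_summable (fun k => f_le_b k x)) as f_summable.
  rewrite (is_lim_seq_unique _ _ (is_lim_seq_sum_f_R0 _ f_summable)). simpl.
  specialize (b_near n N_le_n). simpl in b_near.
  rewrite Rabs_minus_sym in tail. apply Rabs_lt_between in b_near. lra.
Qed.

Lemma is_derive_sum_f_R0 (f f' : nat -> R -> R) (n : nat) (x : R) :
  (forall k, is_derive (f k) x (f' k x)) ->
  is_derive (fun x => sum_f_R0 (fun k => f k x) n) x (sum_f_R0 (fun k => f' k x) n).
Proof.
  intros f_derive. induction n as [|n IH]; simpl; [apply f_derive|].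
  now apply (is_derive_plus (fun x => sum_f_R0 (fun k => f k x) n)).
Qed.

Section TermwiseDerivative.

Variables (f f' : nat -> R -> R) (b b' : nat -> R).
Hypothesis b_summable : ex_series b.
Hypothesis b'_summable : ex_series b'.
Hypothesis f_le_b : forall k x, Rabs (f k x) <= b k.
Hypothesis f'_le_b' : forall k x, Rabs (f' k x) <= b' k.
Hypothesis f_derive : forall k x, is_derive (f k) x (f' k x).
Hypothesis f'_cont : forall k, continuity (f' k).

Lemma is_derive_Series (x : R) :
  is_derive (fun x => Series (fun k => f k x)) x (Series (fun k => f' k x)).
Proof.
  assert (partial_derive : forall n y,
    Derive (fun x => sum_f_R0 (fun k => f k x) n) y = sum_f_R0 (fun k => f' k y) n).
  { intros n y. apply is_derive_unique, is_derive_sum_f_R0. intros; apply f_derive. }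
  assert (f_lim : forall y,
    Lim_seq (fun n => sum_f_R0 (fun k => f k y) n) = Series (fun k => f k y)).
  { intros y. apply is_lim_seq_unique, is_lim_seq_sum_f_R0, (ex_series_Rabs_le _ b b_summable).
    intros; apply f_le_b. }
  assert (f'_lim : Lim_seq (fun n => Derive (fun x => sum_f_R0 (fun k => f k x) n) x)
    = Series (fun k => f' k x)).
  { rewrite (Lim_seq_ext _ _ (fun n => partial_derive n x)).
    apply is_lim_seq_unique, is_lim_seq_sum_f_R0, (ex_series_Rabs_le _ b' b'_summable).
    intros; apply f'_le_b'. }
  apply is_derive_ext with (fun y => real (Lim_seq (fun n => sum_f_R0 (fun k => f k y) n))).
  { intros y. now rewrite f_lim. }
  change (Series (fun k => f' k x)) with (real (Finite (Series (fun k => f' k x)))).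
  rewrite <- f'_lim.
  apply (CVU_Derive (fun n x => sum_f_R0 (fun k => f k x) n) (fun _ => True)); try easy.
  - apply open_true.
  - now apply CVU_Series with b.
  - intros n y _. exists (sum_f_R0 (fun k => f' k y) n). apply is_derive_sum_f_R0.
    intros; apply f_derive.
  - intros n y _. apply (continuity_pt_ext (fun y => sum_f_R0 (fun k => f' k y) n)).
    + intros z. symmetry. apply partial_derive.
    + now apply continuity_sum_f_R0.
  - intros e. destruct (CVU_Series f' b' b'_summable f'_le_b' e) as [N f'_near]. exists N.
    intros n N_le_n y y_in. rewrite partial_derive, (Lim_seq_ext _ _ (fun n => partial_derive n y)).
    now apply f'_near.
Qed.

End TermwiseDerivative.

(** * Geometric decay *)

Lemma Rinv_gt_1 (q : R) : 1 < q -> 0 < / q < 1.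
Proof.
  intros q_gt_1. split; [apply Rinv_0_lt_compat; lra|].
  rewrite <- Rinv_1. apply Rinv_lt_contravar; lra.
Qed.

Lemma is_lim_seq_geom_scal (B r : R) : 0 <= r < 1 -> is_lim_seq (fun n => B * r ^ n) 0.
Proof.
  intros r_in. replace (Finite 0) with (Rbar_mult B 0) by (simpl; now rewrite Rmult_0_r).
  apply is_lim_seq_scal_l, is_lim_seq_geom. rewrite Rabs_pos_eq; lra.
Qed.

Lemma geom_eventually_le (B r e : R) : 0 <= r < 1 -> 0 < e ->
  exists N, forall n, (N <= n)%nat -> B * r ^ n <= e.
Proof.
  intros r_in e_pos. pose proof (is_lim_seq_geom_scal B r r_in) as lim_0.
  apply is_lim_seq_spec in lim_0. destruct (lim_0 (mkposreal e e_pos)) as [N near_0].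
  exists N. intros n N_le_n. specialize (near_0 n N_le_n). simpl in near_0.
  rewrite Rminus_0_r in near_0. apply Rabs_lt_between in near_0. lra.
Qed.

Lemma ex_series_geom_le (a : nat -> R) (B r : R) : 0 <= r < 1 ->
  (forall k, Rabs (a k) <= B * r ^ k) -> ex_series a.
Proof.
  intros r_in a_le. apply (ex_series_Rabs_le a (fun k => B * r ^ k)); [|exact a_le].
  apply (@ex_series_scal_l R_AbsRing), ex_series_geom. rewrite Rabs_pos_eq; lra.
Qed.

Lemma is_series_geom_tail (a : nat -> R) (l B r : R) : 0 <= r < 1 ->
  (forall n, Rabs (l - sum_f_R0 a n) <= B * r ^ n) -> is_series a l.
Proof.
  intros r_in tail. apply is_series_sum_f_R0.
  apply is_lim_seq_ext with (fun n => l - (l - sum_f_R0 a n)); [intros n; ring|].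
  replace (Finite l) with (Finite (l - 0)) by (f_equal; ring).
  apply is_lim_seq_minus'; [apply is_lim_seq_const|].
  apply is_lim_seq_abs_0, is_lim_seq_le_le with (u := fun _ => 0) (w := fun n => B * r ^ n).
  - intros n. split; [apply Rabs_pos | apply tail].
  - apply is_lim_seq_const.
  - now apply is_lim_seq_geom_scal.
Qed.

Lemma ln_le_minus_1 (x : R) : 0 < x -> ln x <= x - 1.
Proof.
  intros x_pos. pose proof (exp_ineq1_le (ln x)) as ineq. rewrite exp_ln in ineq; lra.
Qed.

Lemma ln_INR_nonneg (n : nat) : (1 <= n)%nat -> 0 <= ln (INR n).
Proof. intros n_ge_1. rewrite <- ln_1. apply ln_le; [lra | now apply (le_INR 1)]. Qed.

Lemma exp_le_mono (x y : R) : x <= y -> exp x <= exp y.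
Proof. intros [x_lt_y | ->]; [now apply Rlt_le, exp_increasing | apply Rle_refl]. Qed.

Lemma exp_pow (x : R) (n : nat) : exp x ^ n = exp (INR n * x).
Proof. rewrite <- Rpower_pow by apply exp_pos. unfold Rpower. now rewrite ln_exp. Qed.

(* The weight costs half of the decay rate: [ln x <= L x / A - 1 + ln (A / L)] with
   [L = - ln (sqrt r)] and [A > a]. *)
Lemma Rpower_geom_le (a r : R) : 0 < r < 1 ->
  exists M, forall k, Rpower (INR (S k)) a * r ^ k <= M * sqrt r ^ k.
Proof.
  intros r_in. set (rho := sqrt r). assert (rho_pos : 0 < rho) by (apply sqrt_lt_R0; lra).
  assert (rho_sq : rho * rho = r) by (apply sqrt_sqrt; lra).
  set (L := - ln rho).
  assert (L_pos : 0 < L) by (assert (ln rho < 0) by (rewrite <- ln_1; apply ln_increasing; nra);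
    unfold L; lra).
  set (A := Rabs a + 1). assert (a_lt_A : a < A) by (pose proof (Rle_abs a); unfold A; lra).
  assert (A_pos : 0 < A) by (pose proof (Rabs_pos a); unfold A; lra).
  exists (exp (L - A + A * ln (A / L))). intros k.
  rewrite <- rho_sq, Rpow_mult_distr, <- Rmult_assoc.
  apply Rmult_le_compat_r; [apply pow_le; lra|].
  assert (k_pos : 0 < INR (S k)) by (apply lt_0_INR; lia).
  rewrite <- (Rpower_pow k rho) by exact rho_pos. unfold Rpower. rewrite <- exp_plus.
  apply exp_le_mono. replace (ln rho) with (- L) by (unfold L; ring).
  pose proof (ln_INR_nonneg (S k) ltac:(lia)) as ln_nonneg.
  assert (AL_pos : 0 < A / L) by now apply Rdiv_lt_0_compat.
  pose proof (ln_le_minus_1 (INR (S k) * / (A / L))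
    (Rmult_lt_0_compat _ _ k_pos (Rinv_0_lt_compat _ AL_pos))) as ln_le.
  rewrite ln_mult, ln_Rinv in ln_le by (auto using Rinv_0_lt_compat).
  assert (scaled : A * (ln (INR (S k)) - ln (A / L)) <= A * (INR (S k) * / (A / L) - 1))
    by (apply Rmult_le_compat_l; lra).
  replace (A * (INR (S k) * / (A / L) - 1)) with (L * INR (S k) - A) in scaled by (field; lra).
  rewrite S_INR in *. nra.
Qed.

Lemma ex_series_Rpower_geom (s M r : R) (a : nat -> R) : 0 < r < 1 ->
  (forall k, Rabs (a k) <= M * r ^ k) -> ex_series (fun k => Rpower (INR (S k)) s * a k).
Proof.
  intros r_in a_le. destruct (Rpower_geom_le s r r_in) as [M' weight_le].
  assert (sqrt_r_in : 0 <= sqrt r < 1).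
  { split; [apply sqrt_pos|]. rewrite <- sqrt_1. apply sqrt_lt_1; lra. }
  apply ex_series_geom_le with (M * M') (sqrt r); [exact sqrt_r_in|]. intros k.
  assert (M_nonneg : 0 <= M)
    by (specialize (a_le 0%nat); pose proof (Rabs_pos (a 0%nat)); simpl in a_le; lra).
  rewrite Rabs_mult, (Rabs_pos_eq (Rpower _ _)) by apply Rlt_le, exp_pos.
  apply Rle_trans with (Rpower (INR (S k)) s * (M * r ^ k)).
  - apply Rmult_le_compat_l; [apply Rlt_le, exp_pos | apply a_le].
  - replace (Rpower (INR (S k)) s * (M * r ^ k)) with (M * (Rpower (INR (S k)) s * r ^ k)) by ring.
    rewrite Rmult_assoc. apply Rmult_le_compat_l; [exact M_nonneg | apply weight_le].
Qed.

Lemma ex_series_pow_geom (m : nat) (M r : R) (a : nat -> R) : 0 < r < 1 ->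
  (forall k, Rabs (a k) <= M * r ^ k) -> ex_series (fun k => INR (S k) ^ m * a k).
Proof.
  intros r_in a_le. apply ex_series_ext with (2 := ex_series_Rpower_geom (INR m) M r a r_in a_le).
  intros k. rewrite Rpower_pow; [reflexivity|]. apply lt_0_INR; lia.
Qed.

Definition weighted_l1 (q B : R) (a : nat -> R) : Prop :=
  forall n, sum_f_R0 (fun k => Rabs (a k) * q ^ k) n <= B.

Section WeightedL1.

Variables (q B : R) (a : nat -> R).
Hypothesis a_l1 : weighted_l1 q B a.

Lemma weighted_l1_decay (k : nat) : 1 <= q -> Rabs (a k) <= B * (/ q) ^ k.
Proof.
  intros q_ge_1. assert (pow_pos : 0 < q ^ k) by (apply pow_lt; lra).
  rewrite pow_inv. apply Rmult_le_reg_r with (q ^ k); [exact pow_pos|].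
  rewrite Rmult_assoc, Rinv_l, Rmult_1_r by lra.
  eapply Rle_trans; [|apply (a_l1 k)].
  apply (sum_f_R0_ge_term (fun k => Rabs (a k) * q ^ k)); [|lia].
  intros i. apply Rmult_le_pos; [apply Rabs_pos | apply pow_le; lra].
Qed.

Hypothesis q_gt_1 : 1 < q.

Lemma weighted_l1_summable : ex_series (fun k => Rabs (a k)).
Proof.
  pose proof (Rinv_gt_1 q q_gt_1).
  apply ex_series_geom_le with B (/ q); [lra|].
  intros k. rewrite Rabs_Rabsolu. apply weighted_l1_decay. lra.
Qed.

Lemma weighted_l1_tail (n : nat) :
  Series (fun k => Rabs (a k)) - sum_f_R0 (fun k => Rabs (a k)) n <= B * (/ q) ^ n.
Proof.
  assert (pow_pos : 0 < q ^ n) by (apply pow_lt; lra).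
  assert (gap : forall m, (n <= m)%nat ->
    (sum_f_R0 (fun k => Rabs (a k)) m - sum_f_R0 (fun k => Rabs (a k)) n) * q ^ n
    <= sum_f_R0 (fun k => Rabs (a k) * q ^ k) m - sum_f_R0 (fun k => Rabs (a k) * q ^ k) n).
  { intros m n_le_m. induction n_le_m as [|m n_le_m IH]; [lra|].
    rewrite !tech5.
    assert (Rabs (a (S m)) * q ^ n <= Rabs (a (S m)) * q ^ S m); [|lra].
    apply Rmult_le_compat_l; [apply Rabs_pos | apply Rle_pow; [lra | lia]]. }
  assert (partial_nonneg : 0 <= sum_f_R0 (fun k => Rabs (a k) * q ^ k) n).
  { apply cond_pos_sum. intros k. apply Rmult_le_pos; [apply Rabs_pos | apply pow_le; lra]. }
  assert (bound : forall m,
    sum_f_R0 (fun k => Rabs (a k)) (m + n) - sum_f_R0 (fun k => Rabs (a k)) n <= B * (/ q) ^ n).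
  { intros m. rewrite pow_inv. apply Rmult_le_reg_r with (q ^ n); [exact pow_pos|].
    rewrite (Rmult_assoc B), Rinv_l, Rmult_1_r by lra.
    specialize (gap (m + n)%nat ltac:(lia)). pose proof (a_l1 (m + n)%nat). lra. }
  refine (is_lim_seq_le _ (fun _ => B * (/ q) ^ n) (Finite _) (Finite _) bound _ _);
    [|apply is_lim_seq_const].
  apply is_lim_seq_minus'; [|apply is_lim_seq_const].
  apply (is_lim_seq_incr_n (fun m => sum_f_R0 (fun k => Rabs (a k)) m) n).
  apply is_lim_seq_sum_f_R0, weighted_l1_summable.
Qed.

End WeightedL1.

Lemma geom_weighted_l1 (r : R) : 0 < r < 1 ->
  exists q, 1 < q /\
    forall (M : R) (a : nat -> R), (forall k, Rabs (a k) <= M * r ^ k) ->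
    exists B, weighted_l1 q B a.
Proof.
  intros r_in. set (q := 2 / (1 + r)).
  assert (q_eq : q * (1 + r) = 2) by (unfold q; field; lra).
  assert (q_gt_1 : 1 < q) by nra. assert (qr_in : 0 <= q * r < 1) by nra.
  exists q. split; [exact q_gt_1|]. intros M a a_le.
  assert (M_nonneg : 0 <= M)
    by (specialize (a_le 0%nat); pose proof (Rabs_pos (a 0%nat)); simpl in a_le; lra).
  assert (term_nonneg : forall k, 0 <= M * (q * r) ^ k)
    by (intros k; apply Rmult_le_pos; [lra | apply pow_le; lra]).
  exists (Series (fun k => M * (q * r) ^ k)). intros n.
  apply Rle_trans with (sum_f_R0 (fun k => M * (q * r) ^ k) n).
  - apply sum_Rle. intros k _. rewrite Rpow_mult_distr.
    replace (M * (q ^ k * r ^ k)) with (M * r ^ k * q ^ k) by ring.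
    apply Rmult_le_compat_r; [apply pow_le; lra | apply a_le].
  - apply sum_f_R0_le_Series; [|exact term_nonneg].
    apply ex_series_geom_le with M (q * r); [exact qr_in|].
    intros k. rewrite Rabs_pos_eq; [lra | apply term_nonneg].
Qed.

(** * Cosine polynomials *)

Lemma Rabs_cos_le_1 (x : R) : Rabs (cos x) <= 1.
Proof. apply Rabs_le. destruct (COS_bound x). lra. Qed.

Lemma Rabs_sin_le_1 (x : R) : Rabs (sin x) <= 1.
Proof. apply Rabs_le. destruct (SIN_bound x). lra. Qed.

Lemma Rabs_mult_le_l (a u : R) : Rabs u <= 1 -> Rabs (a * u) <= Rabs a.
Proof. intros u_le_1. rewrite Rabs_mult. pose proof (Rabs_pos a). nra. Qed.

Lemma Rabs_mult_cos_le (a x : R) : Rabs (a * cos x) <= Rabs a.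
Proof. apply Rabs_mult_le_l, Rabs_cos_le_1. Qed.

Lemma Rabs_mult_sin_le (a x : R) : Rabs (a * sin x) <= Rabs a.
Proof. apply Rabs_mult_le_l, Rabs_sin_le_1. Qed.

Lemma cos_INR_shift (j : nat) (x : R) : cos (INR j * (x + 2 * PI)) = cos (INR j * x).
Proof. rewrite <- (cos_period (INR j * x) j). f_equal; ring. Qed.

Lemma sin_INR_shift (j : nat) (x : R) : sin (INR j * (x + 2 * PI)) = sin (INR j * x).
Proof. rewrite <- (sin_period (INR j * x) j). f_equal; ring. Qed.

Lemma cos_INR_0 (x : R) : cos (INR 0 * x) = 1.
Proof. simpl. now rewrite Rmult_0_l, cos_0. Qed.

Definition nat_dist (i j : nat) : nat := ((i - j) + (j - i))%nat.

Lemma cos_INR_mult (i j : nat) (x : R) :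
  cos (INR i * x) * cos (INR j * x)
  = / 2 * cos (INR (i + j) * x) + / 2 * cos (INR (nat_dist i j) * x).
Proof.
  assert (cos_dist : cos (INR (nat_dist i j) * x) = cos (INR i * x - INR j * x)).
  { unfold nat_dist. destruct (le_ge_dec i j).
    - replace (i - j + (j - i))%nat with (j - i)%nat by lia.
      rewrite minus_INR by lia. rewrite <- cos_neg. f_equal; ring.
    - replace (i - j + (j - i))%nat with (i - j)%nat by lia.
      rewrite minus_INR by lia. f_equal; ring. }
  rewrite cos_dist, plus_INR, Rmult_plus_distr_r, cos_plus, cos_minus. field.
Qed.

(* The pair [(a, j)] stands for [a cos (j x)]. *)
Definition cospoly : Type := list (R * nat).

Fixpoint cospoly_eval (l : cospoly) (x : R) : R :=
  match l with
  | nil => 0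
  | (a, j) :: l' => a * cos (INR j * x) + cospoly_eval l' x
  end.

Fixpoint cospoly_norm (q : R) (l : cospoly) : R :=
  match l with
  | nil => 0
  | (a, j) :: l' => Rabs a * q ^ j + cospoly_norm q l'
  end.

Fixpoint cospoly_coef (l : cospoly) (n : nat) : R :=
  match l with
  | nil => 0
  | (a, j) :: l' => a * kronecker j n + cospoly_coef l' n
  end.

Fixpoint cospoly_mult_monomial (a : R) (j : nat) (l : cospoly) : cospoly :=
  match l with
  | nil => nil
  | (b, i) :: l' =>
    (a * b / 2, (i + j)%nat) :: (a * b / 2, nat_dist i j) :: cospoly_mult_monomial a j l'
  end.

Fixpoint cospoly_mult (l m : cospoly) : cospoly :=
  match l with
  | nil => nil
  | (a, j) :: l' => cospoly_mult_monomial a j m ++ cospoly_mult l' m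
  end.

Fixpoint cospoly_of_seq (a : nat -> R) (n : nat) : cospoly :=
  match n with
  | O => (a 0%nat, 0%nat) :: nil
  | S m => (a (S m), S m) :: cospoly_of_seq a m
  end.

Lemma cospoly_eval_app (l m : cospoly) (x : R) :
  cospoly_eval (l ++ m) x = cospoly_eval l x + cospoly_eval m x.
Proof. induction l as [|[a j] l IH]; simpl; [ring|]. rewrite IH. ring. Qed.

Lemma cospoly_norm_app (q : R) (l m : cospoly) :
  cospoly_norm q (l ++ m) = cospoly_norm q l + cospoly_norm q m.
Proof. induction l as [|[a j] l IH]; simpl; [ring|]. rewrite IH. ring. Qed.

Lemma cospoly_eval_mult_monomial (a : R) (j : nat) (l : cospoly) (x : R) :
  cospoly_eval (cospoly_mult_monomial a j l) x = a * cos (INR j * x) * cospoly_eval l x.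
Proof.
  induction l as [|[b i] l IH]; simpl; [ring|]. rewrite IH.
  replace (a * cos (INR j * x) * (b * cos (INR i * x) + cospoly_eval l x))
    with (a * b * (cos (INR i * x) * cos (INR j * x)) + a * cos (INR j * x) * cospoly_eval l x)
    by ring.
  rewrite cos_INR_mult. field.
Qed.

Lemma cospoly_eval_mult (l m : cospoly) (x : R) :
  cospoly_eval (cospoly_mult l m) x = cospoly_eval l x * cospoly_eval m x.
Proof.
  induction l as [|[a j] l IH]; simpl; [ring|].
  rewrite cospoly_eval_app, IH, cospoly_eval_mult_monomial. ring.
Qed.

Lemma cospoly_eval_of_seq (a : nat -> R) (n : nat) (x : R) :
  cospoly_eval (cospoly_of_seq a n) x = sum_f_R0 (fun k => a k * cos (INR k * x)) n.
Proof.
  induction n as [|n IH]; cbn [cospoly_of_seq cospoly_eval sum_f_R0]; [ring|].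
  rewrite IH. apply Rplus_comm.
Qed.

Lemma cospoly_norm_of_seq (q : R) (a : nat -> R) (n : nat) :
  cospoly_norm q (cospoly_of_seq a n) = sum_f_R0 (fun k => Rabs (a k) * q ^ k) n.
Proof.
  induction n as [|n IH]; cbn [cospoly_of_seq cospoly_norm sum_f_R0]; [ring|].
  rewrite IH. apply Rplus_comm.
Qed.

Lemma cospoly_coef_of_seq (a : nat -> R) (n k : nat) : (k <= n)%nat ->
  cospoly_coef (cospoly_of_seq a n) k = a k.
Proof.
  assert (coef_0 : forall m, (m < k)%nat -> cospoly_coef (cospoly_of_seq a m) k = 0).
  { induction m as [|m IH]; intros m_lt_k; cbn [cospoly_of_seq cospoly_coef];
      rewrite kronecker_neq by lia; [ring|]. rewrite IH by lia. ring. }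
  intros k_le_n. induction k_le_n as [|n k_le_n IH].
  - destruct k as [|k]; cbn [cospoly_of_seq cospoly_coef]; rewrite kronecker_eq; [ring|].
    rewrite coef_0 by lia. ring.
  - cbn [cospoly_of_seq cospoly_coef]. rewrite kronecker_neq, IH by lia. ring.
Qed.

Lemma continuity_cospoly_eval (l : cospoly) : continuity (cospoly_eval l).
Proof. induction l as [|[a j] l IH]; simpl; reg. Qed.

Lemma cospoly_eval_shift (l : cospoly) (x : R) : cospoly_eval l (x + 2 * PI) = cospoly_eval l x.
Proof. induction l as [|[a j] l IH]; simpl; [easy|]. now rewrite IH, cos_INR_shift. Qed.

Lemma cospoly_eval_opp (l : cospoly) (x : R) : cospoly_eval l (- x) = cospoly_eval l x.
Proof.
  induction l as [|[a j] l IH]; simpl; [easy|].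
  now rewrite IH, <- Ropp_mult_distr_r, cos_neg.
Qed.

Section CospolyNorm.

Variable q : R.
Hypothesis q_ge_1 : 1 <= q.

Lemma cospoly_norm_nonneg (l : cospoly) : 0 <= cospoly_norm q l.
Proof.
  induction l as [|[a j] l IH]; simpl; [lra|].
  assert (0 <= Rabs a * q ^ j) by (apply Rmult_le_pos; [apply Rabs_pos | apply pow_le; lra]). lra.
Qed.

Lemma cospoly_norm_mult_monomial_le (a : R) (j : nat) (l : cospoly) :
  cospoly_norm q (cospoly_mult_monomial a j l) <= Rabs a * q ^ j * cospoly_norm q l.
Proof.
  induction l as [|[b i] l IH]; simpl; [lra|].
  assert (pow_dist_le : q ^ nat_dist i j <= q ^ (i + j))
    by (apply Rle_pow; [lra | unfold nat_dist; lia]).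
  assert (Rabs_half : Rabs (a * b / 2) = Rabs a * Rabs b / 2)
    by (unfold Rdiv; rewrite !Rabs_mult, (Rabs_pos_eq (/ 2)) by lra; ring).
  assert (half_nonneg : 0 <= Rabs a * Rabs b / 2)
    by (pose proof (Rmult_le_pos _ _ (Rabs_pos a) (Rabs_pos b)); lra).
  rewrite Rabs_half. rewrite pow_add in *.
  pose proof (Rmult_le_compat_l _ _ _ half_nonneg pow_dist_le). nra.
Qed.

Lemma cospoly_norm_mult_le (l m : cospoly) :
  cospoly_norm q (cospoly_mult l m) <= cospoly_norm q l * cospoly_norm q m.
Proof.
  induction l as [|[a j] l IH]; simpl; [lra|]. rewrite cospoly_norm_app.
  pose proof (cospoly_norm_mult_monomial_le a j m). lra.
Qed.

Lemma Rabs_cospoly_eval_le (l : cospoly) (x : R) : Rabs (cospoly_eval l x) <= cospoly_norm q l.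
Proof.
  induction l as [|[a j] l IH]; simpl; [rewrite Rabs_R0; lra|].
  eapply Rle_trans; [apply Rabs_triang|]. apply Rplus_le_compat; [|exact IH].
  eapply Rle_trans; [apply Rabs_mult_cos_le|]. rewrite <- (Rmult_1_r (Rabs a)) at 1.
  apply Rmult_le_compat_l; [apply Rabs_pos | now apply pow_R1_Rle].
Qed.

Lemma cospoly_coef_weighted_l1 (l : cospoly) : weighted_l1 q (cospoly_norm q l) (cospoly_coef l).
Proof.
  intros n. induction l as [|[a j] l IH]; simpl.
  - rewrite sum_eq_R0; [lra|]. intros; rewrite Rabs_R0; ring.
  - apply Rle_trans with (sum_f_R0 (fun k =>
      kronecker j k * (Rabs a * q ^ k) + Rabs (cospoly_coef l k) * q ^ k) n).
    + apply sum_Rle. intros k _. rewrite <- Rmult_assoc, <- Rmult_plus_distr_r.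
      apply Rmult_le_compat_r; [apply pow_le; lra|].
      eapply Rle_trans; [apply Rabs_triang|]. apply Rplus_le_compat_r.
      rewrite Rabs_mult, Rmult_comm, (Rabs_pos_eq (kronecker j k)); [lra|].
      unfold kronecker. destruct (Nat.eq_dec j k); lra.
    + rewrite sum_plus, sum_kronecker.
      assert (0 <= Rabs a * q ^ j) by (apply Rmult_le_pos; [apply Rabs_pos | apply pow_le; lra]).
      destruct (le_dec j n); lra.
Qed.

Lemma Rabs_cospoly_tail_le (l : cospoly) (n : nat) (x : R) :
  Rabs (cospoly_eval l x - sum_f_R0 (fun k => cospoly_coef l k * cos (INR k * x)) n)
  <= cospoly_norm q l * (/ q) ^ n.
Proof.
  assert (pow_pos : 0 < (/ q) ^ n) by (apply pow_lt, Rinv_0_lt_compat; lra).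
  induction l as [|[a j] l IH]; simpl.
  - rewrite sum_eq_R0 by (intros; ring). rewrite Rminus_0_r, Rabs_R0. lra.
  - rewrite (sum_eq _ (fun k => kronecker j k * (a * cos (INR k * x))
      + cospoly_coef l k * cos (INR k * x))) by (intros; ring).
    rewrite sum_plus, sum_kronecker, Rmult_plus_distr_r.
    match goal with |- Rabs (?u + ?v - (?w + ?z)) <= _ =>
      replace (u + v - (w + z)) with ((u - w) + (v - z)) by ring end.
    eapply Rle_trans; [apply Rabs_triang|]. apply Rplus_le_compat; [|exact IH].
    destruct (le_dec j n) as [j_le_n|j_gt_n].
    + rewrite Rminus_diag, Rabs_R0. apply Rmult_le_pos; [|lra].
      apply Rmult_le_pos; [apply Rabs_pos | apply pow_le; lra].
    + rewrite Rminus_0_r, Rmult_assoc. eapply Rle_trans; [apply Rabs_mult_cos_le|].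
      rewrite <- (Rmult_1_r (Rabs a)) at 1. apply Rmult_le_compat_l; [apply Rabs_pos|].
      replace j with ((j - n) + n)%nat by lia.
      rewrite pow_add, Rmult_assoc, <- Rpow_mult_distr, Rinv_r, pow1, Rmult_1_r by lra.
      now apply pow_R1_Rle.
Qed.

End CospolyNorm.

(** * Cosine coefficients *)

Definition cos_coef (f : R -> R) (n : nat) : R :=
  (if Nat.eq_dec n 0 then / (2 * PI) else / PI) * RInt (fun x => f x * cos (INR n * x)) 0 (2 * PI).

Lemma cos_coef_0 (f : R -> R) : cos_coef f 0 = / (2 * PI) * RInt f 0 (2 * PI).
Proof.
  unfold cos_coef. simpl Nat.eq_dec. cbv iota. f_equal. apply RInt_eq.
  intros x. rewrite cos_INR_0. apply Rmult_1_r.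
Qed.

Lemma cos_coef_pos (f : R -> R) (n : nat) : (0 < n)%nat ->
  cos_coef f n = / PI * RInt (fun x => f x * cos (INR n * x)) 0 (2 * PI).
Proof. intros n_pos. unfold cos_coef. destruct (Nat.eq_dec n 0); [lia | reflexivity]. Qed.

Lemma cos_coef_ext (f g : R -> R) (n : nat) : (forall x, f x = g x) -> cos_coef f n = cos_coef g n.
Proof. intros f_eq_g. unfold cos_coef. f_equal. apply RInt_eq. intros; now rewrite f_eq_g. Qed.

Lemma cos_coef_plus (f g : R -> R) (n : nat) : continuity f -> continuity g ->
  cos_coef (fun x => f x + g x) n = cos_coef f n + cos_coef g n.
Proof.
  intros f_cont g_cont. unfold cos_coef. rewrite <- Rmult_plus_distr_l, <- RInt_Rplus by reg.
  f_equal. apply RInt_eq. intros; ring.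
Qed.

Lemma cos_coef_scal (a : R) (f : R -> R) (n : nat) : continuity f ->
  cos_coef (fun x => a * f x) n = a * cos_coef f n.
Proof.
  intros f_cont. unfold cos_coef.
  rewrite (RInt_eq _ (fun x => a * (f x * cos (INR n * x)))) by (intros; ring).
  rewrite RInt_Rmult by reg. ring.
Qed.

Lemma cos_coef_minus (f g : R -> R) (n : nat) : continuity f -> continuity g ->
  cos_coef (fun x => f x - g x) n = cos_coef f n - cos_coef g n.
Proof.
  intros f_cont g_cont. rewrite (cos_coef_ext _ (fun x => f x + (-1) * g x)) by (intros; ring).
  rewrite cos_coef_plus, cos_coef_scal by reg. ring.
Qed.

Lemma Rabs_cos_coef_le (f g : R -> R) (n : nat) : continuity f -> continuity g ->
  (forall x, Rabs (f x) <= g x) -> Rabs (cos_coef f n) <= / PI * RInt g 0 (2 * PI).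
Proof.
  intros f_cont g_cont f_le_g. pose proof PI_RGT_0 as PI_pos.
  pose proof (Rinv_0_lt_compat _ PI_pos).
  assert (factor_in : 0 < (if Nat.eq_dec n 0 then / (2 * PI) else / PI) <= / PI)
    by (destruct (Nat.eq_dec n 0); [rewrite Rinv_mult|]; lra).
  unfold cos_coef. rewrite Rabs_mult, Rabs_pos_eq by lra.
  apply Rmult_le_compat; try lra; try apply Rabs_pos.
  apply Rabs_RInt_le; [lra | reg | exact g_cont|].
  intros x. eapply Rle_trans; [apply Rabs_mult_cos_le | apply f_le_g].
Qed.

Lemma Rabs_cos_coef_le_const (f : R -> R) (n : nat) (e : R) : continuity f ->
  (forall x, Rabs (f x) <= e) -> Rabs (cos_coef f n) <= 2 * e.
Proof.
  intros f_cont f_le_e.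
  eapply Rle_trans; [apply (Rabs_cos_coef_le f (fun _ => e)); [exact f_cont | reg | exact f_le_e]|].
  rewrite RInt_Rconst. apply Req_le. field. apply PI_neq0.
Qed.

Lemma RInt_cos_INR (k : nat) : (0 < k)%nat -> RInt (fun x => cos (INR k * x)) 0 (2 * PI) = 0.
Proof.
  intros k_pos. assert (k_neq0 : INR k <> 0) by (apply not_0_INR; lia).
  apply is_RInt_unique.
  replace 0 with (minus (sin (INR k * (2 * PI)) / INR k) (sin (INR k * 0) / INR k)) at 2.
  - apply (is_RInt_derive (fun x => sin (INR k * x) / INR k)).
    + intros x _. auto_derive; [easy|]. field. exact k_neq0.
    + intros x _. apply (continuity_continuous (fun x => cos (INR k * x))). reg.
  - unfold minus, plus, opp; simpl. rewrite <- (Rplus_0_l (2 * PI)), sin_INR_shift. ring.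
Qed.

Lemma cos_coef_cos (j n : nat) : cos_coef (fun x => cos (INR j * x)) n = kronecker j n.
Proof.
  pose proof PI_neq0 as PI_neq0.
  assert (RInt_one : RInt (fun x => cos (INR 0 * x)) 0 (2 * PI) = 2 * PI :> R).
  { rewrite (RInt_eq _ (fun _ => 1)) by apply cos_INR_0. rewrite RInt_Rconst. ring. }
  unfold cos_coef. rewrite (RInt_eq _ _ _ _ (cos_INR_mult j n)).
  rewrite RInt_Rplus, !RInt_Rmult by reg.
  destruct (Nat.eq_dec j n) as [->|j_neq_n].
  - rewrite kronecker_eq. replace (nat_dist n n) with 0%nat by (unfold nat_dist; lia).
    rewrite RInt_one. destruct (Nat.eq_dec n 0) as [->|n_neq_0].
    + simpl Nat.add. rewrite RInt_one. field. exact PI_neq0.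
    + rewrite RInt_cos_INR by lia. field. exact PI_neq0.
  - rewrite kronecker_neq, !RInt_cos_INR by (unfold nat_dist; lia). ring.
Qed.

Lemma cos_coef_cospoly_eval (l : cospoly) (n : nat) :
  cos_coef (cospoly_eval l) n = cospoly_coef l n.
Proof.
  induction l as [|[a j] l IH]; simpl.
  - rewrite (cos_coef_ext _ (fun x => 0 * 1)) by (intros; simpl; ring).
    rewrite cos_coef_scal by reg. ring.
  - pose proof (continuity_cospoly_eval l).
    rewrite cos_coef_plus, cos_coef_scal, cos_coef_cos, IH by reg. reflexivity.
Qed.

Definition even_periodic (f : R -> R) : Prop :=
  continuity f /\ (forall x, f (x + 2 * PI) = f x) /\ (forall x, f (- x) = f x).

Lemma RInt_sin_even_periodic (f : R -> R) (n : nat) : even_periodic f ->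
  RInt (fun x => f x * sin (INR n * x)) 0 (2 * PI) = 0.
Proof.
  intros (f_cont & f_period & f_even).
  set (g := fun x => f x * sin (INR n * x)). assert (g_cont : continuity g) by (unfold g; reg).
  assert (g_odd : forall x, g (-1 * x + 2 * PI) = - g x).
  { intros x. unfold g. rewrite sin_INR_shift, f_period. replace (-1 * x) with (- x) by ring.
    rewrite f_even, <- Ropp_mult_distr_r, sin_neg. ring. }
  pose proof (RInt_comp_lin g (-1) (2 * PI) 0 (2 * PI)
    (ex_RInt_continuity g _ _ g_cont)) as reflect.
  rewrite (RInt_eq _ g) in reflect
    by (intros x; unfold scal; simpl; unfold mult; simpl; rewrite g_odd; ring).
  replace (-1 * 0 + 2 * PI) with (2 * PI) in reflect by ring.
  replace (-1 * (2 * PI) + 2 * PI) with 0 in reflect by ring.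
  rewrite <- (opp_RInt_swap g 0 (2 * PI)) in reflect by now apply ex_RInt_continuity.
  unfold opp in reflect; simpl in reflect. lra.
Qed.

Lemma RInt_cos_shift_even_periodic (f : R -> R) (n : nat) (x : R) : even_periodic f ->
  RInt (fun y => f y * cos (INR n * (x - y))) 0 (2 * PI)
  = cos (INR n * x) * RInt (fun y => f y * cos (INR n * y)) 0 (2 * PI).
Proof.
  intros f_ep. pose proof (proj1 f_ep) as f_cont.
  rewrite (RInt_eq _ (fun y => cos (INR n * x) * (f y * cos (INR n * y))
    + sin (INR n * x) * (f y * sin (INR n * y))))
    by (intros y; rewrite Rmult_minus_distr_l, cos_minus; ring).
  rewrite RInt_Rplus, !RInt_Rmult by reg. rewrite RInt_sin_even_periodic by exact f_ep.
  now rewrite Rmult_0_r, Rplus_0_r.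
Qed.

(** * The weighted Wiener algebra *)

(* [wiener_ball q B f] says that [f] has a cosine series with [sum |f_j| q^j <= B]; phrasing it
   through approximation by polynomials makes the algebra property a finite computation. *)
Definition wiener_ball (q B : R) (f : R -> R) : Prop :=
  forall e, 0 < e ->
  exists l, cospoly_norm q l <= B /\ forall x, Rabs (f x - cospoly_eval l x) <= e.

Lemma wiener_ball_ext (q B : R) (f g : R -> R) : (forall x, f x = g x) ->
  wiener_ball q B f -> wiener_ball q B g.
Proof.
  intros f_eq_g f_ball e e_pos. destruct (f_ball e e_pos) as (l & l_norm & f_near_l).
  exists l. split; [exact l_norm|]. intros x. now rewrite <- f_eq_g.
Qed.

Lemma wiener_ball_le (q B C : R) (f : R -> R) : B <= C -> wiener_ball q B f -> wiener_ball q C f.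
Proof.
  intros B_le_C f_ball e e_pos. destruct (f_ball e e_pos) as (l & l_norm & f_near_l).
  exists l. split; [lra | exact f_near_l].
Qed.

Lemma wiener_ball_lim (q B : R) (f : R -> R) :
  (forall e, 0 < e -> exists g, wiener_ball q B g /\ forall x, Rabs (f x - g x) <= e) ->
  wiener_ball q B f.
Proof.
  intros f_lim e e_pos. destruct (f_lim (e / 2)) as (g & g_ball & f_near_g); [lra|].
  destruct (g_ball (e / 2)) as (l & l_norm & g_near_l); [lra|].
  exists l. split; [exact l_norm|]. intros x. specialize (f_near_g x). specialize (g_near_l x).
  apply Rabs_le_between in f_near_g, g_near_l. apply Rabs_le. lra.
Qed.

Lemma wiener_ball_invariant (q B : R) (f g : R -> R) (x : R) :
  (forall l, cospoly_eval l (g x) = cospoly_eval l x) -> wiener_ball q B f -> f (g x) = f x.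
Proof.
  intros invariant f_ball. apply cond_eq. intros e e_pos.
  destruct (f_ball (e / 3)) as (l & _ & f_near_l); [lra|].
  pose proof (f_near_l x) as near_x. specialize (f_near_l (g x)). rewrite invariant in f_near_l.
  apply Rabs_le_between in near_x, f_near_l. apply Rabs_lt_between. lra.
Qed.

Lemma wiener_ball_even_periodic (q B : R) (f : R -> R) : wiener_ball q B f -> even_periodic f.
Proof.
  intros f_ball. split; [|split].
  - apply continuity_Rabs_le. intros x e e_pos.
    destruct (f_ball (e / 3)) as (l & _ & f_near_l); [lra|].
    destruct (proj1 (continuity_Rabs_le _) (continuity_cospoly_eval l) x (e / 3))
      as (d & d_pos & l_near); [lra|].
    exists d. split; [exact d_pos|]. intros y y_near. specialize (l_near y y_near).
    pose proof (f_near_l x) as near_x. pose proof (f_near_l y) as near_y.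
    apply Rabs_le_between in near_x, near_y, l_near. apply Rabs_le. lra.
  - intros x. apply (wiener_ball_invariant q B f (fun x => x + 2 * PI)); [|exact f_ball].
    intros l. apply cospoly_eval_shift.
  - intros x. apply (wiener_ball_invariant q B f Ropp); [|exact f_ball].
    intros l. apply cospoly_eval_opp.
Qed.

Lemma wiener_ball_continuity (q B : R) (f : R -> R) : wiener_ball q B f -> continuity f.
Proof. apply wiener_ball_even_periodic. Qed.

Lemma wiener_ball_cos (q a : R) (j : nat) :
  wiener_ball q (Rabs a * q ^ j) (fun x => a * cos (INR j * x)).
Proof.
  intros e e_pos. exists ((a, j) :: nil). simpl. split; [lra|]. intros x.
  rewrite Rplus_0_r, Rminus_diag, Rabs_R0. lra.
Qed.

Lemma wiener_ball_const (q a B : R) : Rabs a <= B -> wiener_ball q B (fun _ => a).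
Proof.
  intros a_le_B. apply (wiener_ball_ext q B (fun x => a * cos (INR 0 * x))).
  - intros x. rewrite cos_INR_0. ring.
  - apply (wiener_ball_le q (Rabs a * q ^ 0)); [simpl; lra | apply wiener_ball_cos].
Qed.

Lemma wiener_ball_plus (q B C : R) (f g : R -> R) :
  wiener_ball q B f -> wiener_ball q C g -> wiener_ball q (B + C) (fun x => f x + g x).
Proof.
  intros f_ball g_ball e e_pos.
  destruct (f_ball (e / 2)) as (l & l_norm & f_near_l); [lra|].
  destruct (g_ball (e / 2)) as (m & m_norm & g_near_m); [lra|].
  exists (l ++ m). rewrite cospoly_norm_app. split; [lra|]. intros x. rewrite cospoly_eval_app.
  specialize (f_near_l x). specialize (g_near_m x).
  apply Rabs_le_between in f_near_l, g_near_m. apply Rabs_le. lra.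
Qed.

Section WienerAlgebra.

Variable q : R.
Hypothesis q_ge_1 : 1 <= q.

Lemma wiener_ball_nonneg (B : R) (f : R -> R) : wiener_ball q B f -> 0 <= B.
Proof.
  intros f_ball. destruct (f_ball 1) as (l & l_norm & _); [lra|].
  pose proof (cospoly_norm_nonneg q q_ge_1 l). lra.
Qed.

Lemma wiener_ball_sup (B : R) (f : R -> R) (x : R) : wiener_ball q B f -> Rabs (f x) <= B.
Proof.
  intros f_ball. apply le_epsilon. intros e e_pos.
  destruct (f_ball e e_pos) as (l & l_norm & f_near_l). specialize (f_near_l x).
  pose proof (Rabs_cospoly_eval_le q q_ge_1 l x).
  replace (f x) with ((f x - cospoly_eval l x) + cospoly_eval l x) by ring.
  eapply Rle_trans; [apply Rabs_triang|]. lra.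
Qed.

Lemma wiener_ball_mult (B C : R) (f g : R -> R) :
  wiener_ball q B f -> wiener_ball q C g -> wiener_ball q (B * C) (fun x => f x * g x).
Proof.
  intros f_ball g_ball e e_pos.
  pose proof (wiener_ball_nonneg B f f_ball). pose proof (wiener_ball_nonneg C g g_ball).
  set (d := e / (B + C + 1)). assert (d_pos : 0 < d) by (apply Rdiv_lt_0_compat; lra).
  destruct (f_ball d d_pos) as (l & l_norm & f_near_l).
  destruct (g_ball d d_pos) as (m & m_norm & g_near_m).
  exists (cospoly_mult l m). split.
  - eapply Rle_trans; [now apply cospoly_norm_mult_le|].
    apply Rmult_le_compat; auto using cospoly_norm_nonneg.
  - intros x. rewrite cospoly_eval_mult. specialize (f_near_l x). specialize (g_near_m x).
    pose proof (Rabs_cospoly_eval_le q q_ge_1 l x). pose proof (wiener_ball_sup C g x g_ball).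
    replace (f x * g x - cospoly_eval l x * cospoly_eval m x)
      with ((f x - cospoly_eval l x) * g x + cospoly_eval l x * (g x - cospoly_eval m x)) by ring.
    eapply Rle_trans; [apply Rabs_triang|]. rewrite !Rabs_mult.
    apply Rle_trans with (d * C + B * d).
    + apply Rplus_le_compat; apply Rmult_le_compat; try apply Rabs_pos; lra.
    + replace e with (d * (B + C + 1)) by (unfold d; field; lra). nra.
Qed.

Lemma wiener_ball_scal (a B : R) (f : R -> R) :
  wiener_ball q B f -> wiener_ball q (Rabs a * B) (fun x => a * f x).
Proof. intros f_ball. apply wiener_ball_mult; [apply wiener_ball_const; lra | exact f_ball]. Qed.

Lemma wiener_ball_pow (B : R) (f : R -> R) (n : nat) :
  wiener_ball q B f -> wiener_ball q (B ^ n) (fun x => f x ^ n).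
Proof.
  intros f_ball. induction n as [|n IH]; simpl.
  - apply wiener_ball_const. rewrite Rabs_R1. lra.
  - now apply wiener_ball_mult.
Qed.

Lemma wiener_ball_pow_minus (B D : R) (f g : R -> R) (n : nat) :
  wiener_ball q B f -> wiener_ball q B g -> wiener_ball q D (fun x => f x - g x) ->
  wiener_ball q (D * (INR (S n) * B ^ n)) (fun x => f x ^ S n - g x ^ S n).
Proof.
  intros f_ball g_ball diff_ball. induction n as [|n IH].
  - apply (wiener_ball_ext q _ (fun x => f x - g x)); [intros; ring|].
    apply (wiener_ball_le q D); [simpl; lra | exact diff_ball].
  - apply (wiener_ball_ext q _ (fun x => (f x - g x) * f x ^ S n + (f x ^ S n - g x ^ S n) * g x));
      [intros; simpl; ring|].
    apply (wiener_ball_le q (D * B ^ S n + D * (INR (S n) * B ^ n) * B));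
      [rewrite (S_INR (S n)); simpl; lra|].
    apply wiener_ball_plus; apply wiener_ball_mult; auto using wiener_ball_pow.
Qed.

Lemma Rabs_cos_coef_minus_le (B e : R) (f : R -> R) (l : cospoly) (k : nat) : wiener_ball q B f ->
  (forall x, Rabs (f x - cospoly_eval l x) <= e) -> Rabs (cos_coef f k - cospoly_coef l k) <= 2 * e.
Proof.
  intros f_ball f_near_l. pose proof (wiener_ball_continuity q B f f_ball).
  pose proof (continuity_cospoly_eval l).
  rewrite <- cos_coef_cospoly_eval, <- cos_coef_minus by assumption.
  apply Rabs_cos_coef_le_const; [reg | exact f_near_l].
Qed.

Lemma cos_coef_weighted_l1 (B : R) (f : R -> R) : wiener_ball q B f -> weighted_l1 q B (cos_coef f).
Proof.
  intros f_ball n. apply le_epsilon. intros e e_pos. set (Q := sum_f_R0 (fun k => q ^ k) n).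
  assert (Q_nonneg : 0 <= Q) by (apply cond_pos_sum; intros; apply pow_le; lra).
  set (d := e / (2 * Q + 1)). assert (d_pos : 0 < d) by (apply Rdiv_lt_0_compat; lra).
  destruct (f_ball d d_pos) as (l & l_norm & f_near_l).
  apply Rle_trans with (sum_f_R0 (fun k => Rabs (cospoly_coef l k) * q ^ k + q ^ k * (2 * d)) n).
  - apply sum_Rle. intros k _. rewrite (Rmult_comm (q ^ k)), <- Rmult_plus_distr_r.
    apply Rmult_le_compat_r; [apply pow_le; lra|].
    pose proof (Rabs_cos_coef_minus_le B d f l k f_ball f_near_l).
    replace (cos_coef f k) with (cospoly_coef l k + (cos_coef f k - cospoly_coef l k)) by ring.
    eapply Rle_trans; [apply Rabs_triang|]. lra.
  - rewrite sum_plus, <- (scal_sum (fun k => q ^ k) n (2 * d)). fold Q.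
    pose proof (cospoly_coef_weighted_l1 q q_ge_1 l n).
    assert (2 * d * Q <= e); [|lra].
    replace e with (d * (2 * Q + 1)) by (unfold d; field; lra). nra.
Qed.

Lemma Rabs_cos_coef_decay (B : R) (f : R -> R) (k : nat) :
  wiener_ball q B f -> Rabs (cos_coef f k) <= B * (/ q) ^ k.
Proof. intros f_ball. apply weighted_l1_decay; [now apply cos_coef_weighted_l1 | exact q_ge_1]. Qed.

Lemma Rabs_cos_sum_tail_le (B : R) (f : R -> R) (n : nat) (x : R) : wiener_ball q B f ->
  Rabs (f x - sum_f_R0 (fun k => cos_coef f k * cos (INR k * x)) n) <= B * (/ q) ^ n.
Proof.
  intros f_ball. apply le_epsilon. intros e e_pos. set (d := e / (2 * INR (S n) + 1)).
  pose proof (pos_INR (S n)). assert (d_pos : 0 < d) by (apply Rdiv_lt_0_compat; lra).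
  destruct (f_ball d d_pos) as (l & l_norm & f_near_l).
  set (f_sum := sum_f_R0 (fun k => cos_coef f k * cos (INR k * x)) n).
  set (l_sum := sum_f_R0 (fun k => cospoly_coef l k * cos (INR k * x)) n).
  assert (sums_near : Rabs (l_sum - f_sum) <= 2 * d * INR (S n)).
  { unfold l_sum, f_sum. rewrite <- minus_sum, <- sum_cte.
    eapply Rle_trans; [apply Rsum_abs|]. apply sum_Rle. intros k _.
    rewrite <- Rmult_minus_distr_r, Rabs_mult, Rabs_minus_sym, <- Rabs_mult.
    eapply Rle_trans; [apply Rabs_mult_cos_le | now apply Rabs_cos_coef_minus_le with B]. }
  assert (l_tail : Rabs (cospoly_eval l x - l_sum) <= B * (/ q) ^ n).
  { eapply Rle_trans; [apply (Rabs_cospoly_tail_le q q_ge_1)|].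
    apply Rmult_le_compat_r; [apply pow_le, Rlt_le, Rinv_0_lt_compat; lra | exact l_norm]. }
  assert (e_eq : d + 2 * d * INR (S n) = e) by (unfold d; field; lra).
  specialize (f_near_l x). apply Rabs_le_between in sums_near, l_tail, f_near_l.
  apply Rabs_le. lra.
Qed.

End WienerAlgebra.

(** * Cosine series *)

Definition cos_series (a : nat -> R) (x : R) : R := Series (fun k => a k * cos (INR k * x)).
Definition sin_series (a : nat -> R) (x : R) : R := Series (fun k => a k * sin (INR k * x)).

Lemma wiener_ball_is_series (q B : R) (f : R -> R) (x : R) : 1 < q -> wiener_ball q B f ->
  is_series (fun k => cos_coef f k * cos (INR k * x)) (f x).
Proof.
  intros q_gt_1 f_ball. pose proof (Rinv_gt_1 q q_gt_1).
  apply is_series_geom_tail with B (/ q); [lra|].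
  intros n. apply Rabs_cos_sum_tail_le; [lra | exact f_ball].
Qed.

Lemma wiener_ball_eq_cos_series (q B : R) (f : R -> R) (x : R) : 1 < q -> wiener_ball q B f ->
  f x = cos_series (cos_coef f) x.
Proof.
  intros q_gt_1 f_ball. symmetry. now apply is_series_unique, wiener_ball_is_series with q B.
Qed.

Section WeightedL1CosSeries.

Variables (q B : R) (a : nat -> R).
Hypothesis q_gt_1 : 1 < q.
Hypothesis a_l1 : weighted_l1 q B a.

Lemma Rabs_cos_series_tail_le (n : nat) (x : R) :
  Rabs (cos_series a x - sum_f_R0 (fun k => a k * cos (INR k * x)) n) <= B * (/ q) ^ n.
Proof.
  eapply Rle_trans; [|now apply (weighted_l1_tail q B a)].
  apply (Rabs_Series_tail_le (fun k => a k * cos (INR k * x))).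
  - now apply weighted_l1_summable with q B.
  - intros k. apply Rabs_mult_cos_le.
Qed.

Lemma cos_series_near_cospoly (e : R) : 0 < e ->
  exists N, forall n, (N <= n)%nat ->
  forall x, Rabs (cos_series a x - cospoly_eval (cospoly_of_seq a n) x) <= e.
Proof.
  intros e_pos. pose proof (Rinv_gt_1 q q_gt_1).
  destruct (geom_eventually_le B (/ q) e) as [N small]; [lra | exact e_pos|].
  exists N. intros n N_le_n x. rewrite cospoly_eval_of_seq.
  eapply Rle_trans; [apply Rabs_cos_series_tail_le | now apply small].
Qed.

Lemma wiener_ball_cos_series : wiener_ball q B (cos_series a).
Proof.
  intros e e_pos. destruct (cos_series_near_cospoly e e_pos) as [N near].
  exists (cospoly_of_seq a N). rewrite cospoly_norm_of_seq. split; [apply a_l1 | now apply near].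
Qed.

Lemma cos_coef_cos_series (k : nat) : cos_coef (cos_series a) k = a k.
Proof.
  apply cond_eq. intros e e_pos.
  destruct (cos_series_near_cospoly (e / 4)) as [N near]; [lra|].
  rewrite <- (cospoly_coef_of_seq a (max N k) k) by lia.
  apply Rle_lt_trans with (2 * (e / 4)); [|lra].
  apply Rabs_cos_coef_minus_le with q B; [apply wiener_ball_cos_series | apply near; lia].
Qed.

End WeightedL1CosSeries.

Lemma cos_series_minus (a b : nat -> R) (x : R) :
  ex_series (fun k => Rabs (a k)) -> ex_series (fun k => Rabs (b k)) ->
  cos_series (fun k => a k - b k) x = cos_series a x - cos_series b x.
Proof.
  intros a_summable b_summable.
  assert (summable_cos : forall c, ex_series (fun k => Rabs (c k)) ->
    ex_series (fun k => c k * cos (INR k * x))).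
  { intros c c_summable. apply ex_series_Rabs_le with (1 := c_summable).
    intros k. apply Rabs_mult_cos_le. }
  unfold cos_series. rewrite <- Series_minus by now apply summable_cos.
  apply Series_ext. intros; ring.
Qed.

Lemma is_derive_cos_series_param (a a' : nat -> R -> R) (b b' : nat -> R) (t x : R) :
  ex_series b -> ex_series b' ->
  (forall k t, Rabs (a k t) <= b k) -> (forall k t, Rabs (a' k t) <= b' k) ->
  (forall k t, is_derive (a k) t (a' k t)) -> (forall k, continuity (a' k)) ->
  is_derive (fun t => cos_series (fun k => a k t) x) t (cos_series (fun k => a' k t) x).
Proof.
  intros b_summable b'_summable a_le_b a'_le_b' a_derive a'_cont.
  apply (is_derive_Series (fun k t => a k t * cos (INR k * x))
    (fun k t => a' k t * cos (INR k * x)) b b'); auto.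
  - intros k s. eapply Rle_trans; [apply Rabs_mult_cos_le | apply a_le_b].
  - intros k s. eapply Rle_trans; [apply Rabs_mult_cos_le | apply a'_le_b'].
  - intros k s. apply is_derive_ext with (fun t => cos (INR k * x) * a k t);
      [intros; apply Rmult_comm|].
    rewrite (Rmult_comm (a' k s)). apply (is_derive_scal (a k)), a_derive.
  - intros k. specialize (a'_cont k). reg.
Qed.

Section TrigSeriesDerivative.

Variable a : nat -> R.
Hypothesis a_summable : ex_series (fun k => INR (S k) * Rabs (a k)).

Lemma Rabs_le_succ_mult_Rabs (k : nat) (z : R) : Rabs z <= 1 ->
  Rabs (a k * z) <= INR (S k) * Rabs (a k).
Proof.
  intros z_le_1. eapply Rle_trans; [now apply Rabs_mult_le_l|].
  rewrite S_INR. pose proof (pos_INR k). pose proof (Rabs_pos (a k)). nra.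
Qed.

Lemma Rabs_INR_mult_le (k : nat) (z : R) : Rabs z <= 1 ->
  Rabs (INR k * a k * z) <= INR (S k) * Rabs (a k).
Proof.
  intros z_le_1. eapply Rle_trans; [now apply Rabs_mult_le_l|].
  rewrite Rabs_mult, (Rabs_pos_eq (INR k)), S_INR by apply pos_INR.
  pose proof (Rabs_pos (a k)). lra.
Qed.

Lemma is_derive_cos_series (x : R) :
  is_derive (cos_series a) x (- sin_series (fun k => INR k * a k) x).
Proof.
  unfold sin_series. rewrite <- Series_opp.
  apply (is_derive_Series (fun k x => a k * cos (INR k * x))
    (fun k x => - (INR k * a k * sin (INR k * x))) _ _ a_summable a_summable).
  - intros k z. apply Rabs_le_succ_mult_Rabs, Rabs_cos_le_1.
  - intros k z. rewrite Rabs_Ropp. apply Rabs_INR_mult_le, Rabs_sin_le_1.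
  - intros k z. auto_derive; [easy | ring].
  - intros k. reg.
Qed.

Lemma is_derive_sin_series (x : R) :
  is_derive (sin_series a) x (cos_series (fun k => INR k * a k) x).
Proof.
  apply (is_derive_Series (fun k x => a k * sin (INR k * x))
    (fun k x => INR k * a k * cos (INR k * x)) _ _ a_summable a_summable).
  - intros k z. apply Rabs_le_succ_mult_Rabs, Rabs_sin_le_1.
  - intros k z. apply Rabs_INR_mult_le, Rabs_cos_le_1.
  - intros k z. auto_derive; [easy | ring].
  - intros k. reg.
Qed.

End TrigSeriesDerivative.

(** * Paths of periodic functions *)

Definition sup_continuous (y : R -> R -> R) : Prop :=
  forall t e, 0 < e ->
  exists d, 0 < d /\ forall t', Rabs (t' - t) < d -> forall x, Rabs (y t' x - y t x) <= e.

Definition wiener_path (q B : R) (y : R -> R -> R) : Prop :=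
  sup_continuous y /\ forall t, wiener_ball q B (y t).

Lemma sup_continuous_plus (y z : R -> R -> R) :
  sup_continuous y -> sup_continuous z -> sup_continuous (fun t x => y t x + z t x).
Proof.
  intros y_cont z_cont t e e_pos.
  destruct (y_cont t (e / 2)) as (d & d_pos & y_near); [lra|].
  destruct (z_cont t (e / 2)) as (d' & d'_pos & z_near); [lra|].
  exists (Rmin d d'). split; [now apply Rmin_glb_lt|]. intros t' t'_near x.
  pose proof (Rmin_l d d'). pose proof (Rmin_r d d').
  specialize (y_near t' ltac:(lra) x). specialize (z_near t' ltac:(lra) x).
  apply Rabs_le_between in y_near, z_near. apply Rabs_le. lra.
Qed.

Lemma sup_continuous_lipschitz (L : R) (y z : R -> R -> R) :
  (forall t t' x, Rabs (z t' x - z t x) <= L * Rabs (y t' x - y t x)) ->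
  sup_continuous y -> sup_continuous z.
Proof.
  intros z_lip y_cont t e e_pos. pose proof (Rabs_pos L) as L_nonneg. pose proof (Rle_abs L).
  destruct (y_cont t (e / (Rabs L + 1))) as (d & d_pos & y_near); [apply Rdiv_lt_0_compat; lra|].
  exists d. split; [exact d_pos|]. intros t' t'_near x. specialize (y_near t' t'_near x).
  pose proof (Rabs_pos (y t' x - y t x)). eapply Rle_trans; [apply z_lip|].
  apply Rle_trans with ((Rabs L + 1) * (e / (Rabs L + 1))); [|apply Req_le; field; lra].
  apply Rle_trans with ((Rabs L + 1) * Rabs (y t' x - y t x)).
  - apply Rmult_le_compat_r; lra.
  - apply Rmult_le_compat_l; lra.
Qed.

Lemma sup_continuous_scal (a : R) (y : R -> R -> R) :
  sup_continuous y -> sup_continuous (fun t x => a * y t x).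
Proof.
  apply (sup_continuous_lipschitz (Rabs a)). intros t t' x.
  rewrite <- Rmult_minus_distr_l, Rabs_mult. apply Rle_refl.
Qed.

Lemma sup_continuous_minus (y z : R -> R -> R) :
  sup_continuous y -> sup_continuous z -> sup_continuous (fun t x => y t x - z t x).
Proof.
  intros y_cont z_cont. apply (sup_continuous_plus y (fun t x => - z t x)); [exact y_cont|].
  apply (sup_continuous_lipschitz 1 z); [|exact z_cont]. intros t t' x.
  rewrite <- Rabs_Ropp. apply Req_le. rewrite Rmult_1_l. f_equal. ring.
Qed.

Lemma Rabs_pow_minus_le (a b M : R) (n : nat) : Rabs a <= M -> Rabs b <= M ->
  Rabs (a ^ S n - b ^ S n) <= Rabs (a - b) * (INR (S n) * M ^ n).
Proof.
  intros a_le b_le. pose proof (Rabs_pos (a - b)) as diff_nonneg. induction n as [|n IH].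
  - rewrite !pow_1, pow_O. simpl. lra.
  - replace (a ^ S (S n) - b ^ S (S n)) with ((a - b) * a ^ S n + (a ^ S n - b ^ S n) * b)
      by (simpl; ring).
    eapply Rle_trans; [apply Rabs_triang|]. rewrite !Rabs_mult, <- RPow_abs.
    apply Rle_trans with (Rabs (a - b) * M ^ S n + Rabs (a - b) * (INR (S n) * M ^ n) * M).
    + apply Rplus_le_compat.
      * apply Rmult_le_compat_l; [exact diff_nonneg|].
        apply pow_incr. split; [apply Rabs_pos | exact a_le].
      * apply Rmult_le_compat; auto using Rabs_pos.
    + apply Req_le. rewrite (S_INR (S n)). simpl. ring.
Qed.

Lemma sup_continuous_pow (y : R -> R -> R) (M : R) (n : nat) :
  (forall t x, Rabs (y t x) <= M) -> sup_continuous y -> sup_continuous (fun t x => y t x ^ n).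
Proof.
  intros y_le_M. destruct n as [|n].
  - apply (sup_continuous_lipschitz 0). intros t t' x. rewrite Rminus_diag, Rabs_R0. lra.
  - apply (sup_continuous_lipschitz (INR (S n) * M ^ n)).
    intros t t' x. rewrite Rmult_comm. now apply Rabs_pow_minus_le.
Qed.

Lemma sup_continuous_separated (g h : R -> R) : continuity g -> (forall x, Rabs (h x) <= 1) ->
  sup_continuous (fun t x => g t * h x).
Proof.
  intros g_cont h_le_1 t e e_pos.
  destruct (proj1 (continuity_Rabs_le g) g_cont t e e_pos) as (d & d_pos & g_near).
  exists d. split; [exact d_pos|]. intros t' t'_near x.
  rewrite <- Rmult_minus_distr_r. eapply Rle_trans; [now apply Rabs_mult_le_l | now apply g_near].
Qed.

Lemma sup_continuous_lim (y : R -> R -> R) :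
  (forall e, 0 < e -> exists z, sup_continuous z /\ forall t x, Rabs (y t x - z t x) <= e) ->
  sup_continuous y.
Proof.
  intros y_lim t e e_pos. destruct (y_lim (e / 3)) as (z & z_cont & y_near_z); [lra|].
  destruct (z_cont t (e / 3)) as (d & d_pos & z_near); [lra|].
  exists d. split; [exact d_pos|]. intros t' t'_near x. specialize (z_near t' t'_near x).
  pose proof (y_near_z t x) as near_t. pose proof (y_near_z t' x) as near_t'.
  apply Rabs_le_between in z_near, near_t, near_t'. apply Rabs_le. lra.
Qed.

Lemma continuity_cos_coef (y : R -> R -> R) (j : nat) :
  sup_continuous y -> (forall t, continuity (y t)) -> continuity (fun t => cos_coef (y t) j).
Proof.
  intros y_cont slice_cont. apply continuity_Rabs_le. intros t e e_pos.
  destruct (y_cont t (e / 2)) as (d & d_pos & y_near); [lra|].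
  exists d. split; [exact d_pos|]. intros t' t'_near. rewrite <- cos_coef_minus by apply slice_cont.
  replace e with (2 * (e / 2)) by field.
  apply Rabs_cos_coef_le_const; [|now apply y_near].
  pose proof (slice_cont t). pose proof (slice_cont t'). reg.
Qed.

Lemma wiener_path_cos_coef_continuity (q B : R) (y : R -> R -> R) (j : nat) :
  wiener_path q B y -> continuity (fun t => cos_coef (y t) j).
Proof.
  intros [y_cont y_ball]. apply continuity_cos_coef; [exact y_cont|].
  intros t. apply (wiener_ball_continuity q B), y_ball.
Qed.

Lemma sup_continuous_of_cos_coef (q B : R) (y : R -> R -> R) : 1 < q ->
  (forall t, wiener_ball q B (y t)) -> (forall j, continuity (fun t => cos_coef (y t) j)) ->
  sup_continuous y.
Proof.
  intros q_gt_1 y_ball coef_cont. pose proof (Rinv_gt_1 q q_gt_1).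
  apply sup_continuous_lim. intros e e_pos.
  destruct (geom_eventually_le B (/ q) e) as [N small]; [lra | exact e_pos|].
  exists (fun t x => sum_f_R0 (fun k => cos_coef (y t) k * cos (INR k * x)) N). split.
  - clear small. induction N as [|N IH].
    + apply (sup_continuous_separated (fun t => cos_coef (y t) 0)); [apply coef_cont|].
      intros; apply Rabs_cos_le_1.
    + apply (sup_continuous_plus _ (fun t x => cos_coef (y t) (S N) * cos (INR (S N) * x)) IH).
      apply (sup_continuous_separated (fun t => cos_coef (y t) (S N))); [apply coef_cont|].
      intros; apply Rabs_cos_le_1.
  - intros t x. eapply Rle_trans; [apply (Rabs_cos_sum_tail_le q ltac:(lra) B), y_ball|].
    now apply small.
Qed.

Lemma wiener_path_minus (q B C D : R) (y z : R -> R -> R) :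
  wiener_path q B y -> wiener_path q C z -> (forall t, wiener_ball q D (fun x => y t x - z t x)) ->
  wiener_path q D (fun t x => y t x - z t x).
Proof.
  intros [y_cont _] [z_cont _] diff_ball. split; [now apply sup_continuous_minus | exact diff_ball].
Qed.

Lemma wiener_path_pow (q B : R) (y : R -> R -> R) (n : nat) : 1 <= q ->
  wiener_path q B y -> wiener_path q (B ^ n) (fun t x => y t x ^ n).
Proof.
  intros q_ge_1 [y_cont y_ball]. split.
  - apply sup_continuous_pow with B; [|exact y_cont]. intros t x. now apply wiener_ball_sup with q.
  - intros t. now apply wiener_ball_pow.
Qed.

Definition path_ball (q rho : R) (Y y : R -> R -> R) : Prop :=
  sup_continuous y /\ forall t, wiener_ball q rho (fun x => y t x - Y t x).

Section ContractionPrinciple.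

Variables (q rho : R) (Y : R -> R -> R) (Phi : (R -> R -> R) -> R -> R -> R).
Hypothesis q_ge_1 : 1 <= q.
Hypothesis rho_nonneg : 0 <= rho.
Hypothesis Y_cont : sup_continuous Y.
Hypothesis Phi_ball : forall y, path_ball q rho Y y -> path_ball q rho Y (Phi y).
Hypothesis Phi_contraction : forall y z D, path_ball q rho Y y -> path_ball q rho Y z ->
  (forall t, wiener_ball q D (fun x => y t x - z t x)) ->
  forall t, wiener_ball q (D / 2) (fun x => Phi y t x - Phi z t x).

Fixpoint picard (n : nat) : R -> R -> R :=
  match n with
  | O => Y
  | S m => Phi (picard m)
  end.

Definition picard_lim (t x : R) : R := real (Lim_seq (fun n => picard n t x)).

Lemma picard_ball (n : nat) : path_ball q rho Y (picard n).
Proof.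
  induction n as [|n IH]; [|now apply Phi_ball]. split; [exact Y_cont|]. intros t.
  apply (wiener_ball_ext q rho (fun _ => 0)); [intros; simpl; ring|].
  apply wiener_ball_const. now rewrite Rabs_R0.
Qed.

Lemma picard_step (n : nat) (t : R) :
  wiener_ball q (rho * (/ 2) ^ n) (fun x => picard (S n) t x - picard n t x).
Proof.
  revert t. induction n as [|n IH]; intros t.
  - apply (wiener_ball_le q rho); [simpl; lra|]. apply (proj2 (picard_ball 1)).
  - replace (rho * (/ 2) ^ S n) with (rho * (/ 2) ^ n / 2) by (simpl; field).
    exact (Phi_contraction _ _ _ (picard_ball (S n)) (picard_ball n) IH t).
Qed.

Lemma picard_gap (n m : nat) (t : R) : (n <= m)%nat ->
  wiener_ball q (2 * rho * (/ 2) ^ n) (fun x => picard m t x - picard n t x).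
Proof.
  intros n_le_m. apply (wiener_ball_le q (2 * rho * ((/ 2) ^ n - (/ 2) ^ m))).
  { apply Rmult_le_compat_l; [lra|].
    assert (0 < (/ 2) ^ m) by (apply pow_lt; lra). lra. }
  induction n_le_m as [|m n_le_m IH].
  - apply (wiener_ball_ext q _ (fun _ => 0)); [intros; ring|].
    apply wiener_ball_const. rewrite Rabs_R0. lra.
  - apply (wiener_ball_ext q _
      (fun x => (picard (S m) t x - picard m t x) + (picard m t x - picard n t x)));
      [intros; ring|].
    eapply wiener_ball_le; [|apply wiener_ball_plus; [apply picard_step | exact IH]].
    simpl. lra.
Qed.

Lemma is_lim_seq_picard (t x : R) : is_lim_seq (fun n => picard n t x) (picard_lim t x).
Proof.
  apply Lim_seq_correct', ex_lim_seq_cauchy_corr. intros [e e_pos].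
  destruct (geom_eventually_le (2 * rho) (/ 2) (e / 3)) as [N small]; [lra | lra|].
  exists N. intros n m N_le_n N_le_m. specialize (small N (le_n N)). simpl.
  pose proof (wiener_ball_sup q q_ge_1 _ _ x (picard_gap N n t N_le_n)) as gap_n.
  pose proof (wiener_ball_sup q q_ge_1 _ _ x (picard_gap N m t N_le_m)) as gap_m.
  apply Rabs_le_between in gap_n, gap_m. apply Rabs_lt_between. lra.
Qed.

Lemma Rabs_picard_lim_minus_le (n : nat) (t x : R) :
  Rabs (picard_lim t x - picard n t x) <= 2 * rho * (/ 2) ^ n.
Proof.
  assert (gap_lim : is_lim_seq (fun m => Rabs (picard (m + n) t x - picard n t x))
    (Rabs (picard_lim t x - picard n t x))).
  { apply (is_lim_seq_abs _ (Finite (picard_lim t x - picard n t x))).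
    apply is_lim_seq_minus'; [|apply is_lim_seq_const].
    apply (is_lim_seq_incr_n (fun m => picard m t x) n), is_lim_seq_picard. }
  refine (is_lim_seq_le _ (fun _ => 2 * rho * (/ 2) ^ n) (Finite _) (Finite _) _ gap_lim _);
    [|apply is_lim_seq_const].
  intros m. apply (wiener_ball_sup q q_ge_1 _ (fun x => picard (m + n) t x - picard n t x)).
  apply picard_gap. lia.
Qed.

Lemma picard_lim_near (e : R) : 0 < e ->
  exists N, forall n, (N <= n)%nat -> forall t x, Rabs (picard_lim t x - picard n t x) <= e.
Proof.
  intros e_pos. destruct (geom_eventually_le (2 * rho) (/ 2) e) as [N small]; [lra | exact e_pos|].
  exists N. intros n N_le_n t x.
  eapply Rle_trans; [apply Rabs_picard_lim_minus_le | now apply small].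
Qed.

Lemma picard_lim_gap (n : nat) (t : R) :
  wiener_ball q (2 * rho * (/ 2) ^ n) (fun x => picard_lim t x - picard n t x).
Proof.
  apply wiener_ball_lim. intros e e_pos. destruct (picard_lim_near e e_pos) as [N near].
  exists (fun x => picard (max N n) t x - picard n t x). split; [apply picard_gap; lia|].
  intros x. specialize (near (max N n) ltac:(lia) t x).
  now replace (picard_lim t x - picard n t x - (picard (max N n) t x - picard n t x))
    with (picard_lim t x - picard (max N n) t x) by ring.
Qed.

Lemma picard_lim_ball : path_ball q rho Y picard_lim.
Proof.
  split.
  - apply sup_continuous_lim. intros e e_pos. destruct (picard_lim_near e e_pos) as [N near].
    exists (picard N). split; [apply picard_ball | now apply near].
  - intros t. apply wiener_ball_lim. intros e e_pos.
    destruct (picard_lim_near e e_pos) as [N near].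
    exists (fun x => picard N t x - Y t x). split; [apply picard_ball|]. intros x.
    replace (picard_lim t x - Y t x - (picard N t x - Y t x))
      with (picard_lim t x - picard N t x) by ring.
    now apply near.
Qed.

Theorem contraction_fixed_point :
  exists y, path_ball q rho Y y /\ forall t x, y t x = Phi y t x.
Proof.
  exists picard_lim. split; [exact picard_lim_ball|]. intros t x. apply cond_eq. intros e e_pos.
  destruct (geom_eventually_le (2 * rho) (/ 2) (e / 3)) as [N small]; [lra | lra|].
  specialize (small N (le_n N)).
  pose proof (Rabs_picard_lim_minus_le (S N) t x) as lim_near.
  pose proof (wiener_ball_sup q q_ge_1 _ _ x (Phi_contraction _ _ _ picard_lim_ball (picard_ball N)
    (picard_lim_gap N) t)) as image_near.
  change (picard (S N) t x) with (Phi (picard N) t x) in lim_near.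
  simpl pow in lim_near. apply Rabs_le_between in lim_near, image_near. apply Rabs_lt_between. lra.
Qed.

End ContractionPrinciple.

(** * Duhamel's formula *)

Definition duhamel (w : R) (h : R -> R) (t : R) : R :=
  RInt (fun s => sin (w * (t - s)) * h s) 0 t / w.
Definition duhamel_dt (w : R) (h : R -> R) (t : R) : R :=
  RInt (fun s => cos (w * (t - s)) * h s) 0 t.

Definition cos_moment (w : R) (h : R -> R) (t : R) : R := RInt (fun s => cos (w * s) * h s) 0 t.
Definition sin_moment (w : R) (h : R -> R) (t : R) : R := RInt (fun s => sin (w * s) * h s) 0 t.

Lemma duhamel_at_0 (w : R) (h : R -> R) : duhamel w h 0 = 0.
Proof. unfold duhamel. rewrite RInt_point. apply Rmult_0_l. Qed.

Lemma duhamel_dt_at_0 (w : R) (h : R -> R) : duhamel_dt w h 0 = 0.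
Proof. apply (RInt_point 0 (fun s => cos (w * (0 - s)) * h s)). Qed.

Lemma duhamel_ext (w : R) (g h : R -> R) (t : R) :
  (forall s, g s = h s) -> duhamel w g t = duhamel w h t.
Proof.
  intros g_eq_h. unfold duhamel. f_equal. apply RInt_eq. intros s. now rewrite g_eq_h.
Qed.

Section Oscillator.

Variables (w : R) (h : R -> R).
Hypothesis h_cont : continuity h.

Lemma duhamel_minus (g : R -> R) (t : R) : continuity g ->
  duhamel w (fun s => h s - g s) t = duhamel w h t - duhamel w g t.
Proof.
  intros g_cont. unfold duhamel, Rdiv. rewrite <- Rmult_minus_distr_r, <- RInt_Rminus by reg.
  f_equal. apply RInt_eq. intros; ring.
Qed.

Lemma duhamel_addition_formula (t : R) :
  duhamel w h t = (sin (w * t) * cos_moment w h t - cos (w * t) * sin_moment w h t) / w.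
Proof.
  unfold duhamel, cos_moment, sin_moment. rewrite <- !RInt_Rmult, <- RInt_Rminus by reg.
  f_equal. apply RInt_eq. intros s. rewrite Rmult_minus_distr_l, sin_minus. ring.
Qed.

Lemma duhamel_dt_addition_formula (t : R) :
  duhamel_dt w h t = cos (w * t) * cos_moment w h t + sin (w * t) * sin_moment w h t.
Proof.
  unfold duhamel_dt, cos_moment, sin_moment. rewrite <- !RInt_Rmult, <- RInt_Rplus by reg.
  apply RInt_eq. intros s. rewrite Rmult_minus_distr_l, cos_minus. ring.
Qed.

Lemma is_derive_cos_moment (t : R) : is_derive (cos_moment w h) t (cos (w * t) * h t).
Proof. apply (is_derive_RInt_continuity (fun s => cos (w * s) * h s)). reg. Qed.

Lemma is_derive_sin_moment (t : R) : is_derive (sin_moment w h) t (sin (w * t) * h t).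
Proof. apply (is_derive_RInt_continuity (fun s => sin (w * s) * h s)). reg. Qed.

Lemma is_derive_duhamel (t : R) : w <> 0 -> is_derive (duhamel w h) t (duhamel_dt w h t).
Proof.
  intros w_neq_0. eapply is_derive_ext; [intros; symmetry; apply duhamel_addition_formula|].
  rewrite duhamel_dt_addition_formula. auto_derive.
  - repeat split; eexists; [apply is_derive_cos_moment | apply is_derive_sin_moment].
  - replace (Derive (fun x => cos_moment w h x) t) with (cos (w * t) * h t)
      by (symmetry; apply is_derive_unique, is_derive_cos_moment).
    replace (Derive (fun x => sin_moment w h x) t) with (sin (w * t) * h t)
      by (symmetry; apply is_derive_unique, is_derive_sin_moment).
    field. exact w_neq_0.
Qed.

Lemma is_derive_duhamel_dt (t : R) : w <> 0 ->
  is_derive (duhamel_dt w h) t (h t - w ^ 2 * duhamel w h t).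
Proof.
  intros w_neq_0. eapply is_derive_ext; [intros; symmetry; apply duhamel_dt_addition_formula|].
  rewrite duhamel_addition_formula. auto_derive.
  - repeat split; eexists; [apply is_derive_cos_moment | apply is_derive_sin_moment].
  - replace (Derive (fun x => cos_moment w h x) t) with (cos (w * t) * h t)
      by (symmetry; apply is_derive_unique, is_derive_cos_moment).
    replace (Derive (fun x => sin_moment w h x) t) with (sin (w * t) * h t)
      by (symmetry; apply is_derive_unique, is_derive_sin_moment).
    transitivity ((Rsqr (sin (w * t)) + Rsqr (cos (w * t))) * h t
      - w * (sin (w * t) * cos_moment w h t - cos (w * t) * sin_moment w h t)).
    + unfold Rsqr. ring.
    + rewrite sin2_cos2. field. exact w_neq_0.
Qed.

Lemma continuity_duhamel : w <> 0 -> continuity (duhamel w h).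
Proof.
  intros w_neq_0. apply (continuity_is_derive _ (duhamel_dt w h)). intros t.
  now apply is_derive_duhamel.
Qed.

Section SupportedForce.

Variables a b : R.
Hypothesis h_supp : forall s, s < a \/ b < s -> h s = 0.

Lemma Rabs_RInt_mult_le (u : R -> R) (t : R) : continuity u -> (forall s, Rabs (u s) <= 1) ->
  Rabs (RInt (fun s => u s * h s) 0 t) <= RInt (fun s => Rabs (h s)) a b.
Proof.
  intros u_cont u_le_1. apply Rabs_RInt_le_support; [reg | reg | |].
  - intros s. rewrite Rmult_comm. now apply Rabs_mult_le_l.
  - intros s s_out. rewrite h_supp by exact s_out. apply Rabs_R0.
Qed.

Lemma Rabs_duhamel_le (t : R) : 0 < w ->
  Rabs (duhamel w h t) <= / w * RInt (fun s => Rabs (h s)) a b.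
Proof.
  intros w_pos. unfold duhamel, Rdiv. pose proof (Rinv_0_lt_compat w w_pos).
  rewrite Rmult_comm, Rabs_mult, (Rabs_pos_eq (/ w)) by lra. apply Rmult_le_compat_l; [lra|].
  apply (Rabs_RInt_mult_le (fun s => sin (w * (t - s)))); [reg | intros; apply Rabs_sin_le_1].
Qed.

Lemma Rabs_duhamel_dt_le (t : R) : Rabs (duhamel_dt w h t) <= RInt (fun s => Rabs (h s)) a b.
Proof.
  apply (Rabs_RInt_mult_le (fun s => cos (w * (t - s)))); [reg | intros; apply Rabs_cos_le_1].
Qed.

End SupportedForce.

End Oscillator.

Lemma duhamel_dt_periods (j K : nat) (h : R -> R) :
  duhamel_dt (INR j) h (INR K * (2 * PI)) = cos_moment (INR j) h (INR K * (2 * PI)).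
Proof.
  apply RInt_eq. intros s. f_equal. rewrite <- (cos_neg (INR j * s)).
  rewrite <- (cos_period (- (INR j * s)) (j * K)). f_equal. rewrite mult_INR. ring.
Qed.

(** * The forced wave operator *)

Lemma sum_low_high_le (u v x : nat -> R) (M : R) (N n : nat) :
  (forall j, 0 <= u j) -> (forall j, 0 <= v j) -> (forall j, 0 <= x j) ->
  (forall j, (j <= N)%nat -> x j <= M) -> (forall j, (N < j)%nat -> u j <= v j) ->
  sum_f_R0 (fun j => u j * x j) n <= M * sum_f_R0 u N + sum_f_R0 (fun j => v j * x j) n.
Proof.
  intros u_nonneg v_nonneg x_nonneg x_low u_high.
  assert (M_nonneg : 0 <= M) by (eapply Rle_trans; [apply (x_nonneg 0%nat) | apply x_low; lia]).
  assert (vx_nonneg : forall j, 0 <= v j * x j) by (intros; now apply Rmult_le_pos).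
  assert (low : forall m, (m <= N)%nat -> sum_f_R0 (fun j => u j * x j) m <= M * sum_f_R0 u N).
  { intros m m_le_N. apply Rle_trans with (M * sum_f_R0 u m).
    - rewrite scal_sum. apply sum_Rle. intros j j_le_m.
      apply Rmult_le_compat_l; [apply u_nonneg | apply x_low; lia].
    - apply Rmult_le_compat_l; [exact M_nonneg | now apply sum_f_R0_mono]. }
  induction n as [|n IH].
  - specialize (low 0%nat ltac:(lia)). specialize (vx_nonneg 0%nat). simpl in *. lra.
  - destruct (le_lt_dec (S n) N) as [low_n|high_n].
    + pose proof (cond_pos_sum _ (S n) vx_nonneg). specialize (low (S n) low_n). lra.
    + rewrite !tech5.
      assert (u (S n) * x (S n) <= v (S n) * x (S n)); [|lra].
      apply Rmult_le_compat_r; [apply x_nonneg | now apply u_high].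
Qed.

Section WaveOperator.

Variables (q a b : R) (N : nat) (w : nat -> R) (chi E F : R -> R).
Hypothesis q_gt_1 : 1 < q.
Hypothesis N_pos : (0 < N)%nat.
Hypothesis w_pos : forall j, 0 < w j.
Hypothesis w_high : forall j, (N < j)%nat -> INR N <= w j.
Hypothesis a_le_b : a <= b.
Hypothesis chi_cont : continuity chi.
Hypothesis chi_range : forall s, 0 <= chi s <= 1.
Hypothesis chi_supp : forall s, s < a \/ b < s -> chi s = 0.
Hypothesis E_cont : continuity E.
Hypothesis F_cont : continuity F.

Definition force (f : R -> R -> R) (j : nat) (s : R) : R := chi s * cos_coef (f s) j.

Definition wave (f : R -> R -> R) (t : R) : R -> R :=
  cos_series (fun j => duhamel (w j) (force f j) t).

Definition concentrated (G W : R) (f : R -> R -> R) : Prop :=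
  wiener_path q W f /\ forall s x, Rabs (f s x) <= G * (E s * F x).

(* The low modes use the concentration of the force, the high ones only the factor [1 / w j]. *)
Definition wave_bound (G W : R) : R :=
  G / PI * RInt F 0 (2 * PI) * RInt E a b * sum_f_R0 (fun j => q ^ j / w j) N
  + W * (b - a) / INR N.

Lemma wave_bound_scal (c G W : R) : wave_bound (c * G) (c * W) = c * wave_bound G W.
Proof. unfold wave_bound, Rdiv. ring. Qed.

Lemma wave_bound_le_r (G W W' : R) : W <= W' -> wave_bound G W <= wave_bound G W'.
Proof.
  intros W_le. apply Rplus_le_compat_l. apply Rmult_le_compat_r.
  - apply Rlt_le, Rinv_0_lt_compat, lt_0_INR, N_pos.
  - apply Rmult_le_compat_r; lra.
Qed.

Section ConcentratedForce.

Variables (G W : R) (f : R -> R -> R).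
Hypothesis f_conc : concentrated G W f.

Lemma continuity_force (j : nat) : continuity (force f j).
Proof.
  apply continuity_mult; [exact chi_cont|].
  now apply (wiener_path_cos_coef_continuity q W), f_conc.
Qed.

Lemma force_supp (j : nat) (s : R) : s < a \/ b < s -> force f j s = 0.
Proof. intros s_out. unfold force. rewrite chi_supp by exact s_out. ring. Qed.

Lemma Rabs_force_le (j : nat) (s : R) : Rabs (force f j s) <= Rabs (cos_coef (f s) j).
Proof.
  unfold force. rewrite Rmult_comm. apply Rabs_mult_le_l.
  destruct (chi_range s). rewrite Rabs_pos_eq; lra.
Qed.

Lemma RInt_Rabs_force_le (j : nat) :
  RInt (fun s => Rabs (force f j s)) a b <= G / PI * RInt F 0 (2 * PI) * RInt E a b.
Proof.
  pose proof (continuity_force j). rewrite <- RInt_Rmult by exact E_cont.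
  apply RInt_mono; [lra | reg | reg |]. intros s _.
  eapply Rle_trans; [apply Rabs_force_le|].
  apply Rle_trans with (/ PI * RInt (fun x => G * E s * F x) 0 (2 * PI)).
  - apply Rabs_cos_coef_le; [|reg|].
    + apply (wiener_ball_continuity q W), f_conc.
    + intros x. rewrite Rmult_assoc. apply f_conc.
  - rewrite RInt_Rmult by exact F_cont. apply Req_le. field. apply PI_neq0.
Qed.

Lemma sum_RInt_Rabs_force_le (n : nat) :
  sum_f_R0 (fun j => q ^ j * RInt (fun s => Rabs (force f j s)) a b) n <= W * (b - a).
Proof.
  assert (term_cont : forall j, continuity (fun s => q ^ j * Rabs (force f j s))).
  { intros j. pose proof (continuity_force j). reg. }
  rewrite (sum_eq _ (fun j => RInt (fun s => q ^ j * Rabs (force f j s)) a b)).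
  - rewrite <- (RInt_sum_f_R0 (fun j s => q ^ j * Rabs (force f j s))) by exact term_cont.
    rewrite Rmult_comm, <- RInt_Rconst. apply RInt_mono; [lra | | reg |].
    + now apply (continuity_sum_f_R0 (fun j s => q ^ j * Rabs (force f j s))).
    + intros s _. eapply Rle_trans; [|apply (cos_coef_weighted_l1 q ltac:(lra) W (f s)), f_conc].
      apply sum_Rle. intros j _. rewrite Rmult_comm.
      apply Rmult_le_compat_r; [apply pow_le; lra | apply Rabs_force_le].
  - intros j _. pose proof (continuity_force j). rewrite RInt_Rmult by reg. reflexivity.
Qed.

Lemma duhamel_force_weighted_l1 (t : R) :
  weighted_l1 q (wave_bound G W) (fun j => duhamel (w j) (force f j) t).
Proof.
  intros n. set (x := fun j => RInt (fun s => Rabs (force f j s)) a b).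
  assert (pow_pos : forall j, 0 < q ^ j) by (intros; apply pow_lt; lra).
  assert (N_pos' : 0 < INR N) by now apply lt_0_INR.
  apply Rle_trans with (sum_f_R0 (fun j => q ^ j / w j * x j) n).
  - apply sum_Rle. intros j _. pose proof (continuity_force j) as force_cont.
    apply Rle_trans with (/ w j * x j * q ^ j); [|unfold Rdiv; lra].
    apply Rmult_le_compat_r; [apply Rlt_le, pow_pos|].
    apply Rabs_duhamel_le; auto using force_supp.
  - apply Rle_trans with (G / PI * RInt F 0 (2 * PI) * RInt E a b
      * sum_f_R0 (fun j => q ^ j / w j) N + sum_f_R0 (fun j => q ^ j / INR N * x j) n).
    + apply sum_low_high_le.
      * intros j. apply Rlt_le, Rdiv_lt_0_compat; auto.
      * intros j. apply Rlt_le, Rdiv_lt_0_compat; auto.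
      * intros j. pose proof (continuity_force j).
        apply RInt_nonneg; [lra | reg | intros; apply Rabs_pos].
      * intros j _. apply RInt_Rabs_force_le.
      * intros j N_lt_j. apply Rmult_le_compat_l; [apply Rlt_le, pow_pos|].
        apply Rinv_le_contravar; auto.
    + apply Rplus_le_compat_l. rewrite (sum_eq _ (fun j => q ^ j * x j * / INR N))
        by (intros; unfold Rdiv; ring).
      rewrite <- scal_sum, Rmult_comm. apply Rmult_le_compat_r.
      * now apply Rlt_le, Rinv_0_lt_compat.
      * apply sum_RInt_Rabs_force_le.
Qed.

Lemma wiener_ball_wave (t : R) : wiener_ball q (wave_bound G W) (wave f t).
Proof. apply wiener_ball_cos_series; [exact q_gt_1 | apply duhamel_force_weighted_l1]. Qed.

Lemma cos_coef_wave (t : R) (j : nat) : cos_coef (wave f t) j = duhamel (w j) (force f j) t.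
Proof. exact (cos_coef_cos_series q _ _ q_gt_1 (duhamel_force_weighted_l1 t) j). Qed.

Lemma sup_continuous_wave : sup_continuous (wave f).
Proof.
  apply (sup_continuous_of_cos_coef q (wave_bound G W)); [exact q_gt_1 | apply wiener_ball_wave|].
  intros j t. apply (continuity_pt_ext (duhamel (w j) (force f j))).
  - intros s. symmetry. apply cos_coef_wave.
  - apply continuity_duhamel; [apply continuity_force|]. specialize (w_pos j). lra.
Qed.

End ConcentratedForce.

Lemma wave_minus (f g : R -> R -> R) (Gf Wf Gg Wg t x : R) :
  concentrated Gf Wf f -> concentrated Gg Wg g ->
  wave (fun s x => f s x - g s x) t x = wave f t x - wave g t x.
Proof.
  intros f_conc g_conc.
  pose proof (fun G W h (h_conc : concentrated G W h) => weighted_l1_summable _ _ _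
    (duhamel_force_weighted_l1 G W h h_conc t) q_gt_1) as summable.
  unfold wave. rewrite <- (cos_series_minus _ _ _ (summable _ _ f f_conc) (summable _ _ g g_conc)).
  apply Series_ext. intros j. f_equal.
  rewrite <- duhamel_minus by (eapply continuity_force; eassumption).
  apply duhamel_ext. intros s. unfold force.
  rewrite cos_coef_minus; [ring| |]; eapply wiener_ball_continuity; [apply f_conc | apply g_conc].
Qed.

Section PowerNonlinearity.

Variables (k : nat) (eps rho B : R) (Y : R -> R -> R).
Hypothesis eps_nonneg : 0 <= eps.
Hypothesis rho_nonneg : 0 <= rho.
Hypothesis Y_path : wiener_path q B Y.
Hypothesis Y_envelope : forall t x, (Rabs (Y t x) + rho) ^ k <= E t * F x.
Hypothesis rho_large : B + rho <= 2 * INR (S k) * rho.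
Hypothesis smallness : eps * (INR (S k) * wave_bound 1 ((B + rho) ^ k)) <= / 2.

Lemma path_ball_wiener_path (y : R -> R -> R) : path_ball q rho Y y -> wiener_path q (B + rho) y.
Proof.
  intros [y_cont y_near]. split; [exact y_cont|]. intros t.
  apply (wiener_ball_ext q _ (fun x => Y t x + (y t x - Y t x))); [intros; ring|].
  apply wiener_ball_plus; [apply Y_path | apply y_near].
Qed.

Lemma path_ball_sup (y : R -> R -> R) (t x : R) : path_ball q rho Y y ->
  Rabs (y t x) <= Rabs (Y t x) + rho.
Proof.
  intros [_ y_near]. pose proof (wiener_ball_sup q ltac:(lra) _ _ x (y_near t)).
  replace (y t x) with (Y t x + (y t x - Y t x)) by ring.
  eapply Rle_trans; [apply Rabs_triang|]. lra.
Qed.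

Lemma Rabs_pow_le_envelope (y : R -> R -> R) (t x : R) : path_ball q rho Y y ->
  Rabs (y t x ^ S k) <= (B + rho) * (E t * F x).
Proof.
  intros y_ball. simpl. rewrite Rabs_mult, <- RPow_abs.
  apply Rmult_le_compat; [apply Rabs_pos | apply pow_le, Rabs_pos | |].
  - apply (wiener_ball_sup q ltac:(lra)). now apply path_ball_wiener_path.
  - eapply Rle_trans; [|apply Y_envelope]. apply pow_incr.
    split; [apply Rabs_pos | now apply path_ball_sup].
Qed.

Lemma concentrated_pow (y : R -> R -> R) : path_ball q rho Y y ->
  concentrated (B + rho) ((B + rho) ^ S k) (fun t x => y t x ^ S k).
Proof.
  intros y_ball. split.
  - apply wiener_path_pow; [lra | now apply path_ball_wiener_path].
  - intros t x. now apply Rabs_pow_le_envelope.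
Qed.

Lemma concentrated_pow_minus (y z : R -> R -> R) (D : R) : path_ball q rho Y y ->
  path_ball q rho Y z -> (forall t, wiener_ball q D (fun x => y t x - z t x)) ->
  concentrated (D * INR (S k) * 1) (D * INR (S k) * (B + rho) ^ k)
    (fun t x => y t x ^ S k - z t x ^ S k).
Proof.
  intros y_ball z_ball diff_ball. split.
  - apply wiener_path_minus with ((B + rho) ^ S k) ((B + rho) ^ S k);
      try now apply concentrated_pow.
    intros t. rewrite Rmult_assoc.
    apply wiener_ball_pow_minus; try apply path_ball_wiener_path; auto; lra.
  - intros t x. eapply Rle_trans.
    + apply Rabs_pow_minus_le with (M := Rabs (Y t x) + rho); now apply path_ball_sup.
    + rewrite Rmult_1_r, <- Rmult_assoc.
      pose proof (wiener_ball_sup q ltac:(lra) _ _ x (diff_ball t)).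
      apply Rmult_le_compat; try apply Y_envelope.
      * apply Rmult_le_pos; [apply Rabs_pos | apply pos_INR].
      * apply pow_le. pose proof (Rabs_pos (Y t x)). lra.
      * now apply Rmult_le_compat_r; [apply pos_INR|].
Qed.

Definition duhamel_map (y : R -> R -> R) (t x : R) : R :=
  Y t x - eps * wave (fun s x => y s x ^ S k) t x.

Lemma path_ball_duhamel_map (y : R -> R -> R) : path_ball q rho Y y ->
  path_ball q rho Y (duhamel_map y).
Proof.
  intros y_ball. pose proof (concentrated_pow y y_ball) as pow_conc. split.
  - apply sup_continuous_minus; [apply Y_path|].
    apply (sup_continuous_scal eps (wave (fun s x => y s x ^ S k))).
    eapply sup_continuous_wave, pow_conc.
  - intros t. apply (wiener_ball_ext q _ (fun x => - eps * wave (fun s x => y s x ^ S k) t x));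
      [intros; unfold duhamel_map; ring|].
    apply (wiener_ball_le q (Rabs (- eps) * wave_bound (B + rho) ((B + rho) ^ S k)));
      [|apply wiener_ball_scal; [lra | now apply wiener_ball_wave]].
    rewrite Rabs_Ropp, Rabs_pos_eq by exact eps_nonneg.
    rewrite <- (Rmult_1_r (B + rho)) at 1.
    change ((B + rho) ^ S k) with ((B + rho) * (B + rho) ^ k).
    rewrite wave_bound_scal.
    assert (k_pos : 0 < INR (S k)) by (apply lt_0_INR; lia).
    assert (B_nonneg : 0 <= B + rho)
      by (apply (wiener_ball_nonneg q ltac:(lra) _ (y 0)); now apply path_ball_wiener_path).
    apply Rmult_le_reg_l with (INR (S k)); [exact k_pos|].
    apply Rle_trans with ((B + rho) * / 2); [|lra].
    replace (INR (S k) * (eps * ((B + rho) * wave_bound 1 ((B + rho) ^ k))))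
      with ((B + rho) * (eps * (INR (S k) * wave_bound 1 ((B + rho) ^ k)))) by ring.
    now apply Rmult_le_compat_l.
Qed.

Lemma duhamel_map_contraction (y z : R -> R -> R) (D : R) : path_ball q rho Y y ->
  path_ball q rho Y z -> (forall t, wiener_ball q D (fun x => y t x - z t x)) ->
  forall t, wiener_ball q (D / 2) (fun x => duhamel_map y t x - duhamel_map z t x).
Proof.
  intros y_ball z_ball diff_ball t.
  assert (D_nonneg : 0 <= D) by exact (wiener_ball_nonneg q ltac:(lra) _ _ (diff_ball 0)).
  apply (wiener_ball_ext q _
    (fun x => - eps * wave (fun s x => y s x ^ S k - z s x ^ S k) t x)).
  { intros x. unfold duhamel_map.
    rewrite (wave_minus (fun s x => y s x ^ S k) (fun s x => z s x ^ S k)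
      (B + rho) ((B + rho) ^ S k) (B + rho) ((B + rho) ^ S k)) by now apply concentrated_pow.
    ring. }
  apply (wiener_ball_le q
    (Rabs (- eps) * wave_bound (D * INR (S k) * 1) (D * INR (S k) * (B + rho) ^ k)));
    [|apply wiener_ball_scal; [lra | now apply wiener_ball_wave, concentrated_pow_minus]].
  rewrite Rabs_Ropp, Rabs_pos_eq, wave_bound_scal by exact eps_nonneg.
  replace (eps * (D * INR (S k) * wave_bound 1 ((B + rho) ^ k)))
    with (D * (eps * (INR (S k) * wave_bound 1 ((B + rho) ^ k)))) by ring.
  now apply Rmult_le_compat_l.
Qed.

Theorem forced_wave_solution :
  exists y, path_ball q rho Y y /\
    forall t j, cos_coef (y t) j
      = cos_coef (Y t) j - eps * duhamel (w j) (force (fun s x => y s x ^ S k) j) t.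
Proof.
  destruct (contraction_fixed_point q rho Y duhamel_map ltac:(lra) rho_nonneg (proj1 Y_path)
    path_ball_duhamel_map duhamel_map_contraction) as (y & y_ball & y_fixed).
  exists y. split; [exact y_ball|]. intros t j.
  pose proof (concentrated_pow y y_ball) as pow_conc.
  rewrite (cos_coef_ext _ _ _ (y_fixed t)). unfold duhamel_map.
  pose proof (wiener_ball_continuity _ _ _ (wiener_ball_wave _ _ _ pow_conc t)) as wave_cont.
  pose proof (wiener_ball_continuity _ _ _ (proj2 Y_path t)) as Y_slice_cont.
  rewrite cos_coef_minus, (cos_coef_scal eps) by reg. now rewrite (cos_coef_wave _ _ _ pow_conc).
Qed.

End PowerNonlinearity.

End WaveOperator.

(** * Concentration at the zeros of the sine *)

Definition peak (lam t : R) : R := exp (- (lam * sin t ^ 2 / 2)).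
Definition peak_mass (lam : R) : R := PI / sqrt (lam / 18).

Lemma peak_pos (lam t : R) : 0 < peak lam t.
Proof. apply exp_pos. Qed.

Lemma continuity_peak (lam : R) : continuity (peak lam).
Proof. unfold peak. reg. Qed.

Lemma continuity_peak_double (lam : R) : continuity (fun x => peak lam (2 * x)).
Proof. unfold peak. reg. Qed.

Lemma peak_shift (lam t : R) : peak lam (t + PI) = peak lam t.
Proof. unfold peak. rewrite neg_sin. do 4 f_equal. ring. Qed.

Lemma peak_antimono (mu lam t : R) : mu <= lam -> peak lam t <= peak mu t.
Proof.
  intros mu_le_lam. apply exp_le_mono. pose proof (pow2_ge_0 (sin t)).
  pose proof (Rmult_le_compat_r (sin t ^ 2) mu lam ltac:(lra) mu_le_lam). lra.
Qed.

Lemma exp_opp_le (z : R) : 0 <= z -> exp (- z) <= / (1 + z).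
Proof. intros z_nonneg. rewrite exp_Ropp. apply Rinv_le_contravar; [lra | apply exp_ineq1_le]. Qed.

Lemma sin_ge_third (x : R) : 0 <= x <= PI / 2 -> x / 3 <= sin x.
Proof.
  intros x_in. pose proof PI_4 as PI_le_4. pose proof PI_RGT_0.
  destruct (SIN x) as [taylor _]; try lra.
  unfold sin_lb, sin_approx, sin_term in taylor. simpl in taylor.
  assert (x_sq : 0 <= x ^ 2 <= 4) by (simpl; nra).
  assert (cubic : x * (1 / 3) <= x * (1 - x ^ 2 / 6)) by (apply Rmult_le_compat_l; lra).
  assert (quintic : 0 <= x ^ 5 * (/ 120 - x ^ 2 / 5040))
    by (apply Rmult_le_pos; [apply pow_le|]; lra).
  simpl in *. lra.
Qed.

Lemma sin_sq_ge (x : R) : Rabs x <= PI / 2 -> x ^ 2 / 9 <= sin x ^ 2.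
Proof.
  assert (nonneg_case : forall y, 0 <= y <= PI / 2 -> y ^ 2 / 9 <= sin y ^ 2).
  { intros y y_in. replace (y ^ 2 / 9) with ((y / 3) ^ 2) by field.
    apply pow_incr. split; [lra | now apply sin_ge_third]. }
  intros x_in. destruct (Rle_dec 0 x) as [x_nonneg|x_neg].
  - apply nonneg_case. rewrite Rabs_pos_eq in x_in; lra.
  - rewrite Rabs_left in x_in by lra. specialize (nonneg_case (- x) ltac:(lra)).
    rewrite sin_neg in nonneg_case. lra.
Qed.

Lemma continuity_cauchy_density (k : R) : continuity (fun t => / (1 + (k * t) ^ 2)).
Proof.
  apply (continuity_inv (fun t => 1 + (k * t) ^ 2)); [reg|].
  intros t. pose proof (pow2_ge_0 (k * t)). lra.
Qed.

Lemma RInt_cauchy_density_le (k a b : R) : 0 < k ->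
  RInt (fun t => / (1 + (k * t) ^ 2)) a b <= PI / k.
Proof.
  intros k_pos.
  rewrite (is_RInt_unique _ a b (minus (atan (k * b) / k) (atan (k * a) / k))).
  - unfold minus, plus, opp, Rdiv; simpl. destruct (atan_bound (k * b)), (atan_bound (k * a)).
    rewrite Ropp_mult_distr_l, <- Rmult_plus_distr_r.
    apply Rmult_le_compat_r; [apply Rlt_le, Rinv_0_lt_compat, k_pos | lra].
  - apply (is_RInt_derive (fun t => atan (k * t) / k)).
    + intros t _. pose proof (pow2_ge_0 (k * t)). simpl in *.
      auto_derive; [easy|]. unfold Rsqr. field. split; lra.
    + intros t _. apply (continuity_continuous (fun t => / (1 + (k * t) ^ 2))).
      apply continuity_cauchy_density.
Qed.

Section PeakIntegrals.

Variable lam : R.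
Hypothesis lam_pos : 0 < lam.

Lemma peak_mass_pos : 0 < peak_mass lam.
Proof. apply Rdiv_lt_0_compat; [apply PI_RGT_0 | apply sqrt_lt_R0; lra]. Qed.

Lemma peak_mass_sq : peak_mass lam ^ 2 = 18 * PI ^ 2 / lam.
Proof.
  unfold peak_mass. pose proof (sqrt_lt_R0 (lam / 18) ltac:(lra)) as sqrt_pos.
  replace ((PI / sqrt (lam / 18)) ^ 2) with (PI ^ 2 / (sqrt (lam / 18) * sqrt (lam / 18)))
    by (field; lra).
  rewrite sqrt_sqrt by lra. field. lra.
Qed.

Lemma peak_le_cauchy_density (t : R) : Rabs t <= PI / 2 ->
  peak lam t <= / (1 + (sqrt (lam / 18) * t) ^ 2).
Proof.
  intros t_in. pose proof (sin_sq_ge t t_in) as sin_sq. pose proof (pow2_ge_0 t).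
  assert (sin_nonneg : 0 <= lam * sin t ^ 2) by (apply Rmult_le_pos; lra).
  eapply Rle_trans; [apply exp_opp_le; lra|]. rewrite Rpow_mult_distr, pow2_sqrt by lra.
  apply Rinv_le_contravar.
  - assert (0 <= lam / 18 * t ^ 2) by (apply Rmult_le_pos; lra). lra.
  - pose proof (Rmult_le_compat_l lam _ _ (Rlt_le _ _ lam_pos) sin_sq). lra.
Qed.

Lemma RInt_peak_le (a : R) (n : nat) :
  RInt (peak lam) a (a + INR n * PI) <= INR n * peak_mass lam.
Proof.
  pose proof (continuity_peak lam) as peak_cont. pose proof PI_RGT_0.
  rewrite RInt_periods by (exact peak_cont || apply peak_shift).
  apply Rmult_le_compat_l; [apply pos_INR|].
  rewrite <- (RInt_period _ _ peak_cont (peak_shift lam) (- (PI / 2))).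
  replace (- (PI / 2) + PI) with (PI / 2) by field.
  eapply Rle_trans; [|apply RInt_cauchy_density_le, sqrt_lt_R0; lra].
  apply RInt_mono; [lra | exact peak_cont | apply continuity_cauchy_density|].
  intros t t_in. apply peak_le_cauchy_density, Rabs_le. lra.
Qed.

Lemma RInt_peak_periods_le (K : nat) :
  RInt (peak lam) 0 (INR K * (2 * PI)) <= 2 * INR K * peak_mass lam.
Proof.
  pose proof (RInt_peak_le 0 (2 * K)) as bound.
  rewrite Rplus_0_l, mult_INR in bound. simpl (INR 2) in bound.
  now replace ((1 + 1) * INR K * PI) with (INR K * (2 * PI)) in bound by ring.
Qed.

Lemma RInt_peak_double_le : RInt (fun x => peak lam (2 * x)) 0 (2 * PI) <= 2 * peak_mass lam.
Proof.
  pose proof (RInt_comp_lin (peak lam) 2 0 0 (2 * PI)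
    (ex_RInt_continuity _ _ _ (continuity_peak lam))) as rescale.
  rewrite (RInt_eq _ (fun x => 2 * peak lam (2 * x))) in rescale
    by (intros; unfold scal; simpl; unfold mult; simpl; now rewrite Rplus_0_r).
  rewrite RInt_Rmult in rescale by apply continuity_peak_double.
  replace (2 * (2 * PI) + 0) with (2 * 0 + 0 + INR 4 * PI) in rescale by (simpl; ring).
  pose proof (RInt_peak_le (2 * 0 + 0) 4) as four_peaks. simpl INR in *. lra.
Qed.

Lemma sin_sq_peak_le (t : R) : sin t ^ 2 * peak lam t <= 4 / lam * peak (lam / 2) t.
Proof.
  unfold peak. set (z := lam * sin t ^ 2 / 4).
  assert (z_nonneg : 0 <= z)
    by (unfold z; pose proof (Rmult_le_pos lam (sin t ^ 2) ltac:(lra) (pow2_ge_0 _)); lra).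
  replace (- (lam * sin t ^ 2 / 2)) with (- z + - z) by (unfold z; field).
  replace (- (lam / 2 * sin t ^ 2 / 2)) with (- z) by (unfold z; field).
  replace (sin t ^ 2) with (4 / lam * z) by (unfold z; field; lra).
  rewrite exp_plus. pose proof (exp_pos (- z)).
  assert (z_exp_le_1 : z * exp (- z) <= 1).
  { apply Rle_trans with (z * / (1 + z)).
    - apply Rmult_le_compat_l; [exact z_nonneg | now apply exp_opp_le].
    - apply Rmult_le_reg_r with (1 + z); [lra|]. rewrite Rmult_assoc, Rinv_l; lra. }
  rewrite Rmult_assoc. apply Rmult_le_compat_l; [apply Rlt_le, Rdiv_lt_0_compat; lra|].
  rewrite <- Rmult_assoc. nra.
Qed.

End PeakIntegrals.

(** * Resonant forcing by a concentrated source *)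

Lemma Rabs_sin_le_Rabs (x : R) : Rabs (sin x) <= Rabs x.
Proof.
  assert (pos_case : forall y, 0 < y -> Rabs (sin y) <= y).
  { intros y y_pos. pose proof PI2_1. destruct (Rle_dec y 1) as [y_le_1|y_gt_1].
    - rewrite Rabs_pos_eq; [apply Rlt_le, sin_lt_x, y_pos | apply sin_ge_0; lra].
    - eapply Rle_trans; [apply Rabs_sin_le_1 | lra]. }
  destruct (Rtotal_order x 0) as [x_neg|[->|x_pos]].
  - rewrite (Rabs_left x), <- Rabs_Ropp, <- sin_neg by exact x_neg. apply pos_case. lra.
  - rewrite sin_0. apply Rle_refl.
  - rewrite (Rabs_pos_eq x) by lra. now apply pos_case.
Qed.

Lemma cos_ge_quadratic (x : R) : 1 - x ^ 2 / 2 <= cos x.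
Proof.
  replace (cos x) with (cos (2 * (x / 2))) by (f_equal; field). rewrite cos_2a_sin.
  assert (sin_sq : sin (x / 2) ^ 2 <= (x / 2) ^ 2).
  { rewrite <- (pow2_abs (sin _)), <- (pow2_abs (x / 2)).
    apply pow_incr. split; [apply Rabs_pos | apply Rabs_sin_le_Rabs]. }
  simpl in *. lra.
Qed.

Lemma Rabs_sin_INR_mult_le (n : nat) (z : R) : Rabs (sin (INR n * z)) <= INR n * Rabs (sin z).
Proof.
  induction n as [|n IH]; [simpl; rewrite !Rmult_0_l, sin_0, Rabs_R0; lra|].
  rewrite S_INR, Rmult_plus_distr_r, Rmult_1_l, sin_plus.
  eapply Rle_trans; [apply Rabs_triang|]. rewrite (Rmult_comm (cos _)).
  pose proof (Rabs_mult_cos_le (sin (INR n * z)) z).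
  pose proof (Rabs_mult_cos_le (sin z) (INR n * z)). lra.
Qed.

Lemma sin_INR_mult_sq_le (n : nat) (z : R) : sin (INR n * z) ^ 2 <= INR n ^ 2 * sin z ^ 2.
Proof.
  rewrite <- (pow2_abs (sin (INR n * z))), <- (pow2_abs (sin z)), <- Rpow_mult_distr.
  apply pow_incr. split; [apply Rabs_pos | apply Rabs_sin_INR_mult_le].
Qed.

(* Multiples of 4 are in phase at both kinds of peaks, [(0, 0)] and [(PI, PI / 2)], of the linear
   solution. *)
Lemma cos_cos_ge (n : nat) (s x : R) :
  1 - INR n ^ 2 * (8 * sin s ^ 2 + 2 * sin (2 * x) ^ 2)
  <= cos (INR (4 * n) * s) * cos (INR (4 * n) * x).
Proof.
  pose proof (sin_INR_mult_sq_le (2 * n) s) as sin_s.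
  pose proof (sin_INR_mult_sq_le n (2 * x)) as sin_x.
  rewrite mult_INR in sin_s |- *. replace (INR 4) with 4 by (simpl; ring).
  replace (INR 2) with 2 in sin_s by (simpl; ring).
  replace (4 * INR n * s) with (2 * (2 * INR n * s)) by ring.
  replace (4 * INR n * x) with (2 * (INR n * (2 * x))) by ring.
  rewrite !cos_2a_sin.
  pose proof (pow2_ge_0 (sin (2 * INR n * s))). pose proof (pow2_ge_0 (sin (INR n * (2 * x)))).
  nra.
Qed.

Section ResonantForcing.

Variables (T G : R) (f : R -> R -> R) (E F : R -> R).
Hypothesis T_nonneg : 0 <= T.
Hypothesis f_cont : sup_continuous f.
Hypothesis f_slice_cont : forall s, continuity (f s).
Hypothesis E_cont : continuity E.
Hypothesis F_cont : continuity F.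
Hypothesis f_range : forall s x, 0 <= f s x <= G * (E s * F x).

(* The work lost to the points where the mode [4 n] is out of phase with the source is at most
   [G n^2] times this. *)
Definition phase_loss : R :=
  8 * RInt F 0 (2 * PI) * RInt (fun s => sin s ^ 2 * E s) 0 T
  + 2 * RInt (fun x => sin (2 * x) ^ 2 * F x) 0 (2 * PI) * RInt E 0 T.

Definition space_mass (s : R) : R := RInt (f s) 0 (2 * PI).

Lemma continuity_space_mass : continuity space_mass.
Proof.
  intros s. apply (continuity_pt_ext (fun s => 2 * PI * cos_coef (f s) 0)).
  - intros t. rewrite cos_coef_0. unfold space_mass. field. apply PI_neq0.
  - pose proof (continuity_cos_coef f 0 f_cont f_slice_cont) as coef_cont.
    exact (continuity_scal _ (2 * PI) coef_cont s).
Qed.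

Lemma resonant_slice_ge (n : nat) (s : R) : (1 <= n)%nat ->
  / PI * (space_mass s - G * INR n ^ 2 * (8 * RInt F 0 (2 * PI) * (sin s ^ 2 * E s)
    + 2 * RInt (fun x => sin (2 * x) ^ 2 * F x) 0 (2 * PI) * E s))
  <= cos (INR (4 * n) * s) * cos_coef (f s) (4 * n).
Proof.
  intros n_ge_1. pose proof PI_RGT_0 as PI_pos. rewrite cos_coef_pos by lia.
  rewrite (Rmult_comm (cos (INR (4 * n) * s))), (Rmult_assoc (/ PI)).
  rewrite (Rmult_comm _ (cos (INR (4 * n) * s))).
  apply Rmult_le_compat_l; [apply Rlt_le, Rinv_0_lt_compat, PI_pos|].
  pose proof (f_slice_cont s) as slice_cont.
  set (A := G * INR n ^ 2 * 8 * sin s ^ 2 * E s). set (B := G * INR n ^ 2 * 2 * E s).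
  apply Rle_trans with
    (RInt (fun x => f s x - (A * F x + B * (sin (2 * x) ^ 2 * F x))) 0 (2 * PI)).
  - rewrite RInt_Rminus, RInt_Rplus, !RInt_Rmult by reg.
    unfold space_mass, A, B. apply Req_le. ring.
  - rewrite <- RInt_Rmult by reg. apply RInt_mono; [lra | reg | reg|]. intros x _.
    pose proof (cos_cos_ge n s x) as phase. destruct (f_range s x) as [f_nonneg f_le].
    assert (loss_nonneg : 0 <= INR n ^ 2 * (8 * sin s ^ 2 + 2 * sin (2 * x) ^ 2)).
    { apply Rmult_le_pos; [apply pow2_ge_0|].
      pose proof (pow2_ge_0 (sin s)). pose proof (pow2_ge_0 (sin (2 * x))). lra. }
    pose proof (Rmult_le_compat_l (f s x) _ _ f_nonneg phase).
    pose proof (Rmult_le_compat_r _ _ _ loss_nonneg f_le). unfold A, B. lra.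
Qed.

Lemma cos_moment_cos_coef_ge (n : nat) : (1 <= n)%nat ->
  / PI * (RInt space_mass 0 T - G * INR n ^ 2 * phase_loss)
  <= cos_moment (INR (4 * n)) (fun s => cos_coef (f s) (4 * n)) T.
Proof.
  intros n_ge_1. pose proof continuity_space_mass as mass_cont.
  set (J := RInt F 0 (2 * PI)). set (J2 := RInt (fun x => sin (2 * x) ^ 2 * F x) 0 (2 * PI)).
  set (A := G * INR n ^ 2 * (8 * J)). set (B := G * INR n ^ 2 * (2 * J2)).
  apply Rle_trans with
    (RInt (fun s => / PI * (space_mass s - (A * (sin s ^ 2 * E s) + B * E s))) 0 T).
  - rewrite RInt_Rmult, RInt_Rminus, RInt_Rplus, !RInt_Rmult by reg.
    unfold A, B, J, J2, phase_loss. apply Req_le. ring.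
  - apply RInt_mono; [exact T_nonneg | reg | |].
    + apply (continuity_mult (fun s => cos (INR (4 * n) * s))); [reg|].
      now apply continuity_cos_coef.
    + intros s _. eapply Rle_trans; [|now apply resonant_slice_ge].
      apply Req_le. unfold A, B, J, J2. ring.
Qed.

End ResonantForcing.

Section PhaseLoss.

Variable mu : R.
Hypothesis mu_pos : 0 < mu.

Lemma RInt_peak_half_range (K : nat) :
  0 <= RInt (peak mu) 0 (INR K * (2 * PI)) <= 2 * INR K * peak_mass (mu / 2).
Proof.
  pose proof PI_RGT_0. pose proof (pos_INR K).
  assert (T_nonneg : 0 <= INR K * (2 * PI)) by (apply Rmult_le_pos; lra). split.
  - apply RInt_nonneg; [exact T_nonneg | apply continuity_peak | intros; apply Rlt_le, peak_pos].
  - eapply Rle_trans; [|apply RInt_peak_periods_le; lra].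
    apply RInt_mono; try apply continuity_peak; [exact T_nonneg|].
    intros. apply peak_antimono. lra.
Qed.

Lemma RInt_peak_double_half_range :
  0 <= RInt (fun x => peak mu (2 * x)) 0 (2 * PI) <= 2 * peak_mass (mu / 2).
Proof.
  pose proof PI_RGT_0. split.
  - apply RInt_nonneg; [lra | apply continuity_peak_double | intros; apply Rlt_le, peak_pos].
  - eapply Rle_trans; [|apply RInt_peak_double_le; lra].
    apply RInt_mono; try apply continuity_peak_double; [lra|]. intros. apply peak_antimono. lra.
Qed.

Lemma RInt_sin_sq_peak_range (K : nat) :
  0 <= RInt (fun s => sin s ^ 2 * peak mu s) 0 (INR K * (2 * PI))
    <= 4 / mu * (2 * INR K * peak_mass (mu / 2)).
Proof.
  pose proof PI_RGT_0. pose proof (pos_INR K).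
  assert (T_nonneg : 0 <= INR K * (2 * PI)) by (apply Rmult_le_pos; lra).
  pose proof (continuity_peak mu). pose proof (continuity_peak (mu / 2)). split.
  - apply RInt_nonneg; [exact T_nonneg | reg|].
    intros s. apply Rmult_le_pos; [apply pow2_ge_0 | apply Rlt_le, peak_pos].
  - apply Rle_trans with (RInt (fun s => 4 / mu * peak (mu / 2) s) 0 (INR K * (2 * PI))).
    + apply RInt_mono; [exact T_nonneg | reg | reg|]. intros s _. now apply sin_sq_peak_le.
    + rewrite RInt_Rmult by assumption.
      apply Rmult_le_compat_l; [apply Rlt_le, Rdiv_lt_0_compat; lra|].
      apply RInt_peak_periods_le. lra.
Qed.

Lemma RInt_sin_sq_peak_double_range :
  0 <= RInt (fun x => sin (2 * x) ^ 2 * peak mu (2 * x)) 0 (2 * PI)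
    <= 4 / mu * (2 * peak_mass (mu / 2)).
Proof.
  pose proof PI_RGT_0.
  pose proof (continuity_peak mu). pose proof (continuity_peak (mu / 2)). split.
  - apply RInt_nonneg; [lra | reg|].
    intros x. apply Rmult_le_pos; [apply pow2_ge_0 | apply Rlt_le, peak_pos].
  - apply Rle_trans with (RInt (fun x => 4 / mu * peak (mu / 2) (2 * x)) 0 (2 * PI)).
    + apply RInt_mono; [lra | reg | reg|]. intros x _. now apply sin_sq_peak_le.
    + rewrite RInt_Rmult by reg.
      apply Rmult_le_compat_l; [apply Rlt_le, Rdiv_lt_0_compat; lra|].
      apply RInt_peak_double_le. lra.
Qed.

Lemma phase_loss_le (K : nat) :
  phase_loss (INR K * (2 * PI)) (peak mu) (fun x => peak mu (2 * x))
  <= 5760 * PI ^ 2 * INR K / mu ^ 2.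
Proof.
  pose proof (RInt_peak_half_range K). pose proof RInt_peak_double_half_range.
  pose proof (RInt_sin_sq_peak_range K). pose proof RInt_sin_sq_peak_double_range.
  set (g := peak_mass (mu / 2)) in *. unfold phase_loss.
  apply Rle_trans with (8 * (2 * g) * (4 / mu * (2 * INR K * g))
    + 2 * (4 / mu * (2 * g)) * (2 * INR K * g)).
  - apply Rplus_le_compat; apply Rmult_le_compat; lra.
  - apply Req_le. transitivity (160 * INR K / mu * g ^ 2); [field; lra|].
    unfold g. rewrite peak_mass_sq by lra. field. lra.
Qed.

End PhaseLoss.

(** * Sobolev norms of even functions *)

Lemma fc_cos_cos_coef (f : R -> R) (j : nat) :
  fc_cos f j = if Nat.eq_dec j 0 then cos_coef f j else cos_coef f j / 2.
Proof.
  unfold fc_cos, cos_coef. destruct (Nat.eq_dec j 0); [reflexivity|]. field. apply PI_neq0.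
Qed.

Lemma fc_sq_scal (A : R) (f : R -> R) (j : nat) : continuity f ->
  fc_sq (fun x => A * f x) j = A ^ 2 * fc_sq f j.
Proof.
  intros f_cont. unfold fc_sq, fc_cos, fc_sin.
  rewrite (RInt_eq _ (fun x => A * (f x * cos (INR j * x)))),
    (RInt_eq (fun x => A * f x * sin (INR j * x)) (fun x => A * (f x * sin (INR j * x))))
    by (intros; ring).
  rewrite !RInt_Rmult by reg. ring.
Qed.

Lemma Hs_norm_scal (r A : R) (f : R -> R) : 0 <= A -> continuity f ->
  Hs_norm r (fun x => A * f x) = A * Hs_norm r f.
Proof.
  intros A_nonneg f_cont. unfold Hs_norm.
  rewrite fc_sq_scal, (Series_ext _ (fun k => A ^ 2 * Hs_terms r f k)), Series_scal_l
    by (auto; intros k; unfold Hs_terms; rewrite fc_sq_scal by exact f_cont; ring).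
  rewrite <- (sqrt_pow2 A) at 3 by exact A_nonneg.
  rewrite <- sqrt_mult_alt by apply pow2_ge_0. f_equal. ring.
Qed.

Lemma Hs_fin_scal (r A : R) (f : R -> R) : continuity f -> Hs_fin r f ->
  Hs_fin r (fun x => A * f x).
Proof.
  intros f_cont f_fin. apply ex_series_ext with (fun k => scal (A ^ 2) (Hs_terms r f k)).
  - intros k. unfold Hs_terms. rewrite fc_sq_scal by exact f_cont.
    unfold scal; simpl; unfold mult; simpl. ring.
  - now apply (@ex_series_scal R_AbsRing).
Qed.

Lemma Vconv_scal (p : nat) (A : R) (f : R -> R) (x : R) : continuity f ->
  Vconv p (fun y => A * f y) x = A * Vconv p f x.
Proof.
  intros f_cont. unfold Vconv.
  rewrite (RInt_eq (fun y => A * f y * cos (x - y)) (fun y => A * (f y * cos (x - y)))),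
    (RInt_eq (fun y => A * f y * cos (INR p * (x - y)))
      (fun y => A * (f y * cos (INR p * (x - y))))) by (intros; ring).
  rewrite !RInt_Rmult by reg. field. apply PI_neq0.
Qed.

Section EvenPeriodic.

Variable f : R -> R.
Hypothesis f_ep : even_periodic f.

Lemma fc_sin_even_periodic (j : nat) : fc_sin f j = 0.
Proof. unfold fc_sin. rewrite RInt_sin_even_periodic by exact f_ep. apply Rmult_0_r. Qed.

Lemma fc_sq_0_even_periodic : fc_sq f 0 = cos_coef f 0 ^ 2.
Proof. unfold fc_sq. rewrite fc_cos_cos_coef, fc_sin_even_periodic. simpl. ring. Qed.

Lemma fc_sq_S_even_periodic (k : nat) : fc_sq f (S k) = cos_coef f (S k) ^ 2 / 4.
Proof. unfold fc_sq. rewrite fc_cos_cos_coef, fc_sin_even_periodic. simpl. field. Qed.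

Lemma Hs_fin_decay (s M r : R) : 0 < r < 1 -> (forall k, Rabs (cos_coef f k) <= M * r ^ k) ->
  Hs_fin s f.
Proof.
  intros r_in coef_le.
  apply (ex_series_Rpower_geom (2 * s) ((M * r) ^ 2 / 4) (r ^ 2)); [simpl; nra|].
  intros k. rewrite fc_sq_S_even_periodic. specialize (coef_le (S k)).
  rewrite Rabs_pos_eq by (pose proof (pow2_ge_0 (cos_coef f (S k))); lra).
  replace ((M * r) ^ 2 / 4 * (r ^ 2) ^ k) with ((M * r ^ S k) ^ 2 / 4)
    by (rewrite <- pow_mult, Nat.mul_comm, pow_mult; simpl; field).
  rewrite <- (pow2_abs (cos_coef f (S k))).
  apply Rmult_le_compat_r; [lra|]. apply pow_incr. split; [apply Rabs_pos | exact coef_le].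
Qed.

Lemma Hs_norm_eq_0 (r : R) : (forall j, cos_coef f j = 0) -> Hs_norm r f = 0.
Proof.
  intros coef_0. unfold Hs_norm. rewrite fc_sq_0_even_periodic, coef_0, Series_eq_0.
  - replace (0 ^ 2 + 2 * 0) with 0 by ring. apply sqrt_0.
  - intros k. unfold Hs_terms. rewrite fc_sq_S_even_periodic, coef_0. field.
Qed.

Lemma Hs_norm_two_modes (r c d : R) :
  (forall j, cos_coef f j = c * kronecker 0 j + d * kronecker 2 j) ->
  Hs_norm r f = sqrt (c ^ 2 + Rpower 2 (2 * r) * d ^ 2 / 2).
Proof.
  intros coef_eq. set (term := fun k => Rpower (INR (S k)) (2 * r) * (d ^ 2 / 4)).
  assert (terms_eq : forall k, kronecker 1 k * term k = Hs_terms r f k).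
  { intros k. unfold Hs_terms, term. rewrite fc_sq_S_even_periodic, coef_eq.
    rewrite (kronecker_neq 0 (S k)) by discriminate.
    destruct (Nat.eq_dec k 1) as [->|k_neq_1].
    - rewrite !kronecker_eq. field.
    - rewrite !kronecker_neq by lia. field. }
  unfold Hs_norm.
  rewrite fc_sq_0_even_periodic, coef_eq, kronecker_eq, kronecker_neq by discriminate.
  rewrite (is_series_unique _ _ (is_series_ext _ _ _ terms_eq (is_series_kronecker 1 term))).
  unfold term. replace (INR 2) with 2 by (simpl; ring). f_equal. field.
Qed.

Lemma Vconv_even_periodic (p : nat) (x : R) : (1 <= p)%nat ->
  Vconv p f x = cos_coef f 0 + cos_coef f 1 * cos (INR 1 * x)
    + INR p ^ 2 * (cos_coef f p * cos (INR p * x)).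
Proof.
  intros p_ge_1. unfold Vconv. rewrite cos_coef_0, !cos_coef_pos by lia.
  rewrite (RInt_eq (fun y => f y * cos (x - y)) (fun y => f y * cos (INR 1 * (x - y))))
    by (intros; simpl; now rewrite Rmult_1_l).
  rewrite !RInt_cos_shift_even_periodic by exact f_ep. field. apply PI_neq0.
Qed.

End EvenPeriodic.

Lemma sum_multiples_of_4_ge (a : nat -> R) (n i : nat) (v : R) : (forall k, 0 <= a k) ->
  (forall k, (n < k <= n + i)%nat -> v <= a (4 * k - 1)%nat) ->
  INR i * v <= sum_f_R0 a (4 * (n + i)).
Proof.
  intros a_nonneg a_ge. induction i as [|i IH].
  - simpl INR. rewrite Rmult_0_l. now apply cond_pos_sum.
  - replace (4 * (n + S i))%nat with (S (S (S (S (4 * (n + i)))))) by lia.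
    rewrite !tech5, S_INR. specialize (IH (fun k k_in => a_ge k ltac:(lia))).
    specialize (a_ge (n + S i)%nat ltac:(lia)).
    replace (4 * (n + S i) - 1)%nat with (S (S (S (4 * (n + i))))) in a_ge by lia.
    pose proof (a_nonneg (S (4 * (n + i)))). pose proof (a_nonneg (S (S (4 * (n + i))))).
    pose proof (a_nonneg (S (S (S (S (4 * (n + i))))))). lra.
Qed.

Lemma Hs_norm_ge_multiples_of_4 (r v : R) (f : R -> R) (n : nat) : / 2 <= r -> 0 <= v ->
  (1 <= n)%nat -> Hs_fin r f ->
  (forall k, (n < k <= 2 * n)%nat -> v ^ 2 / 4 <= fc_sq f (4 * k)) ->
  Rpower (INR n) (r + / 2) * v <= Hs_norm r f.
Proof.
  intros r_ge v_nonneg n_ge_1 f_fin f_ge.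
  assert (n_pos : 0 < INR n) by (apply lt_0_INR; lia).
  assert (fc_nonneg : forall j, 0 <= fc_sq f j)
    by (intros j; apply Rplus_le_le_0_compat; apply pow2_ge_0).
  assert (terms_nonneg : forall k, 0 <= Hs_terms r f k)
    by (intros k; apply Rmult_le_pos; [apply Rlt_le, exp_pos | apply fc_nonneg]).
  assert (sum_ge : INR n * (Rpower (INR (4 * n)) (2 * r) * (v ^ 2 / 4)) <= Series (Hs_terms r f)).
  { eapply Rle_trans; [|exact (sum_f_R0_le_Series _ (4 * (n + n)) f_fin terms_nonneg)].
    apply sum_multiples_of_4_ge; [exact terms_nonneg|]. intros k k_in. unfold Hs_terms.
    replace (S (4 * k - 1)) with (4 * k)%nat by lia.
    apply Rmult_le_compat; [apply Rlt_le, exp_pos | pose proof (pow2_ge_0 v); lra | |].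
    - apply Rle_Rpower_l; [lra|]. split; [apply lt_0_INR; lia | apply le_INR; lia].
    - apply f_ge. lia. }
  unfold Hs_norm. rewrite <- (sqrt_pow2 (Rpower (INR n) (r + / 2) * v))
    by (apply Rmult_le_pos; [apply Rlt_le, exp_pos | exact v_nonneg]).
  apply sqrt_le_1_alt. rewrite Rpow_mult_distr, <- (Rpower_pow 2), Rpower_mult by apply exp_pos.
  replace ((r + / 2) * INR 2) with (1 + 2 * r) by (simpl; field).
  rewrite Rpower_plus, Rpower_1 by exact n_pos.
  rewrite mult_INR, <- Rpower_mult_distr in sum_ge by (simpl; lra).
  assert (four_pow : 4 <= Rpower (INR 4) (2 * r)).
  { replace (INR 4) with 4 by (simpl; ring).
    rewrite <- (Rpower_1 4) at 1 by lra. apply Rle_Rpower; lra. }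
  assert (lower_nonneg : 0 <= INR n * Rpower (INR n) (2 * r) * v ^ 2).
  { apply Rmult_le_pos; [|apply pow2_ge_0]. apply Rmult_le_pos; [lra | apply Rlt_le, exp_pos]. }
  specialize (fc_nonneg 0%nat). nra.
Qed.

(** * Frequencies, cutoff and the linear solution *)

Definition potential (p j : nat) : R :=
  kronecker 0 j + kronecker 1 j + INR p ^ 2 * kronecker p j.

Definition freq (p j : nat) : R := sqrt (INR j ^ 2 + potential p j).

Lemma potential_range (p j : nat) : 0 <= potential p j <= 2 + INR p ^ 2.
Proof.
  unfold potential, kronecker. pose proof (pow2_ge_0 (INR p)).
  destruct (Nat.eq_dec 0 j), (Nat.eq_dec 1 j), (Nat.eq_dec p j); lra.
Qed.

Lemma freq_sq (p j : nat) : freq p j ^ 2 = INR j ^ 2 + potential p j.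
Proof.
  apply pow2_sqrt. destruct (potential_range p j). pose proof (pow2_ge_0 (INR j)). lra.
Qed.

Lemma INR_le_freq (p j : nat) : INR j <= freq p j.
Proof.
  rewrite <- (sqrt_pow2 (INR j)) at 1 by apply pos_INR.
  apply sqrt_le_1_alt. destruct (potential_range p j). lra.
Qed.

Lemma freq_ge_1 (p j : nat) : 1 <= freq p j.
Proof.
  destruct j as [|j].
  - rewrite <- sqrt_1. apply sqrt_le_1_alt. unfold potential. rewrite kronecker_eq.
    pose proof (pow2_ge_0 (INR p)). unfold kronecker.
    destruct (Nat.eq_dec 1 0), (Nat.eq_dec p 0); simpl in *; lra.
  - eapply Rle_trans; [|apply INR_le_freq]. apply (le_INR 1). lia.
Qed.

Lemma freq_eq_INR (p j : nat) : (2 <= j)%nat -> j <> p -> freq p j = INR j.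
Proof.
  intros j_ge_2 j_neq_p. unfold freq, potential. rewrite !kronecker_neq by lia.
  rewrite Rmult_0_r, !Rplus_0_r. apply sqrt_pow2, pos_INR.
Qed.

Lemma is_series_potential (p : nat) (f : nat -> R) :
  is_series (fun k => potential p k * f k) (f 0%nat + f 1%nat + INR p ^ 2 * f p).
Proof.
  apply is_series_ext with (fun k =>
    plus (plus (kronecker 0 k * f k) (kronecker 1 k * f k)) (kronecker p k * (INR p ^ 2 * f k))).
  - intros k. unfold potential, plus; simpl. ring.
  - apply (is_series_plus (fun k => kronecker 0 k * f k + kronecker 1 k * f k)).
    + apply (is_series_plus (fun k => kronecker 0 k * f k)); apply is_series_kronecker.
    + apply (is_series_kronecker p (fun k => INR p ^ 2 * f k)).
Qed.

(* Cutting the force off outside [[-1, T + 1]] makes the fixed point problem global in time. *)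
Definition cutoff (T t : R) : R := Rmax 0 (Rmin 1 (Rmin (t + 2) (T + 2 - t))).

Lemma cutoff_range (T t : R) : 0 <= cutoff T t <= 1.
Proof. unfold cutoff. split; [apply Rmax_l|]. apply Rmax_lub; [lra | apply Rmin_l]. Qed.

Lemma cutoff_eq_1 (T t : R) : -1 <= t <= T + 1 -> cutoff T t = 1.
Proof.
  intros t_in. unfold cutoff. rewrite (Rmin_left 1) by (apply Rmin_glb; lra). apply Rmax_right. lra.
Qed.

Lemma cutoff_eq_0 (T t : R) : t < -2 \/ T + 2 < t -> cutoff T t = 0.
Proof.
  intros t_out. unfold cutoff. apply Rmax_left. eapply Rle_trans; [apply Rmin_r|].
  destruct t_out; [eapply Rle_trans; [apply Rmin_l|] | eapply Rle_trans; [apply Rmin_r|]]; lra.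
Qed.

Lemma continuity_cutoff (T : R) : continuity (cutoff T).
Proof.
  apply continuity_Rabs_le. intros t e e_pos. exists e. split; [exact e_pos|]. intros s s_near.
  apply Rabs_lt_between in s_near. apply Rabs_le. unfold cutoff, Rmax, Rmin.
  repeat destruct (Rle_dec _ _); lra.
Qed.

Definition linear_wave (c d t x : R) : R := c * cos t + d * cos (2 * t) * cos (2 * x).

Definition linear_mode (c d : R) (j : nat) (t : R) : R :=
  c * cos t * kronecker 0 j + d * cos (2 * t) * kronecker 2 j.

Definition linear_mode_dt (c d : R) (j : nat) (t : R) : R :=
  - c * sin t * kronecker 0 j + - 2 * d * sin (2 * t) * kronecker 2 j.

Lemma cos_coef_linear_wave (c d t : R) (j : nat) :
  cos_coef (linear_wave c d t) j = linear_mode c d j t.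
Proof.
  rewrite (cos_coef_ext _
    (fun x => c * cos t * cos (INR 0 * x) + d * cos (2 * t) * cos (INR 2 * x)))
    by (intros x; unfold linear_wave; rewrite cos_INR_0; simpl INR; replace (1 + 1) with 2; ring).
  rewrite cos_coef_plus, !cos_coef_scal, !cos_coef_cos by reg. reflexivity.
Qed.

Lemma is_derive_linear_mode (c d : R) (j : nat) (t : R) :
  is_derive (linear_mode c d j) t (linear_mode_dt c d j t).
Proof. unfold linear_mode, linear_mode_dt. auto_derive; [easy | ring]. Qed.

Lemma is_derive_linear_mode_dt (c d : R) (p j : nat) (t : R) : (3 <= p)%nat ->
  is_derive (linear_mode_dt c d j) t (- (freq p j ^ 2 * linear_mode c d j t)).
Proof.
  intros p_ge_3. rewrite freq_sq.
  assert (freq_0 : (INR j ^ 2 + potential p j) * kronecker 0 j = kronecker 0 j).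
  { destruct (Nat.eq_dec 0 j) as [<-|j_neq_0]; [|rewrite kronecker_neq by exact j_neq_0; ring].
    unfold potential. rewrite kronecker_eq, !kronecker_neq by lia. simpl. ring. }
  assert (freq_2 : (INR j ^ 2 + potential p j) * kronecker 2 j = 4 * kronecker 2 j).
  { destruct (Nat.eq_dec 2 j) as [<-|j_neq_2]; [|rewrite kronecker_neq by exact j_neq_2; ring].
    unfold potential. rewrite kronecker_eq, !kronecker_neq by lia. simpl. ring. }
  unfold linear_mode, linear_mode_dt. auto_derive; [easy|].
  transitivity (- (c * cos t * kronecker 0 j + d * cos (2 * t) * (4 * kronecker 2 j))); [ring|].
  rewrite <- freq_0 at 1. rewrite <- freq_2 at 1. ring.
Qed.

Lemma sup_continuous_linear_wave (c d : R) : sup_continuous (linear_wave c d).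
Proof.
  apply (sup_continuous_plus (fun t x => c * cos t) (fun t x => d * cos (2 * t) * cos (2 * x))).
  - apply (sup_continuous_lipschitz 1 (fun t x => c * cos t * 1)).
    + intros t t' x. rewrite !Rmult_1_r, Rmult_1_l. apply Rle_refl.
    + apply (sup_continuous_separated (fun t => c * cos t)); [reg|].
      intros _. rewrite Rabs_R1. apply Rle_refl.
  - apply (sup_continuous_separated (fun t => d * cos (2 * t))); [reg|].
    intros; apply Rabs_cos_le_1.
Qed.

Lemma linear_mode_dt_decay (q c d : R) (j : nat) (t : R) : 1 <= q ->
  Rabs (linear_mode_dt c d j t) <= (Rabs c + 2 * Rabs d) * q ^ 2 * (/ q) ^ j.
Proof.
  intros q_ge_1. pose proof (Rabs_pos c). pose proof (Rabs_pos d).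
  pose proof (pow_R1_Rle q 2 q_ge_1) as q_sq_ge_1.
  assert (c_le : Rabs (- c * sin t) <= Rabs c)
    by (eapply Rle_trans; [apply Rabs_mult_sin_le | rewrite Rabs_Ropp; apply Rle_refl]).
  assert (d_le : Rabs (-2 * d * sin (2 * t)) <= 2 * Rabs d).
  { eapply Rle_trans; [apply Rabs_mult_sin_le|].
    rewrite Rabs_mult, (Rabs_left (-2)) by lra. lra. }
  unfold linear_mode_dt. destruct (Nat.eq_dec 0 j) as [<-|j_neq_0].
  - rewrite kronecker_eq, kronecker_neq by discriminate.
    rewrite Rmult_0_r, Rplus_0_r, !Rmult_1_r. nra.
  - rewrite (kronecker_neq 0) by exact j_neq_0. rewrite Rmult_0_r, Rplus_0_l.
    destruct (Nat.eq_dec 2 j) as [<-|j_neq_2].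
    + rewrite kronecker_eq, Rmult_1_r.
      replace ((Rabs c + 2 * Rabs d) * q ^ 2 * (/ q) ^ 2)
        with (Rabs c + 2 * Rabs d) by (field; lra).
      lra.
    + rewrite kronecker_neq, Rmult_0_r, Rabs_R0 by exact j_neq_2.
      apply Rmult_le_pos; [nra | apply pow_le, Rlt_le, Rinv_0_lt_compat; lra].
Qed.

Lemma sin_sq_half_le (a : R) : sin a ^ 2 / 2 <= 1 - Rabs (cos a).
Proof.
  pose proof (sin2_cos2 a) as pythagoras. unfold Rsqr in pythagoras.
  pose proof (pow2_abs (cos a)). pose proof (Rabs_pos (cos a)). pose proof (Rabs_cos_le_1 a).
  simpl in *. nra.
Qed.

Section LinearWave.

Variables c d : R.
Hypothesis c_nonneg : 0 <= c.
Hypothesis d_nonneg : 0 <= d.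
Hypothesis c_plus_d : c + d = 1.

Lemma wiener_ball_linear_wave (q t : R) : 1 <= q -> wiener_ball q (q ^ 2) (linear_wave c d t).
Proof.
  intros q_ge_1. pose proof (pow_R1_Rle q 2 q_ge_1) as q_sq_ge_1.
  apply (wiener_ball_le q (Rabs (c * cos t) + Rabs (d * cos (2 * t)) * q ^ 2)).
  - pose proof (Rabs_mult_cos_le c t) as c_le. pose proof (Rabs_mult_cos_le d (2 * t)) as d_le.
    rewrite (Rabs_pos_eq c) in c_le by lra. rewrite (Rabs_pos_eq d) in d_le by lra. nra.
  - apply (wiener_ball_plus q _ _ (fun _ => c * cos t) (fun x => d * cos (2 * t) * cos (2 * x)));
      [apply wiener_ball_const, Rle_refl|].
    replace 2 with (INR 2) at 3 by (simpl; ring). apply wiener_ball_cos.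
Qed.

Lemma linear_wave_ge (h t x : R) : h <= / 2 -> t ^ 2 <= h -> x ^ 2 <= h ->
  1 - 4 * h <= linear_wave c d t x.
Proof.
  intros h_le t_sq x_sq. pose proof (cos_ge_quadratic t) as cos_t.
  pose proof (cos_ge_quadratic (2 * t)) as cos_2t. pose proof (cos_ge_quadratic (2 * x)) as cos_2x.
  pose proof (pow2_ge_0 t). rewrite Rpow_mult_distr in cos_2t, cos_2x.
  assert (product : 1 - 4 * h <= cos (2 * t) * cos (2 * x)).
  { apply Rle_trans with ((1 - 2 * h) * (1 - 2 * h)); [nra|]. apply Rmult_le_compat; lra. }
  assert (c * (1 - 4 * h) <= c * cos t) by (apply Rmult_le_compat_l; lra).
  assert (d * (1 - 4 * h) <= d * (cos (2 * t) * cos (2 * x))) by (apply Rmult_le_compat_l; lra).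
  unfold linear_wave. replace (1 - 4 * h) with ((c + d) * (1 - 4 * h)) by (rewrite c_plus_d; ring).
  lra.
Qed.

Lemma linear_wave_envelope (m rho t x : R) (k : nat) : m <= c -> m <= d -> 0 <= rho ->
  INR k * rho <= 1 ->
  (Rabs (linear_wave c d t x) + rho) ^ k <= 3 * (peak (INR k * m) t * peak (INR k * m) (2 * x)).
Proof.
  intros m_le_c m_le_d rho_nonneg k_rho_le_1.
  set (loss := m * (sin t ^ 2 / 2) + m * (sin (2 * x) ^ 2 / 2)).
  assert (wave_le : Rabs (linear_wave c d t x) <= 1 - loss).
  { apply Rle_trans with (c * Rabs (cos t) + d * Rabs (cos (2 * x))).
    - unfold linear_wave. eapply Rle_trans; [apply Rabs_triang|].
      rewrite (Rmult_assoc d), (Rmult_comm (cos (2 * t))), !(Rabs_mult c), !(Rabs_mult d).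
      rewrite (Rabs_pos_eq c), (Rabs_pos_eq d) by lra.
      apply Rplus_le_compat_l, Rmult_le_compat_l; [lra | apply Rabs_mult_cos_le].
    - pose proof (sin_sq_half_le t). pose proof (sin_sq_half_le (2 * x)).
      pose proof (pow2_ge_0 (sin t)). pose proof (pow2_ge_0 (sin (2 * x))). unfold loss. nra. }
  apply Rle_trans with (exp (rho - loss) ^ k).
  - apply pow_incr. pose proof (Rabs_pos (linear_wave c d t x)).
    pose proof (exp_ineq1_le (rho - loss)). lra.
  - rewrite exp_pow. unfold peak. rewrite <- exp_plus.
    apply Rle_trans with (exp 1 * exp (- (INR k * loss))).
    + rewrite <- exp_plus. apply exp_le_mono. lra.
    + apply Rmult_le_compat; try (apply Rlt_le, exp_pos); [apply exp_le_3|].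
      apply exp_le_mono. unfold loss. lra.
Qed.

End LinearWave.

(** * From the modes to the partial differential equation *)

Lemma pow_one_plus_le_exp (x : R) (n : nat) : 0 <= 1 + x -> (1 + x) ^ n <= exp (INR n * x).
Proof.
  intros x_ge. rewrite <- exp_pow. apply pow_incr. split; [exact x_ge | apply exp_ineq1_le].
Qed.

Definition weight (p : nat) : R := 1 + / INR p.

Definition forcing (p : nat) (T : R) (y : R -> R -> R) : nat -> R -> R :=
  force (cutoff T) (fun s x => y s x ^ p).

(* With [eps = A^(p-1)], the function [A y] solves the wave equation on [[-1, T + 1]] and agrees at
   time [0] with [A] times the linear wave. *)
Definition modal_solution (p : nat) (T c d eps : R) (y : R -> R -> R) : Prop :=
  path_ball (weight p) (/ INR p) (linear_wave c d) y /\
  forall t j, cos_coef (y t) j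
    = linear_mode c d j t - eps * duhamel (freq p j) (forcing p T y j) t.

Definition data_norm (s c d : R) : R := sqrt (c ^ 2 + Rpower 2 (2 * s) * d ^ 2).

Section ModalSolution.

Variables (p : nat) (T c d eps : R) (y : R -> R -> R).
Hypothesis p_ge_4 : (4 <= p)%nat.
Hypothesis T_nonneg : 0 <= T.
Hypothesis c_nonneg : 0 <= c.
Hypothesis d_nonneg : 0 <= d.
Hypothesis c_plus_d : c + d = 1.
Hypothesis y_modal : modal_solution p T c d eps y.

Let q : R := weight p.
Let r : R := / q.

Lemma Rinv_INR_range : 0 < / INR p <= / 4.
Proof.
  assert (INR 4 <= INR p) as INR_p_ge by now apply le_INR. simpl in INR_p_ge.
  split; [apply Rinv_0_lt_compat | apply Rinv_le_contravar]; lra.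
Qed.

Lemma weight_gt_1 : 1 < weight p.
Proof. unfold weight. pose proof Rinv_INR_range. lra. Qed.

Lemma decay_rate_range : 0 < r < 1.
Proof. apply Rinv_gt_1, weight_gt_1. Qed.

Lemma wiener_path_linear_wave : wiener_path q (1 + 3 * / INR p) (linear_wave c d).
Proof.
  pose proof weight_gt_1. pose proof Rinv_INR_range. split; [apply sup_continuous_linear_wave|].
  intros t. apply (wiener_ball_le q (q ^ 2)); [unfold q, weight; nra|].
  apply wiener_ball_linear_wave; auto. unfold q. lra.
Qed.

Lemma modal_wiener_path : wiener_path q (1 + 4 * / INR p) y.
Proof.
  destruct y_modal as [y_ball _].
  replace (1 + 4 * / INR p) with (1 + 3 * / INR p + / INR p) by ring.
  exact (path_ball_wiener_path q (/ INR p) _ _ wiener_path_linear_wave y y_ball).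
Qed.

Lemma modal_pow_wiener_path : wiener_path q (exp 4) (fun t x => y t x ^ p).
Proof.
  pose proof Rinv_INR_range. pose proof weight_gt_1.
  destruct (wiener_path_pow q _ y p ltac:(unfold q; lra) modal_wiener_path) as [pow_cont pow_ball].
  split; [exact pow_cont|]. intros t.
  apply (wiener_ball_le q ((1 + 4 * / INR p) ^ p)); [|apply pow_ball].
  replace 4 with (INR p * (4 * / INR p)) at 2 by (field; apply not_0_INR; lia).
  apply pow_one_plus_le_exp. lra.
Qed.

Lemma modal_slice (t : R) : wiener_ball q 2 (y t).
Proof.
  pose proof Rinv_INR_range.
  apply (wiener_ball_le q (1 + 4 * / INR p)); [lra | apply modal_wiener_path].
Qed.

Lemma continuity_forcing (j : nat) : continuity (forcing p T y j).
Proof.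
  apply (continuity_mult (cutoff T)); [apply continuity_cutoff|].
  exact (wiener_path_cos_coef_continuity q _ _ j modal_pow_wiener_path).
Qed.

Lemma forcing_decay (j : nat) (s : R) : Rabs (forcing p T y j s) <= exp 4 * r ^ j.
Proof.
  unfold forcing, force. rewrite Rmult_comm. destruct (cutoff_range T s).
  eapply Rle_trans; [apply Rabs_mult_le_l; rewrite Rabs_pos_eq; lra|].
  pose proof weight_gt_1. apply Rabs_cos_coef_decay; [unfold q; lra | apply modal_pow_wiener_path].
Qed.

Definition mode_dt (j : nat) (t : R) : R :=
  linear_mode_dt c d j t - eps * duhamel_dt (freq p j) (forcing p T y j) t.

Definition mode_dtt (j : nat) (t : R) : R :=
  - (freq p j ^ 2 * cos_coef (y t) j) - eps * forcing p T y j t.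

Definition velocity (t : R) : R -> R := cos_series (fun j => mode_dt j t).

Lemma freq_neq_0 (j : nat) : freq p j <> 0.
Proof. pose proof (freq_ge_1 p j). lra. Qed.

Lemma is_derive_mode (j : nat) (t : R) : is_derive (fun t => cos_coef (y t) j) t (mode_dt j t).
Proof.
  apply is_derive_ext with (fun t => linear_mode c d j t
    - eps * duhamel (freq p j) (forcing p T y j) t).
  { intros s. symmetry. apply y_modal. }
  apply (is_derive_minus (linear_mode c d j)); [apply is_derive_linear_mode|].
  apply (is_derive_scal (duhamel (freq p j) (forcing p T y j))).
  apply is_derive_duhamel; [apply continuity_forcing | apply freq_neq_0].
Qed.

Lemma is_derive_mode_dt (j : nat) (t : R) : is_derive (mode_dt j) t (mode_dtt j t).
Proof.
  assert (mode_dtt_eq : mode_dtt j t = - (freq p j ^ 2 * linear_mode c d j t)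
    - eps * (forcing p T y j t - freq p j ^ 2 * duhamel (freq p j) (forcing p T y j) t)).
  { unfold mode_dtt. rewrite (proj2 y_modal). ring. }
  rewrite mode_dtt_eq.
  apply (is_derive_minus (linear_mode_dt c d j)); [apply is_derive_linear_mode_dt; lia|].
  apply (is_derive_scal (duhamel_dt (freq p j) (forcing p T y j))).
  apply is_derive_duhamel_dt; [apply continuity_forcing | apply freq_neq_0].
Qed.

Lemma continuity_mode_dt (j : nat) : continuity (mode_dt j).
Proof. apply (continuity_is_derive _ (mode_dtt j)), is_derive_mode_dt. Qed.

Lemma continuity_mode_dtt (j : nat) : continuity (mode_dtt j).
Proof.
  pose proof (continuity_forcing j) as forcing_cont.
  pose proof (continuity_is_derive _ _ (is_derive_mode j)) as mode_cont.
  exact (continuity_minus _ _ (continuity_opp _ (continuity_scal _ (freq p j ^ 2) mode_cont))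
    (continuity_scal _ eps forcing_cont)).
Qed.

Lemma mode_decay (j : nat) (t : R) : Rabs (cos_coef (y t) j) <= 2 * r ^ j.
Proof.
  pose proof weight_gt_1. apply Rabs_cos_coef_decay; [unfold q; lra | apply modal_slice].
Qed.

Lemma mode_dt_decay : exists M, forall j t, Rabs (mode_dt j t) <= M * r ^ j.
Proof.
  pose proof weight_gt_1. pose proof decay_rate_range.
  exists ((Rabs c + 2 * Rabs d) * q ^ 2 + Rabs eps * ((T + 2 - - 2) * exp 4)). intros j t.
  unfold mode_dt. eapply Rle_trans; [apply Rabs_triang|].
  rewrite Rabs_Ropp, (Rabs_mult eps), Rmult_plus_distr_r. apply Rplus_le_compat.
  - apply linear_mode_dt_decay. unfold q. lra.
  - rewrite Rmult_assoc. apply Rmult_le_compat_l; [apply Rabs_pos|].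
    pose proof (continuity_forcing j) as forcing_cont.
    eapply Rle_trans; [apply (Rabs_duhamel_dt_le _ _ forcing_cont (-2) (T + 2))|].
    + intros s s_out. unfold forcing, force. rewrite cutoff_eq_0 by exact s_out. ring.
    + rewrite Rmult_assoc, <- RInt_Rconst.
      apply RInt_mono; [lra | reg | reg | intros; apply forcing_decay].
Qed.

Lemma mode_dtt_decay :
  exists M, forall j t, Rabs (mode_dtt j t) <= INR (S j) ^ 2 * (M * r ^ j).
Proof.
  pose proof decay_rate_range.
  exists ((3 + INR p ^ 2) * 2 + Rabs eps * exp 4). intros j t.
  pose proof (pos_INR j). pose proof (pow2_ge_0 (INR p)). destruct (potential_range p j).
  assert (succ_sq_ge_1 : 1 <= INR (S j) ^ 2) by (apply pow_R1_Rle; rewrite S_INR; lra).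
  assert (freq_sq_le : freq p j ^ 2 <= INR (S j) ^ 2 * (3 + INR p ^ 2)).
  { assert (INR j ^ 2 <= INR (S j) ^ 2) by (apply pow_incr; rewrite S_INR; lra).
    rewrite freq_sq. nra. }
  unfold mode_dtt. eapply Rle_trans; [apply Rabs_triang|].
  rewrite !Rabs_Ropp, !Rabs_mult, (Rabs_pos_eq (freq p j ^ 2)) by apply pow2_ge_0.
  rewrite Rmult_plus_distr_r, Rmult_plus_distr_l. apply Rplus_le_compat.
  - rewrite (Rmult_assoc (3 + INR p ^ 2)), <- Rmult_assoc.
    apply Rmult_le_compat; [apply pow2_ge_0 | apply Rabs_pos | exact freq_sq_le | apply mode_decay].
  - rewrite <- (Rmult_1_l (Rabs eps * _)), (Rmult_assoc (Rabs eps)).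
    apply Rmult_le_compat; [lra | apply Rmult_le_pos; apply Rabs_pos | exact succ_sq_ge_1|].
    apply Rmult_le_compat_l; [apply Rabs_pos | apply forcing_decay].
Qed.

Lemma modal_eq_cos_series (t x : R) : y t x = cos_series (cos_coef (y t)) x.
Proof. apply wiener_ball_eq_cos_series with q 2; [apply weight_gt_1 | apply modal_slice]. Qed.

Lemma geom_summable (M : R) : ex_series (fun j => M * r ^ j).
Proof.
  apply (@ex_series_scal_l R_AbsRing), ex_series_geom. pose proof decay_rate_range.
  rewrite Rabs_pos_eq; lra.
Qed.

Lemma is_derive_modal_t (t x : R) : is_derive (fun t => y t x) t (velocity t x).
Proof.
  destruct mode_dt_decay as [M mode_dt_le].
  apply is_derive_ext with (fun t => cos_series (cos_coef (y t)) x).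
  { intros s. symmetry. apply modal_eq_cos_series. }
  apply (is_derive_cos_series_param (fun j t => cos_coef (y t) j) mode_dt _ _ t x
    (geom_summable 2) (geom_summable M));
    auto using mode_decay, is_derive_mode, continuity_mode_dt.
Qed.

Lemma is_derive_velocity (t x : R) :
  is_derive (fun t => velocity t x) t (cos_series (fun j => mode_dtt j t) x).
Proof.
  destruct mode_dt_decay as [M mode_dt_le]. destruct mode_dtt_decay as [M' mode_dtt_le].
  assert (summable : ex_series (fun j => INR (S j) ^ 2 * (M' * r ^ j))).
  { pose proof decay_rate_range as r_in. apply (ex_series_pow_geom 2 (Rabs M') r); [exact r_in|].
    intros k. rewrite Rabs_mult, (Rabs_pos_eq (r ^ k)) by (apply pow_le; lra). apply Rle_refl. }
  apply (is_derive_cos_series_param mode_dt mode_dtt _ _ t x (geom_summable M) summable);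
    auto using is_derive_mode_dt, continuity_mode_dtt.
Qed.

Lemma mode_summable (n : nat) (t : R) :
  ex_series (fun j => INR (S j) ^ n * Rabs (cos_coef (y t) j)).
Proof.
  apply ex_series_pow_geom with 2 r; [apply decay_rate_range|].
  intros k. rewrite Rabs_Rabsolu. apply mode_decay.
Qed.

Lemma is_derive_modal_x (t x : R) :
  is_derive (y t) x (- sin_series (fun j => INR j * cos_coef (y t) j) x).
Proof.
  apply is_derive_ext with (cos_series (cos_coef (y t))).
  { intros z. symmetry. apply modal_eq_cos_series. }
  apply is_derive_cos_series.
  apply ex_series_ext with (2 := mode_summable 1 t). intros j. now rewrite pow_1.
Qed.

Definition laplacian_mode (t : R) (j : nat) : R := - (INR j ^ 2 * cos_coef (y t) j).

Lemma laplacian_mode_summable (t : R) : ex_series (fun j => Rabs (laplacian_mode t j)).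
Proof.
  apply ex_series_Rabs_le with (1 := mode_summable 2 t). intros j. pose proof (pos_INR j).
  unfold laplacian_mode. rewrite Rabs_Rabsolu, Rabs_Ropp, Rabs_mult, (Rabs_pos_eq (INR j ^ 2))
    by apply pow2_ge_0.
  apply Rmult_le_compat_r; [apply Rabs_pos|]. apply pow_incr. rewrite S_INR. lra.
Qed.

Lemma is_derive_modal_xx (t x : R) :
  is_derive (fun x => - sin_series (fun j => INR j * cos_coef (y t) j) x) x
    (cos_series (laplacian_mode t) x).
Proof.
  replace (cos_series (laplacian_mode t) x)
    with (- cos_series (fun j => INR j * (INR j * cos_coef (y t) j)) x).
  - apply (is_derive_opp (sin_series (fun j => INR j * cos_coef (y t) j))), is_derive_sin_series.
    apply ex_series_Rabs_le with (1 := mode_summable 2 t). intros j. pose proof (pos_INR j).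
    rewrite Rabs_mult, Rabs_Rabsolu, (Rabs_mult (INR j)), S_INR.
    rewrite (Rabs_pos_eq (INR j + 1)), (Rabs_pos_eq (INR j)) by lra.
    pose proof (Rabs_pos (cos_coef (y t) j)). nra.
  - unfold cos_series. rewrite <- Series_opp. apply Series_ext. intros j.
    unfold laplacian_mode. ring.
Qed.

Lemma modal_wave_equation (t x : R) : -1 <= t <= T + 1 ->
  cos_series (fun j => mode_dtt j t) x - cos_series (laplacian_mode t) x + Vconv p (y t) x
    + eps * y t x ^ p = 0.
Proof.
  intros t_in. set (term := fun j => cos_coef (y t) j * cos (INR j * x)).
  assert (laplacian_sum : is_series (fun j => laplacian_mode t j * cos (INR j * x))
    (cos_series (laplacian_mode t) x)).
  { apply Series_correct, ex_series_Rabs_le with (1 := laplacian_mode_summable t).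
    intros j. apply Rabs_mult_cos_le. }
  pose proof (is_series_potential p term) as potential_sum.
  pose proof (wiener_ball_is_series q _ _ x weight_gt_1 (proj2 modal_pow_wiener_path t)) as pow_sum.
  assert (total : is_series (fun j => laplacian_mode t j * cos (INR j * x) - potential p j * term j
      - eps * (cos_coef (fun x => y t x ^ p) j * cos (INR j * x)))
    (cos_series (laplacian_mode t) x - (term 0%nat + term 1%nat + INR p ^ 2 * term p)
      - eps * y t x ^ p))
    by exact (is_series_minus _ _ _ _ (is_series_minus _ _ _ _ laplacian_sum potential_sum)
      (is_series_scal eps _ _ pow_sum)).
  rewrite Vconv_even_periodic by (lia || apply (wiener_ball_even_periodic q 2), modal_slice).
  replace (cos_series (fun j => mode_dtt j t) x) with (Series (fun j =>
    laplacian_mode t j * cos (INR j * x) - potential p j * term j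
    - eps * (cos_coef (fun x => y t x ^ p) j * cos (INR j * x)))).
  - rewrite (is_series_unique _ _ total). unfold term. rewrite cos_INR_0. ring.
  - apply Series_ext. intros j. unfold mode_dtt, forcing, force, laplacian_mode, term.
    rewrite cutoff_eq_1, freq_sq by exact t_in. ring.
Qed.

Lemma velocity_weighted_l1 :
  exists q', 1 < q' /\ forall t, exists B, weighted_l1 q' B (fun j => mode_dt j t).
Proof.
  destruct (geom_weighted_l1 r decay_rate_range) as (q' & q'_gt_1 & l1).
  destruct mode_dt_decay as [M mode_dt_le]. exists q'. split; [exact q'_gt_1|].
  intros t. now apply l1 with M.
Qed.

Lemma even_periodic_velocity (t : R) : even_periodic (velocity t).
Proof.
  destruct velocity_weighted_l1 as (q' & q'_gt_1 & l1). destruct (l1 t) as [B dt_l1].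
  apply wiener_ball_even_periodic with q' B. now apply wiener_ball_cos_series.
Qed.

Lemma cos_coef_velocity (t : R) (j : nat) : cos_coef (velocity t) j = mode_dt j t.
Proof.
  destruct velocity_weighted_l1 as (q' & q'_gt_1 & l1). destruct (l1 t) as [B dt_l1].
  exact (cos_coef_cos_series q' B _ q'_gt_1 dt_l1 j).
Qed.

Lemma even_periodic_modal (t : R) : even_periodic (y t).
Proof. apply wiener_ball_even_periodic with q 2, modal_slice. Qed.

Lemma Hs_fin_modal (s t : R) : Hs_fin s (y t).
Proof.
  apply Hs_fin_decay with 2 r; [apply even_periodic_modal | apply decay_rate_range|].
  intros k. apply mode_decay.
Qed.

Lemma Hs_fin_velocity (s t : R) : Hs_fin s (velocity t).
Proof.
  destruct mode_dt_decay as [M mode_dt_le].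
  apply Hs_fin_decay with M r; [apply even_periodic_velocity | apply decay_rate_range|].
  intros k. rewrite cos_coef_velocity. apply mode_dt_le.
Qed.

Section Amplitude.

Variable A : R.
Hypothesis A_pos : 0 < A.
Hypothesis eps_eq : eps = A ^ (p - 1).

Definition amplified (t x : R) : R := A * y t x.

Lemma dt_amplified (t : R) : dt amplified t = fun x => A * velocity t x.
Proof.
  apply functional_extensionality. intros x. apply is_derive_unique.
  apply (is_derive_scal (fun t => y t x)), is_derive_modal_t.
Qed.

Lemma Es_norm_amplified (s t : R) :
  Es_norm s amplified t = A * (Hs_norm (s + / 2) (y t) + Hs_norm (s - / 2) (velocity t)).
Proof.
  unfold Es_norm. rewrite dt_amplified, Rmult_plus_distr_l. unfold amplified.
  rewrite !Hs_norm_scal by (lra || apply even_periodic_modal || apply even_periodic_velocity).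
  reflexivity.
Qed.

Lemma amplified_wave_equation (t x : R) : -1 <= t <= T + 1 ->
  A * cos_series (fun j => mode_dtt j t) x - A * cos_series (laplacian_mode t) x
    + Vconv p (amplified t) x + amplified t x ^ p = 0.
Proof.
  intros t_in. pose proof (modal_wave_equation t x t_in) as equation.
  unfold amplified. rewrite Vconv_scal, Rpow_mult_distr by apply even_periodic_modal.
  replace (A ^ p) with (A * eps)
    by (rewrite eps_eq; replace p with (S (p - 1)) at 2 by lia; reflexivity).
  rewrite <- (Rmult_0_r A), <- equation. ring.
Qed.

Lemma amplified_is_solution (s : R) : is_solution s p amplified T.
Proof.
  split; [|split].
  - intros t x. unfold amplified. f_equal. apply even_periodic_modal.
  - exists 1. split; [lra|]. intros t t_in x.
    assert (t_derive : forall t, is_derive (fun tau => amplified tau x) t (A * velocity t x))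
      by (intros; apply (is_derive_scal (fun t => y t x)), is_derive_modal_t).
    assert (x_derive : forall x, is_derive (amplified t) x
      (A * - sin_series (fun j => INR j * cos_coef (y t) j) x))
      by (intros; apply (is_derive_scal (y t)), is_derive_modal_x).
    assert (tt_derive : is_derive (fun tau => Derive (fun sig => amplified sig x) tau) t
      (A * cos_series (fun j => mode_dtt j t) x)).
    { apply is_derive_ext with (fun t => A * velocity t x).
      - intros tau. symmetry. apply is_derive_unique, t_derive.
      - apply (is_derive_scal (fun t => velocity t x)), is_derive_velocity. }
    assert (xx_derive : is_derive (fun z => Derive (fun z => amplified t z) z) x
      (A * cos_series (laplacian_mode t) x)).
    { apply is_derive_ext with (fun x => A * - sin_series (fun j => INR j * cos_coef (y t) j) x).
      - intros z. symmetry. apply is_derive_unique, x_derive.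
      - apply (is_derive_scal (fun x => - sin_series (fun j => INR j * cos_coef (y t) j) x)).
        apply is_derive_modal_xx. }
    repeat split; try (eexists; eauto).
    replace (Derive (fun tau => Derive (fun sig => amplified sig x) tau) t)
      with (A * cos_series (fun j => mode_dtt j t) x)
      by (symmetry; apply is_derive_unique; exact tt_derive).
    replace (Derive (fun y => Derive (fun z => amplified t z) y) x)
      with (A * cos_series (laplacian_mode t) x)
      by (symmetry; apply is_derive_unique; exact xx_derive).
    apply amplified_wave_equation. lra.
  - intros t _. rewrite dt_amplified.
    split; apply Hs_fin_scal; auto using Hs_fin_modal, Hs_fin_velocity;
      (apply even_periodic_modal || apply even_periodic_velocity).
Qed.

Lemma Es_norm_amplified_0 (s : R) : Es_norm s amplified 0 = A * data_norm s c d.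
Proof.
  rewrite Es_norm_amplified, (Hs_norm_eq_0 (velocity 0)), Rplus_0_r.
  - rewrite (Hs_norm_two_modes (y 0) (even_periodic_modal 0) _ c d).
    + unfold data_norm. do 3 f_equal. replace (2 * (s + / 2)) with (2 * s + 1) by field.
      rewrite Rpower_plus, Rpower_1 by lra. field.
    + intros j. rewrite (proj2 y_modal), duhamel_at_0. unfold linear_mode.
      rewrite Rmult_0_r, cos_0. ring.
  - apply even_periodic_velocity.
  - intros j. rewrite cos_coef_velocity. unfold mode_dt, linear_mode_dt.
    rewrite duhamel_dt_at_0, Rmult_0_r, sin_0. ring.
Qed.

End Amplitude.

End ModalSolution.

(** * Growth of the resonant modes *)

Lemma INR_ge_10 (p : nat) : (10 <= p)%nat -> 10 <= INR p.
Proof. intros p_ge. replace 10 with (INR 10) by (simpl; ring). now apply le_INR. Qed.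

Lemma exp_opp_10_le_pow (p : nat) : (10 <= p)%nat -> exp (-10) <= (1 - 5 * / INR p) ^ p.
Proof.
  intros p_ge_10. pose proof (INR_ge_10 p p_ge_10). set (z := 5 * / INR p).
  assert (z_in : 0 < z <= / 2).
  { assert (0 < / INR p <= / 10)
      by (split; [apply Rinv_0_lt_compat | apply Rinv_le_contravar]; lra).
    unfold z. lra. }
  assert (base : exp (- (2 * z)) <= 1 - z).
  { eapply Rle_trans; [apply exp_opp_le; lra|]. apply Rmult_le_reg_l with (1 + 2 * z); [lra|].
    rewrite Rinv_r by lra. nra. }
  replace (-10) with (INR p * - (2 * z)) by (unfold z; field; lra).
  rewrite <- exp_pow. apply pow_incr. split; [apply Rlt_le, exp_pos | exact base].
Qed.

Lemma linear_wave_periods (c d t x : R) (i : nat) :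
  linear_wave c d (INR i * (2 * PI) + t) x = linear_wave c d t x.
Proof.
  unfold linear_wave. rewrite !(cos_2a_cos).
  replace (INR i * (2 * PI) + t) with (t + 2 * INR i * PI) by ring. now rewrite cos_period.
Qed.

Section ModalGrowth.

Variables (p K : nat) (c d eps m : R) (y : R -> R -> R).

Let T : R := INR K * (2 * PI).
Let mu : R := INR (p - 1) * m.

Hypothesis p_ge_10 : (10 <= p)%nat.
Hypothesis p_even : Nat.Even p.
Hypothesis eps_nonneg : 0 <= eps.
Hypothesis m_pos : 0 < m.
Hypothesis m_le_c : m <= c.
Hypothesis m_le_d : m <= d.
Hypothesis c_plus_d : c + d = 1.
Hypothesis y_modal : modal_solution p T c d eps y.

Lemma concentration_rate_ge : INR p * m / 2 <= mu.
Proof.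
  pose proof (INR_ge_10 p p_ge_10). unfold mu. rewrite minus_INR by lia. simpl INR. nra.
Qed.

Lemma modal_pow_path : wiener_path (weight p) (exp 4) (fun t x => y t x ^ p).
Proof. apply (modal_pow_wiener_path p T c d eps y); auto; lia || lra. Qed.

Lemma continuity_modal_pow (t : R) : continuity (fun x => y t x ^ p).
Proof. apply (wiener_ball_continuity (weight p) (exp 4)), modal_pow_path. Qed.

Lemma modal_near_linear_wave (t x : R) : Rabs (y t x - linear_wave c d t x) <= / INR p.
Proof.
  pose proof (weight_gt_1 p ltac:(lia)).
  apply (wiener_ball_sup (weight p) ltac:(lra) _ (fun x => y t x - linear_wave c d t x)), y_modal.
Qed.

Lemma modal_pow_nonneg (t x : R) : 0 <= y t x ^ p.
Proof. destruct p_even as [k ->]. rewrite pow_mult. apply pow_le, pow2_ge_0. Qed.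

Lemma modal_pow_range (t x : R) : 0 <= y t x ^ p <= 6 * (peak mu t * peak mu (2 * x)).
Proof.
  split; [apply modal_pow_nonneg|]. pose proof (INR_ge_10 p p_ge_10).
  pose proof (Rinv_INR_range p ltac:(lia)) as inv_range.
  pose proof (modal_near_linear_wave t x) as near.
  assert (y_le : Rabs (y t x) <= Rabs (linear_wave c d t x) + / INR p).
  { replace (y t x) with (linear_wave c d t x + (y t x - linear_wave c d t x)) by ring.
    eapply Rle_trans; [apply Rabs_triang|]. lra. }
  assert (y_le_2 : Rabs (y t x) <= 2).
  { pose proof (weight_gt_1 p ltac:(lia)). apply (wiener_ball_sup (weight p) ltac:(lra)).
    apply (modal_slice p T c d eps y); auto; lia || lra. }
  assert (envelope : Rabs (y t x) ^ (p - 1) <= 3 * (peak mu t * peak mu (2 * x))).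
  { eapply Rle_trans; [apply pow_incr; split; [apply Rabs_pos | exact y_le]|].
    apply linear_wave_envelope; try lra.
    rewrite minus_INR, Rmult_minus_distr_r, Rinv_r by (lia || lra). simpl. lra. }
  rewrite <- (Rabs_pos_eq _ (modal_pow_nonneg t x)), <- RPow_abs.
  replace p with (S (p - 1)) at 1 by lia. simpl.
  replace (6 * (peak mu t * peak mu (2 * x)))
    with (2 * (3 * (peak mu t * peak mu (2 * x)))) by ring.
  apply Rmult_le_compat; [apply Rabs_pos | apply pow_le, Rabs_pos | exact y_le_2 | exact envelope].
Qed.

Lemma modal_pow_ge_near_peak (i : nat) (t x : R) : t ^ 2 <= / INR p -> x ^ 2 <= / INR p ->
  exp (-10) <= y (INR i * (2 * PI) + t) x ^ p.
Proof.
  intros t_sq x_sq. pose proof (Rinv_INR_range p ltac:(lia)).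
  assert (inv_le : / INR p <= / 10)
    by (apply Rinv_le_contravar; [lra | apply (INR_ge_10 p p_ge_10)]).
  eapply Rle_trans; [apply (exp_opp_10_le_pow p p_ge_10)|]. apply pow_incr.
  pose proof (modal_near_linear_wave (INR i * (2 * PI) + t) x) as near.
  rewrite linear_wave_periods in near. apply Rabs_le_between in near.
  pose proof (linear_wave_ge c d ltac:(lra) ltac:(lra) c_plus_d (/ INR p) t x ltac:(lra) t_sq x_sq).
  lra.
Qed.

Lemma space_mass_period_ge (i : nat) : exp (-10) * / INR p
  <= RInt (space_mass (fun s x => y s x ^ p)) (INR i * (2 * PI)) (INR i * (2 * PI) + 2 * PI).
Proof.
  pose proof (Rinv_INR_range p ltac:(lia)). pose proof PI2_1. set (k := sqrt (/ INR p)).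
  assert (k_sq : k ^ 2 = / INR p) by (apply pow2_sqrt; lra).
  assert (k_in : 0 <= k <= 1).
  { split; [apply sqrt_pos|]. rewrite <- sqrt_1. apply sqrt_le_1_alt. lra. }
  replace (exp (-10) * / INR p) with (k * (k * exp (-10))) by (rewrite <- k_sq; ring).
  apply RInt_ge_const; [lra | | |].
  - apply continuity_space_mass; [apply modal_pow_path | apply continuity_modal_pow].
  - intros s. apply RInt_nonneg; [lra | apply continuity_modal_pow | apply modal_pow_nonneg].
  - intros s s_in. unfold space_mass. rewrite <- (Rplus_0_l (2 * PI)).
    apply RInt_ge_const; [lra | apply continuity_modal_pow | apply modal_pow_nonneg|].
    intros x x_in. replace s with (INR i * (2 * PI) + (s - INR i * (2 * PI))) by ring.
    apply modal_pow_ge_near_peak; rewrite <- k_sq; apply pow_incr; lra.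
Qed.

Lemma horizon_nonneg : 0 <= T.
Proof. pose proof PI_RGT_0. apply Rmult_le_pos; [apply pos_INR | lra]. Qed.

Lemma modal_phase_loss_le (n : nat) :
  276480 * PI ^ 2 * INR n ^ 2 <= exp (-10) * INR p * m ^ 2 ->
  6 * INR n ^ 2 * phase_loss T (peak mu) (fun x => peak mu (2 * x))
  <= INR K * (exp (-10) * / INR p) / 2.
Proof.
  intros n_small. pose proof (INR_ge_10 p p_ge_10). pose proof (pos_INR K) as K_nonneg.
  assert (pm_pos : 0 < INR p * m) by (apply Rmult_lt_0_compat; lra).
  pose proof concentration_rate_ge as mu_ge.
  apply Rle_trans with (6 * INR n ^ 2 * (5760 * PI ^ 2 * INR K / (INR p * m / 2) ^ 2)).
  - apply Rmult_le_compat_l; [pose proof (pow2_ge_0 (INR n)); lra|].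
    eapply Rle_trans; [apply phase_loss_le; lra|]. apply Rmult_le_compat_l.
    + pose proof (pow2_ge_0 PI). apply Rmult_le_pos; lra.
    + apply Rinv_le_contravar; [apply pow_lt; lra | apply pow_incr; lra].
  - replace (6 * INR n ^ 2 * (5760 * PI ^ 2 * INR K / (INR p * m / 2) ^ 2))
      with (276480 * PI ^ 2 * INR n ^ 2 * (INR K / (2 * (INR p * m) ^ 2))) by (field; lra).
    replace (INR K * (exp (-10) * / INR p) / 2)
      with (exp (-10) * INR p * m ^ 2 * (INR K / (2 * (INR p * m) ^ 2))) by (field; lra).
    apply Rmult_le_compat_r; [|exact n_small]. apply Rmult_le_pos; [exact K_nonneg|].
    apply Rlt_le, Rinv_0_lt_compat. pose proof (pow_lt _ 2 pm_pos). lra.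
Qed.

Lemma cos_moment_forcing_ge (n : nat) : (1 <= n)%nat ->
  276480 * PI ^ 2 * INR n ^ 2 <= exp (-10) * INR p * m ^ 2 ->
  INR K * (exp (-10) / (2 * PI * INR p)) <= cos_moment (INR (4 * n)) (forcing p T y (4 * n)) T.
Proof.
  intros n_ge_1 n_small. pose proof PI_RGT_0 as PI_pos. pose proof (INR_ge_10 p p_ge_10).
  pose proof horizon_nonneg as T_nonneg.
  assert (uncut : cos_moment (INR (4 * n)) (forcing p T y (4 * n)) T
    = cos_moment (INR (4 * n)) (fun s => cos_coef (fun x => y s x ^ p) (4 * n)) T).
  { apply RInt_ext. rewrite Rmin_left, Rmax_right by exact T_nonneg. intros s s_in.
    unfold forcing, force. rewrite cutoff_eq_1, Rmult_1_l by lra. reflexivity. }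
  rewrite uncut.
  eapply Rle_trans; [|apply (cos_moment_cos_coef_ge T 6 (fun s x => y s x ^ p) (peak mu)
    (fun x => peak mu (2 * x))); auto using continuity_modal_pow, continuity_peak,
    continuity_peak_double, modal_pow_range; apply modal_pow_path].
  assert (mass_ge : INR K * (exp (-10) * / INR p)
    <= RInt (space_mass (fun s x => y s x ^ p)) 0 T).
  { apply RInt_blocks_ge; [|apply space_mass_period_ge].
    apply continuity_space_mass; [apply modal_pow_path | apply continuity_modal_pow]. }
  pose proof (modal_phase_loss_le n n_small).
  replace (INR K * (exp (-10) / (2 * PI * INR p)))
    with (/ PI * (INR K * (exp (-10) * / INR p) / 2)) by (field; lra).
  apply Rmult_le_compat_l; [apply Rlt_le, Rinv_0_lt_compat, PI_pos | lra].
Qed.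

Lemma mode_dt_multiple_of_4 (n : nat) : (1 <= n)%nat -> (4 * n < p)%nat ->
  mode_dt p T c d eps y (4 * n) T = - (eps * cos_moment (INR (4 * n)) (forcing p T y (4 * n)) T).
Proof.
  intros n_ge_1 n_lt. pose proof (duhamel_dt_periods (4 * n) K (forcing p T y (4 * n))) as work.
  fold T in work. unfold mode_dt, linear_mode_dt.
  rewrite freq_eq_INR, !kronecker_neq, work by lia. ring.
Qed.

Lemma Es_norm_growth (A s : R) (n : nat) : 0 < A -> 1 <= s -> (1 <= n)%nat -> (8 * n < p)%nat ->
  276480 * PI ^ 2 * INR (2 * n) ^ 2 <= exp (-10) * INR p * m ^ 2 ->
  A * (Rpower (INR n) s * (eps * (INR K * (exp (-10) / (2 * PI * INR p)))))
  <= Es_norm s (amplified y A) T.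
Proof.
  intros A_pos s_ge_1 n_ge_1 n_lt n_small. set (rate := INR K * (exp (-10) / (2 * PI * INR p))).
  pose proof PI_RGT_0. pose proof (INR_ge_10 p p_ge_10). pose proof horizon_nonneg.
  assert (rate_nonneg : 0 <= rate).
  { apply Rmult_le_pos; [apply pos_INR|].
    apply Rlt_le, Rdiv_lt_0_compat; [apply exp_pos | apply Rmult_lt_0_compat; lra]. }
  assert (p_ge_4 : (4 <= p)%nat) by lia.
  assert (c_nonneg : 0 <= c) by lra. assert (d_nonneg : 0 <= d) by lra.
  rewrite (Es_norm_amplified p T c d eps y) by assumption.
  apply Rmult_le_compat_l; [lra|].
  replace s with (s - / 2 + / 2) at 1 by ring.
  pose proof (sqrt_pos (fc_sq (y T) 0 + 2 * Series (Hs_terms (s + / 2) (y T)))) as position_nonneg.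
  fold (Hs_norm (s + / 2) (y T)) in position_nonneg.
  assert (velocity_ge : Rpower (INR n) (s - / 2 + / 2) * (eps * rate)
    <= Hs_norm (s - / 2) (velocity p T c d eps y T)); [|lra].
  apply Hs_norm_ge_multiples_of_4; [lra | now apply Rmult_le_pos | exact n_ge_1 | |].
  - now apply Hs_fin_velocity.
  - intros k k_in. replace (4 * k)%nat with (S (4 * k - 1)) by lia.
    rewrite fc_sq_S_even_periodic by now apply even_periodic_velocity.
    replace (S (4 * k - 1)) with (4 * k)%nat by lia.
    rewrite cos_coef_velocity, mode_dt_multiple_of_4 by (assumption || lia).
    rewrite <- (Rsqr_pow2 (- _)), <- Rsqr_neg, Rsqr_pow2.
    apply Rmult_le_compat_r; [lra|]. apply pow_incr. split; [now apply Rmult_le_pos|].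
    apply Rmult_le_compat_l; [exact eps_nonneg|]. apply cos_moment_forcing_ge; [lia|].
    eapply Rle_trans; [|exact n_small]. apply Rmult_le_compat_l.
    + pose proof (pow2_ge_0 PI). lra.
    + apply pow_incr. split; [apply pos_INR | apply le_INR; lia].
Qed.

End ModalGrowth.

(** * Choice of parameters *)

Lemma sum_inv_freq_le (p n : nat) : sum_f_R0 (fun j => / freq p j) (S n) <= 2 + ln (INR (S n)).
Proof.
  assert (inv_le_1 : forall j, / freq p j <= 1).
  { intros j. rewrite <- Rinv_1. apply Rinv_le_contravar; [lra | apply freq_ge_1]. }
  induction n as [|n IH].
  - simpl. rewrite ln_1. pose proof (inv_le_1 0%nat). pose proof (inv_le_1 1%nat). lra.
  - rewrite tech5.
    assert (n_pos : 0 < INR (S n)) by (apply lt_0_INR; lia).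
    assert (succ_pos : 0 < INR (S (S n))) by (apply lt_0_INR; lia).
    assert (inv_le : / freq p (S (S n)) <= / INR (S (S n)))
      by (apply Rinv_le_contravar; [exact succ_pos | apply INR_le_freq]).
    pose proof (ln_le_minus_1 (INR (S n) * / INR (S (S n)))
      (Rmult_lt_0_compat _ _ n_pos (Rinv_0_lt_compat _ succ_pos))) as ln_ratio.
    rewrite ln_mult, ln_Rinv in ln_ratio by auto using Rinv_0_lt_compat.
    assert (ratio : INR (S n) * / INR (S (S n)) - 1 = - / INR (S (S n)))
      by (rewrite (S_INR (S n)) in *; field; lra).
    lra.
Qed.

Lemma sum_weight_freq_le (p : nat) : (1 <= p)%nat ->
  sum_f_R0 (fun j => weight p ^ j / freq p j) p <= 3 * (2 + ln (INR p)).
Proof.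
  intros p_ge_1. assert (p_pos : 0 < INR p) by (apply lt_0_INR; lia).
  pose proof (Rinv_0_lt_compat _ p_pos) as inv_pos.
  apply Rle_trans with (sum_f_R0 (fun j => / freq p j * 3) p).
  - apply sum_Rle. intros j j_le_p. unfold Rdiv. rewrite Rmult_comm. pose proof (freq_ge_1 p j).
    apply Rmult_le_compat_l; [apply Rlt_le, Rinv_0_lt_compat; lra|].
    apply Rle_trans with (weight p ^ p); [apply Rle_pow; [unfold weight; lra | exact j_le_p]|].
    eapply Rle_trans; [apply pow_one_plus_le_exp; lra|].
    rewrite Rinv_r by lra. apply exp_le_3.
  - rewrite <- scal_sum. apply Rmult_le_compat_l; [lra|].
    pose proof (sum_inv_freq_le p (p - 1)) as harmonic.
    now replace (S (p - 1)) with p in harmonic by lia.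
Qed.

Lemma exp_4_le_81 : exp 4 <= 81.
Proof.
  replace 4 with (INR 4 * 1) by (simpl; ring). rewrite <- exp_pow.
  replace 81 with (3 ^ 4) by ring. apply pow_incr. split; [apply Rlt_le, exp_pos | apply exp_le_3].
Qed.

Lemma log_factor_ge_2 (p : nat) : (1 <= p)%nat -> 2 <= 2 + ln (INR p).
Proof. intros p_ge_1. pose proof (ln_INR_nonneg p p_ge_1). lra. Qed.

Section Existence.

Variables (p K : nat) (c d eps m : R).

Let T : R := INR K * (2 * PI).
Let mu : R := INR (p - 1) * m.

Hypothesis p_ge_10 : (10 <= p)%nat.
Hypothesis K_ge_1 : (1 <= K)%nat.
Hypothesis eps_nonneg : 0 <= eps.
Hypothesis m_pos : 0 < m.
Hypothesis m_le_c : m <= c.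
Hypothesis m_le_d : m <= d.
Hypothesis c_plus_d : c + d = 1.
Hypothesis eps_small : eps * T * (2 + ln (INR p)) <= m / 5000.

Lemma peak_masses_le :
  RInt (fun x => peak mu (2 * x)) 0 (2 * PI)
    * RInt (fun t => 3 * peak mu t) (- (2 * PI)) (T + 2 * PI)
  <= 1296 * PI ^ 2 * INR K / (INR p * m).
Proof.
  pose proof (INR_ge_10 p p_ge_10). pose proof (concentration_rate_ge p m p_ge_10 m_pos) as mu_ge.
  fold mu in mu_ge. assert (pm_pos : 0 < INR p * m) by (apply Rmult_lt_0_compat; lra).
  assert (mu_pos : 0 < mu) by lra. pose proof (peak_mass_pos mu mu_pos) as g_pos.
  pose proof PI_RGT_0. assert (INR 1 <= INR K) as K_ge by now apply le_INR. simpl INR in K_ge.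
  pose proof (continuity_peak mu) as peak_cont.
  assert (time : RInt (fun t => 3 * peak mu t) (- (2 * PI)) (T + 2 * PI)
    <= 18 * INR K * peak_mass mu).
  { rewrite RInt_Rmult by exact peak_cont.
    pose proof (RInt_peak_le mu mu_pos (- (2 * PI)) (2 * (K + 2))) as bound.
    replace (- (2 * PI) + INR (2 * (K + 2)) * PI) with (T + 2 * PI) in bound
      by (unfold T; rewrite mult_INR, plus_INR; simpl; ring).
    rewrite mult_INR, plus_INR in bound. simpl (INR 2) in bound. nra. }
  apply Rle_trans with (2 * peak_mass mu * (18 * INR K * peak_mass mu)).
  - apply Rmult_le_compat; [| |now apply RInt_peak_double_le | exact time].
    + apply RInt_nonneg; [lra | apply continuity_peak_double | intros; apply Rlt_le, peak_pos].
    + apply RInt_nonneg; [|reg|].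
      * pose proof (horizon_nonneg K) as T_nonneg. fold T in T_nonneg. lra.
      * intros t. pose proof (peak_pos mu t). lra.
  - replace (2 * peak_mass mu * (18 * INR K * peak_mass mu))
      with (36 * INR K * peak_mass mu ^ 2) by ring.
    rewrite peak_mass_sq by exact mu_pos.
    replace (36 * INR K * (18 * PI ^ 2 / mu)) with (648 * PI ^ 2 * INR K * / mu) by (field; lra).
    replace (1296 * PI ^ 2 * INR K / (INR p * m)) with (648 * PI ^ 2 * INR K * / (INR p * m / 2))
      by (field; lra).
    apply Rmult_le_compat_l; [|apply Rinv_le_contravar; lra].
    pose proof (pow2_ge_0 PI). apply Rmult_le_pos; lra.
Qed.

Lemma wave_bound_le :
  INR p * wave_bound (weight p) (- (2 * PI)) (T + 2 * PI) p (freq p) (fun t => 3 * peak mu t)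
    (fun x => peak mu (2 * x)) 1 (exp 4)
  <= 2500 * (T * (2 + ln (INR p)) / m).
Proof.
  pose proof (INR_ge_10 p p_ge_10). pose proof PI_RGT_0. pose proof exp_4_le_81.
  pose proof (log_factor_ge_2 p ltac:(lia)) as log_ge.
  assert (INR 1 <= INR K) as K_ge by now apply le_INR. simpl INR in K_ge.
  set (l := 2 + ln (INR p)) in *.
  assert (T_ge : 2 * PI <= T) by (unfold T; nra).
  assert (sum_nonneg : 0 <= sum_f_R0 (fun j => weight p ^ j / freq p j) p).
  { apply cond_pos_sum. intros j. pose proof (freq_ge_1 p j). pose proof (weight_gt_1 p ltac:(lia)).
    apply Rmult_le_pos; [apply pow_le; lra | apply Rlt_le, Rinv_0_lt_compat; lra]. }
  assert (resonant : INR p * (1 / PI * RInt (fun x => peak mu (2 * x)) 0 (2 * PI)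
      * RInt (fun t => 3 * peak mu t) (- (2 * PI)) (T + 2 * PI)
      * sum_f_R0 (fun j => weight p ^ j / freq p j) p) <= 1944 * (T * l / m)).
  { apply Rle_trans with (INR p / PI * (1296 * PI ^ 2 * INR K / (INR p * m) * (3 * l))).
    - rewrite (Rmult_assoc (1 / PI)), (Rmult_assoc (1 / PI)), <- (Rmult_assoc (INR p)).
      replace (INR p * (1 / PI)) with (INR p / PI) by (field; lra).
      apply Rmult_le_compat_l; [apply Rlt_le, Rdiv_lt_0_compat; lra|].
      eapply Rle_trans; [apply Rmult_le_compat_r; [exact sum_nonneg | apply peak_masses_le]|].
      apply Rmult_le_compat_l; [|apply sum_weight_freq_le; lia].
      apply Rlt_le, Rdiv_lt_0_compat; [|apply Rmult_lt_0_compat; lra].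
      pose proof (pow_lt PI 2 ltac:(lra)). nra.
    - apply Req_le. unfold T. field. lra. }
  assert (window : INR p * (exp 4 * (T + 2 * PI - - (2 * PI)) / INR p) <= 243 * T).
  { replace (INR p * (exp 4 * (T + 2 * PI - - (2 * PI)) / INR p))
      with (exp 4 * (T + 4 * PI)) by (field; lra).
    apply Rle_trans with (81 * (3 * T)); [|lra].
    apply Rmult_le_compat; [apply Rlt_le, exp_pos | | |]; lra. }
  assert (T_le : T <= T * l / m).
  { apply Rmult_le_reg_r with m; [exact m_pos|].
    unfold Rdiv. rewrite (Rmult_assoc (T * l)), Rinv_l by lra. nra. }
  unfold wave_bound. rewrite Rmult_plus_distr_l. lra.
Qed.

Lemma modal_solution_exists : exists y, modal_solution p T c d eps y.
Proof.
  pose proof (weight_gt_1 p ltac:(lia)) as weight_gt_1.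
  pose proof (Rinv_INR_range p ltac:(lia)) as inv_range. pose proof (INR_ge_10 p p_ge_10).
  pose proof (horizon_nonneg K) as T_nonneg. fold T in T_nonneg. pose proof PI2_1.
  assert (p_eq : S (p - 1) = p) by lia.
  assert (reg_3_peak : continuity (fun t => 3 * peak mu t))
    by (pose proof (continuity_peak mu); reg).
  destruct (forced_wave_solution (weight p) (- (2 * PI)) (T + 2 * PI) p (freq p) (cutoff T)
    (fun t => 3 * peak mu t) (fun x => peak mu (2 * x))) with (k := (p - 1)%nat) (eps := eps)
    (rho := / INR p) (B := 1 + 3 * / INR p) (Y := linear_wave c d) as (y & y_ball & y_coef);
    auto using continuity_cutoff, cutoff_range, continuity_peak_double; try lra.
  - lia.
  - intros j. pose proof (freq_ge_1 p j). lra.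
  - intros j p_lt_j. eapply Rle_trans; [|apply INR_le_freq]. apply le_INR. lia.
  - intros s s_out. apply cutoff_eq_0. lra.
  - apply wiener_path_linear_wave; lia || lra.
  - intros t x. rewrite Rmult_assoc. apply linear_wave_envelope; try lra.
    rewrite minus_INR, Rmult_minus_distr_r, Rinv_r by (lia || lra). simpl. lra.
  - rewrite p_eq, Rmult_assoc, Rinv_r by lra. lra.
  - rewrite p_eq. apply Rle_trans with (eps * (2500 * (T * (2 + ln (INR p)) / m))).
    + apply Rmult_le_compat_l; [exact eps_nonneg|]. eapply Rle_trans; [|exact wave_bound_le].
      apply Rmult_le_compat_l; [lra|]. apply wave_bound_le_r; [lia | lra|].
      replace (1 + 3 * / INR p + / INR p) with (1 + 4 * / INR p) by ring.
      eapply Rle_trans; [apply pow_one_plus_le_exp; lra|]. apply exp_le_mono.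
      rewrite minus_INR by lia. simpl INR.
      replace ((INR p - 1) * (4 * / INR p)) with (4 - 4 * / INR p) by (field; lra). lra.
    + replace (eps * (2500 * (T * (2 + ln (INR p)) / m)))
        with (2500 * (eps * T * (2 + ln (INR p))) * / m) by (field; lra).
      apply Rmult_le_reg_r with m; [exact m_pos|]. rewrite Rmult_assoc, Rinv_l by lra. lra.
  - exists y. split; [exact y_ball|]. intros t j.
    rewrite y_coef, cos_coef_linear_wave, p_eq. reflexivity.
Qed.

End Existence.

Lemma pow_between_surjective (lo hi X : R) (k : nat) : lo <= hi -> lo ^ k <= X <= hi ^ k ->
  exists v, lo <= v <= hi /\ v ^ k = X.
Proof.
  intros lo_le_hi X_in. destruct (IVT_gen (fun v => v ^ k) lo hi X) as (v & v_in & v_pow).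
  - reg.
  - rewrite Rmin_left, Rmax_right by lra. exact X_in.
  - rewrite Rmin_left, Rmax_right in v_in by exact lo_le_hi. now exists v.
Qed.

Lemma Rpower_2_opp_le_quarter (s : R) : 2 < s -> Rpower 2 (- s) <= / 4.
Proof.
  intros s_gt_2. apply Rle_trans with (Rpower 2 (- INR 2)).
  - apply Rle_Rpower; simpl; lra.
  - rewrite Rpower_Ropp, Rpower_pow by lra. simpl. lra.
Qed.

(* Moving mass between the modes [0] and [2] tunes the norm of the data at fixed sup-norm
   [c + d]. *)
Lemma data_norm_surjective (s v : R) : 2 < s -> 3 / 2 <= v <= 2 ->
  exists d, Rpower 2 (- s) <= d <= 3 / 4 /\ data_norm s (1 - d) d = v.
Proof.
  intros s_gt_2 v_in. set (m := Rpower 2 (- s)). set (R2 := Rpower 2 (2 * s)).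
  assert (m_in : 0 < m <= / 4) by (split; [apply exp_pos | now apply Rpower_2_opp_le_quarter]).
  assert (R2_m : R2 * m ^ 2 = 1).
  { unfold R2, m. rewrite <- Rpower_pow, Rpower_mult, <- Rpower_plus by apply exp_pos.
    replace (2 * s + - s * INR 2) with 0 by (simpl; ring). apply Rpower_O. lra. }
  assert (m_sq : 0 < m ^ 2 <= / 16) by nra. assert (R2_ge : 16 <= R2) by nra.
  assert (low : data_norm s (1 - m) m <= v).
  { unfold data_norm. fold R2. rewrite R2_m, <- (sqrt_pow2 v) by lra. apply sqrt_le_1_alt. nra. }
  assert (high : v <= data_norm s (1 - 3 / 4) (3 / 4)).
  { unfold data_norm. fold R2. rewrite <- (sqrt_pow2 v) by lra. apply sqrt_le_1_alt. nra. }
  destruct (IVT_gen (fun d => data_norm s (1 - d) d) m (3 / 4) v) as (d & d_in & d_eq).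
  - intros d. unfold data_norm.
    apply (continuity_pt_comp (fun d => (1 - d) ^ 2 + Rpower 2 (2 * s) * d ^ 2) sqrt); [reg|].
    apply continuity_pt_sqrt. fold R2.
    pose proof (pow2_ge_0 (1 - d)). pose proof (pow2_ge_0 d). nra.
  - split.
    + eapply Rle_trans; [apply Rmin_l | exact low].
    + eapply Rle_trans; [exact high | apply Rmax_r].
  - rewrite Rmin_left, Rmax_right in d_in by lra. now exists d.
Qed.

Definition time_scale (p : nat) (N : R) : R := 2 ^ p / (INR p * N ^ (p - 1)).

Lemma time_scale_ge (p : nat) (delta : R) : (5 <= p)%nat -> 0 < delta < / 2 ->
  4 * PI <= time_scale p delta.
Proof.
  intros p_ge_5 delta_in. pose proof PI_4. assert (p_pos : 0 < INR p) by (apply lt_0_INR; lia).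
  assert (delta_pow_pos : 0 < delta ^ (p - 1)) by (apply pow_lt; lra).
  assert (p_le_pow : INR p <= 2 ^ p).
  { pose proof (poly p 1 ltac:(lra)) as bernoulli.
    replace (1 + 1) with 2 in bernoulli by ring. lra. }
  assert (delta_pow_le : delta ^ (p - 1) <= / 16).
  { apply Rle_trans with ((/ 2) ^ (p - 1)); [apply pow_incr; lra|].
    rewrite pow_inv. apply Rinv_le_contravar; [lra|].
    apply Rle_trans with (2 ^ 4); [simpl; lra | apply Rle_pow; [lra | lia]]. }
  apply Rle_trans with 16; [lra|]. apply Rmult_le_reg_r with (INR p * delta ^ (p - 1)).
  - now apply Rmult_lt_0_compat.
  - unfold time_scale, Rdiv. rewrite (Rmult_assoc (2 ^ p)), Rinv_l by nra. nra.
Qed.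

Lemma whole_periods_below (X : R) : 4 * PI <= X ->
  exists K, (1 <= K)%nat /\ X / 2 <= INR K * (2 * PI) <= X.
Proof.
  intros X_ge. pose proof PI_RGT_0. set (z := X / (2 * PI)).
  assert (X_eq : X = z * (2 * PI)) by (unfold z; field; lra).
  assert (z_ge : 2 <= z) by (apply Rmult_le_reg_r with (2 * PI); lra).
  destruct (nfloor_ex z ltac:(lra)) as [K [K_le K_gt]].
  assert (K_ge_1 : (1 <= K)%nat) by (destruct K; [simpl in K_gt; lra | lia]).
  exists K. split; [exact K_ge_1|]. rewrite X_eq. split; nra.
Qed.

Section GrowingSolution.

Variables (s delta : R) (p : nat).

Let m : R := Rpower 2 (- s).
Let theta : R := m / (5000 * (2 + ln (INR p))).

Hypothesis s_gt_2 : 2 < s.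
Hypothesis delta_range : 0 < delta < / 2.
Hypothesis p_ge_10 : (10 <= p)%nat.
Hypothesis p_large : 10000 * (2 + ln (INR p)) <= INR p * m.

(* The amplitude is [A = delta / v], where [v] is the norm of the data of amplitude 1; hence
   [eps] times the time scale is [theta] when [v^(p-1) = 2^p / (p theta)]. *)
Lemma normalized_data_exists : exists d,
  m <= d <= 3 / 4 /\ data_norm s (1 - d) d <= 2 /\ 0 < data_norm s (1 - d) d /\
  (delta / data_norm s (1 - d) d) ^ (p - 1) * time_scale p delta = theta.
Proof.
  pose proof (INR_ge_10 p p_ge_10). pose proof (log_factor_ge_2 p ltac:(lia)) as log_ge.
  pose proof (Rpower_2_opp_le_quarter s s_gt_2) as m_le. fold m in m_le.
  assert (m_pos : 0 < m) by apply exp_pos.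
  assert (theta_eq : theta * (5000 * (2 + ln (INR p))) = m) by (unfold theta; field; lra).
  assert (theta_pos : 0 < theta) by (apply Rdiv_lt_0_compat; lra).
  assert (theta_le : theta <= / 40000) by nra.
  assert (p_theta_ge : 2 <= INR p * theta)
    by (apply Rmult_le_reg_r with (5000 * (2 + ln (INR p))); nra).
  assert (pow_p : forall x, x ^ p = x * x ^ (p - 1))
    by (intros x; replace p with (S (p - 1)) at 1 by lia; reflexivity).
  set (X := 2 ^ p / (INR p * theta)).
  assert (X_eq : X * (INR p * theta) = 2 * 2 ^ (p - 1)) by (rewrite <- pow_p; unfold X; field; lra).
  assert (pow_pos : 0 < 2 ^ (p - 1)) by (apply pow_lt; lra).
  assert (X_le : X <= 2 ^ (p - 1)) by (apply Rmult_le_reg_r with (INR p * theta); [lra|]; nra).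
  assert (X_ge : (3 / 2) ^ (p - 1) <= X).
  { pose proof (poly (p - 1) (/ 3) ltac:(lra)) as bernoulli. rewrite minus_INR in bernoulli by lia.
    simpl INR in bernoulli. assert (low_pos : 0 < (3 / 2) ^ (p - 1)) by (apply pow_lt; lra).
    assert (factor : 2 ^ (p - 1) = (3 / 2) ^ (p - 1) * (1 + / 3) ^ (p - 1))
      by (rewrite <- Rpow_mult_distr; f_equal; field).
    apply Rmult_le_reg_r with (INR p * theta); [lra|].
    rewrite X_eq, factor.
    replace (2 * ((3 / 2) ^ (p - 1) * (1 + / 3) ^ (p - 1)))
      with ((3 / 2) ^ (p - 1) * (2 * (1 + / 3) ^ (p - 1))) by ring.
    apply Rmult_le_compat_l; [lra|]. nra. }
  destruct (pow_between_surjective (3 / 2) 2 X (p - 1) ltac:(lra) (conj X_ge X_le))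
    as (v & v_in & v_pow).
  destruct (data_norm_surjective s v s_gt_2 v_in) as (d & d_in & d_norm).
  exists d. rewrite d_norm. split; [exact d_in|]. split; [lra|]. split; [lra|].
  unfold time_scale, Rdiv at 1. rewrite Rpow_mult_distr, pow_inv, v_pow. unfold X.
  pose proof (pow_lt delta (p - 1) ltac:(lra)). pose proof (pow_lt 2 p ltac:(lra)).
  field. repeat split; lra.
Qed.

Lemma growing_solution (n : nat) : Nat.Even p -> (1 <= n)%nat -> (8 * n < p)%nat ->
  276480 * PI ^ 2 * INR (2 * n) ^ 2 <= exp (-10) * INR p * m ^ 2 ->
  exists (u : R -> R -> R) (T : R),
    0 <= T /\ is_solution s p u T /\ Es_norm s u 0 = delta /\
    exp (-10) * m / (80000 * PI ^ 2) * (Rpower (INR n) s / (INR p * (2 + ln (INR p)))) * delta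
      <= Es_norm s u T /\
    time_scale p delta / 2 <= T <= time_scale p delta.
Proof.
  intros p_even n_ge_1 n_lt n_small. pose proof PI_RGT_0. pose proof (INR_ge_10 p p_ge_10).
  pose proof (log_factor_ge_2 p ltac:(lia)) as log_ge.
  assert (m_pos : 0 < m) by apply exp_pos.
  destruct normalized_data_exists as (d & d_in & v_le & v_pos & theta_eq).
  set (v := data_norm s (1 - d) d) in *. set (A := delta / v) in *.
  assert (A_pos : 0 < A) by (apply Rdiv_lt_0_compat; lra).
  assert (A_ge : delta / 2 <= A) by (apply Rmult_le_compat_l; [lra | apply Rinv_le_contravar; lra]).
  pose proof (Rpower_2_opp_le_quarter s s_gt_2) as m_le. fold m in m_le.
  destruct (whole_periods_below (time_scale p delta)) as (K & K_ge_1 & T_range);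
    [apply time_scale_ge; [lia | exact delta_range]|].
  set (T := INR K * (2 * PI)) in *. set (eps := A ^ (p - 1)) in *.
  assert (T_nonneg : 0 <= T) by (apply Rmult_le_pos; [apply pos_INR | lra]).
  assert (eps_pos : 0 < eps) by now apply pow_lt.
  assert (eps_T : theta / 2 <= eps * T <= theta) by (rewrite <- theta_eq; split; nra).
  assert (theta_log : theta * (2 + ln (INR p)) = m / 5000) by (unfold theta; field; lra).
  destruct (modal_solution_exists p K (1 - d) d eps m) as [y y_modal]; try assumption; try lra.
  { fold T. rewrite <- theta_log. apply Rmult_le_compat_r; lra. }
  assert (norm_0 : Es_norm s (amplified y A) 0 = delta).
  { rewrite (Es_norm_amplified_0 p T (1 - d) d eps y); try assumption; try lia; try lra.
    fold v. unfold A. field. lra. }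
  exists (amplified y A), T. split; [|split; [|split; [exact norm_0|split; [|exact T_range]]]].
  - exact T_nonneg.
  - apply (amplified_is_solution p T (1 - d) d eps y); try assumption; try reflexivity; lia || lra.
  - eapply Rle_trans;
      [|apply (Es_norm_growth p K (1 - d) d eps m) with (n := n); try assumption; lra].
    set (rate := Rpower (INR n) s * (exp (-10) / (2 * PI * INR p))).
    assert (rate_pos : 0 < rate).
    { apply Rmult_lt_0_compat; [apply exp_pos|].
      apply Rdiv_lt_0_compat; [apply exp_pos | apply Rmult_lt_0_compat; lra]. }
    apply Rle_trans with (delta / 2 * (theta / 2 / (2 * PI) * rate)).
    + apply Req_le. unfold rate, theta. field. lra.
    + replace (Rpower (INR n) s * (eps * (INR K * (exp (-10) / (2 * PI * INR p)))))
        with (eps * T / (2 * PI) * rate) by (unfold rate, T; field; lra).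
      apply Rmult_le_compat; [lra | | exact A_ge |].
      * apply Rmult_le_pos; [|lra]. apply Rmult_le_pos; [|apply Rlt_le, Rinv_0_lt_compat; lra].
        assert (0 < theta) by (apply Rdiv_lt_0_compat; lra). lra.
      * apply Rmult_le_compat_r; [lra|]. apply Rmult_le_compat_r; [|lra].
        apply Rlt_le, Rinv_0_lt_compat. lra.
Qed.

End GrowingSolution.

Lemma eventually_log_le_Rpower (sigma M : R) : 0 < sigma ->
  eventually (fun p => M * (2 + ln (INR p)) <= Rpower (INR p) sigma).
Proof.
  intros sigma_pos. pose proof (Rabs_pos M) as M_nonneg. pose proof (Rle_abs M).
  assert (inv_pos : 0 < 2 / sigma) by (apply Rdiv_lt_0_compat; lra).
  set (Y := 1 + Rabs M * (2 + 2 / sigma)).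
  assert (Y_ge_1 : 1 <= Y) by (unfold Y; nra).
  destruct (INR_unbounded (Rpower Y (2 / sigma))) as [P P_gt]. exists P. intros p P_le_p.
  apply le_INR in P_le_p. assert (Rpower_pos : 0 < Rpower Y (2 / sigma)) by apply exp_pos.
  assert (p_pos : 0 < INR p) by lra. set (z := Rpower (INR p) (sigma / 2)).
  assert (Y_le_z : Y <= z).
  { rewrite <- (Rpower_1 Y) by lra.
    replace 1 with (2 / sigma * (sigma / 2)) by (field; lra). rewrite <- Rpower_mult.
    apply Rle_Rpower_l; lra. }
  assert (z_sq : Rpower (INR p) sigma = z * z)
    by (unfold z; rewrite <- Rpower_plus; f_equal; field).
  assert (ln_eq : ln (INR p) = 2 / sigma * ln z)
    by (unfold z, Rpower; rewrite ln_exp; field; lra).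
  pose proof (ln_le_minus_1 z ltac:(lra)) as ln_z_le.
  assert (log_nonneg : 0 <= ln z) by (rewrite <- ln_1; apply ln_le; lra).
  rewrite z_sq, ln_eq. apply Rle_trans with (Rabs M * (2 + 2 / sigma) * z).
  - apply Rle_trans with (Rabs M * (2 + 2 / sigma * ln z)).
    + apply Rmult_le_compat_r; [nra | lra].
    + rewrite Rmult_assoc. apply Rmult_le_compat_l; [exact M_nonneg|]. nra.
  - apply Rmult_le_compat_r; unfold Y in *; lra.
Qed.

Lemma eventually_resonant_index (s kappa C : R) : 2 < s -> 0 < kappa ->
  eventually (fun p => exists n, (1 <= n)%nat /\ (8 * n < p)%nat /\
    INR n ^ 2 <= kappa ^ 2 * INR p /\ C <= Rpower (INR n) s / (INR p * (2 + ln (INR p)))).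
Proof.
  intros s_gt_2 kappa_pos. set (D := Rpower (kappa / 2) s).
  assert (D_pos : 0 < D) by apply exp_pos.
  pose proof (filter_and (F := eventually) _ _ (eventually_log_le_Rpower (/ 2) (/ kappa) ltac:(lra))
    (filter_and (F := eventually) _ _ (eventually_log_le_Rpower (/ 2) (8 * kappa) ltac:(lra))
      (eventually_log_le_Rpower (s / 2 - 1) (C / D) ltac:(lra)))) as [P large].
  exists (max 10 P). intros p p_ge. destruct (large p ltac:(lia)) as (large_1 & large_8 & large_s).
  pose proof (INR_ge_10 p ltac:(lia)). pose proof (log_factor_ge_2 p ltac:(lia)) as log_ge.
  rewrite Rpower_sqrt in large_1, large_8 by lra. set (r := sqrt (INR p)) in *.
  assert (r_sq : r * r = INR p) by (apply sqrt_sqrt; lra).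
  assert (kr_ge : 2 <= kappa * r).
  { apply Rle_trans with (kappa * (/ kappa * (2 + ln (INR p)))); [|apply Rmult_le_compat_l; lra].
    rewrite <- Rmult_assoc, Rinv_r, Rmult_1_l by lra. exact log_ge. }
  destruct (nfloor_ex (kappa * r) ltac:(lra)) as [n [n_le n_gt]].
  assert (r_pos : 0 < r) by nra.
  exists n. split; [destruct n; [simpl in n_gt; lra | lia]|]. split; [|split].
  - apply INR_lt. rewrite mult_INR, <- r_sq. replace (INR 8) with 8 by (simpl; ring). nra.
  - rewrite <- r_sq. replace (kappa ^ 2 * (r * r)) with ((kappa * r) ^ 2) by ring.
    apply pow_incr. split; [apply pos_INR | exact n_le].
  - assert (pow_ge : D * (INR p * Rpower (INR p) (s / 2 - 1)) <= Rpower (INR n) s).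
    { apply Rle_trans with (Rpower (kappa / 2 * r) s); [|apply Rle_Rpower_l; lra].
      rewrite <- Rpower_mult_distr by lra. apply Rmult_le_compat_l; [now apply Rlt_le|].
      rewrite <- (Rpower_1 (INR p)) at 1 by lra. rewrite <- Rpower_plus.
      unfold r. rewrite <- Rpower_sqrt, Rpower_mult by lra. apply Req_le. f_equal. field. }
    apply Rmult_le_reg_r with (INR p * (2 + ln (INR p))); [nra|].
    unfold Rdiv. rewrite (Rmult_assoc (Rpower (INR n) s)), Rinv_l, Rmult_1_r by nra.
    eapply Rle_trans; [|exact pow_ge].
    replace (C * (INR p * (2 + ln (INR p)))) with (D * (INR p * (C / D * (2 + ln (INR p)))))
      by (field; lra).
    apply Rmult_le_compat_l; [lra|]. apply Rmult_le_compat_l; [lra | exact large_s].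
Qed.

Lemma eventually_growing_solution (s delta C : R) : 2 < s -> 0 < delta < / 2 ->
  eventually (fun p => Nat.Even p -> exists (u : R -> R -> R) (T : R),
    0 <= T /\ is_solution s p u T /\ Es_norm s u 0 = delta /\ C * delta <= Es_norm s u T /\
    time_scale p delta / 2 <= T <= time_scale p delta).
Proof.
  intros s_gt_2 delta_in. set (m := Rpower 2 (- s)). assert (m_pos : 0 < m) by apply exp_pos.
  set (kappa := m * sqrt (exp (-10) / (1105920 * PI ^ 2))).
  set (gain := exp (-10) * m / (80000 * PI ^ 2)).
  pose proof (exp_pos (-10)) as exp_pos. pose proof (pow_lt PI 2 PI_RGT_0) as PI_sq_pos.
  assert (ratio_pos : 0 < exp (-10) / (1105920 * PI ^ 2)) by (apply Rdiv_lt_0_compat; lra).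
  assert (kappa_pos : 0 < kappa) by (apply Rmult_lt_0_compat; [|apply sqrt_lt_R0]; lra).
  assert (gain_pos : 0 < gain) by (apply Rdiv_lt_0_compat; [apply Rmult_lt_0_compat|]; lra).
  pose proof (filter_and (F := eventually) _ _
    (eventually_resonant_index s kappa (C / gain) s_gt_2 kappa_pos)
    (eventually_log_le_Rpower 1 (10000 / m) ltac:(lra))) as [P large].
  exists (max 10 P). intros p p_ge p_even.
  destruct (large p ltac:(lia)) as ((n & n_ge_1 & n_lt & n_sq_le & n_gain) & p_large).
  pose proof (INR_ge_10 p ltac:(lia)). rewrite Rpower_1 in p_large by lra.
  destruct (growing_solution s delta p s_gt_2 delta_in ltac:(lia)) with (n := n)
    as (u & T & T_nonneg & solution & norm_0 & growth & T_range); try assumption.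
  - fold m. apply (Rmult_le_compat_r m) in p_large; [|lra].
    replace (10000 / m * (2 + ln (INR p)) * m) with (10000 * (2 + ln (INR p))) in p_large
      by (field; lra).
    exact p_large.
  - fold m. replace (exp (-10) * INR p * m ^ 2) with (276480 * PI ^ 2 * (4 * (kappa ^ 2 * INR p))).
    + rewrite mult_INR, Rpow_mult_distr. replace (INR 2) with 2 by (simpl; ring).
      apply Rmult_le_compat_l; lra.
    + unfold kappa. rewrite Rpow_mult_distr, pow2_sqrt by lra. field. exact PI_neq0.
  - exists u, T. repeat (split; [assumption|]). split; [|exact T_range].
    eapply Rle_trans; [|exact growth]. fold m gain. apply Rmult_le_compat_r; [lra|].
    replace C with (gain * (C / gain)) by (field; lra). apply Rmult_le_compat_l; lra.
Qed.

Theorem theorem2p1 :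
  exists C1 C2 delta0 Cbig0 : R,
    0 < C1 /\ C1 < C2 /\ 0 < delta0 /\ 0 < Cbig0 /\
    forall s : R, 2 < s ->
    forall delta : R, 0 < delta < delta0 ->
    forall Cbig : R, Cbig0 < Cbig ->
    exists p0 : nat,
      forall p : nat, (p0 <= p)%nat -> Nat.Even p ->
      exists (u : R -> R -> R) (T : R),
        0 <= T /\
        is_solution s p u T /\
        Es_norm s u 0 <= delta /\
        Es_norm s u T / Es_norm s u 0 >= Cbig /\
        C1 * (2 ^ p / (INR p * Es_norm s u 0 ^ (p - 1))) <= T /\
        T <= C2 * (2 ^ p / (INR p * Es_norm s u 0 ^ (p - 1))).
Proof.
  exists (/ 2), 1, (/ 2), 1. do 4 (split; [lra|]).
  intros s s_gt_2 delta delta_in C _.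
  destruct (eventually_growing_solution s delta C s_gt_2 delta_in) as [p0 growing].
  exists p0. intros p p0_le_p p_even.
  destruct (growing p p0_le_p p_even)
    as (u & T & T_nonneg & solution & norm_0 & growth & T_ge & T_le).
  exists u, T. rewrite norm_0. fold (time_scale p delta).
  do 3 (split; [assumption || lra|]). split; [|lra].
  apply Rle_ge, Rmult_le_reg_r with delta; [lra|].
  unfold Rdiv. rewrite Rmult_assoc, Rinv_l by lra. lra.
Qed.
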